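(* Given a $G$-preflow $X$, the statement ''$\widehat{X}$ is tame'' is $\Delta_1$ (as a property of the preflow $X$).
   Context: A formula of set theory is $\Delta_0$ if it is equivalent over ZFC to one with only bounded quantifiers; $\Sigma_1$ (resp. $\Pi_1$) if equivalent over ZFC to $\exists\bar{x}\,\phi$ (resp. $\forall\bar{x}\,\phi$) with $\phi$ $\Delta_0$; $\Delta_1$ if both $\Sigma_1$ and $\Pi_1$. A topological group is presented as a group $G$ with a base $\mathcal{N}_G$ at $e_G$ for its (Hausdorff) topology; a uniform space is presented as a set $X$ with a base $\mathcal{U}_X$ of regular open entourages for a (Hausdorff) uniformity, with $X\times X\in\mathcal{U}_X$. A $G$-preflow is a precompact uniform space $(X,\mathcal{U}_X)$ on which $G$ acts by uniform isomorphisms such that for every $U\in\mathcal{U}_X$ there is $V\in\mathcal{N}_G$ with $Vx\subseteq U[x]$ for every $x\in X$. Then the action extends continuously to the completion $\widehat{X}$, which is a $G$-flow (a compact space with a continuous left $G$-action). Tameness: given a $G$-flow $Z$, nonempty open $A_0,A_1\subseteq Z$ with $\overline{A_0}\cap\overline{A_1}=\emptyset$ and $S\subseteq G$, the pair $(A_0,A_1)$ shatters $S$ if for every partition $S=S_0\sqcup S_1$ there is $z\in Z$ such that for every $g\in S$ and $i<2$, $gz\in A_i$ iff $g\in S_i$. $Z$ is tame if no such pair $(A_0,A_1)$ shatters an infinite $S\subseteq G$. *)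

(* Defs.v *)
(* Stdlib *)
From Stdlib Require Import Arith List.
Import ListNotations.

(** * First-order formulas in the language {∈}, with named variables *)

Inductive form : Type :=
| fMem (x y : nat)
| fEq (x y : nat)
| fFalse
| fImp (p q : form)
| fAnd (p q : form)
| fOr (p q : form)
| fAll (x : nat) (p : form)
| fEx (x : nat) (p : form).

Definition fIff (p q : form) : form := fAnd (fImp p q) (fImp q p).

Fixpoint free (v : nat) (p : form) : Prop :=
  match p with
  | fMem x y | fEq x y => v = x \/ v = y
  | fFalse => False
  | fImp p q | fAnd p q | fOr p q => free v p \/ free v q
  | fAll x p | fEx x p => v <> x /\ free v p
  end.

Definition upd {M : Type} (v : nat -> M) (x : nat) (a : M) : nat -> M :=
  fun y => if Nat.eqb y x then a else v y.

Fixpoint sat {M : Type} (E : M -> M -> Prop) (v : nat -> M) (p : form) : Prop :=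
  match p with
  | fMem x y => E (v x) (v y)
  | fEq x y => v x = v y
  | fFalse => False
  | fImp p q => sat E v p -> sat E v q
  | fAnd p q => sat E v p /\ sat E v q
  | fOr p q => sat E v p \/ sat E v q
  | fAll x p => forall a : M, sat E (upd v x a) p
  | fEx x p => exists a : M, sat E (upd v x a) p
  end.

Definition models {M : Type} (E : M -> M -> Prop) (T : form -> Prop) : Prop :=
  forall p, T p -> forall v : nat -> M, sat E v p.

(* Free variables of [p] are read as universally quantified.  By completeness
   this is the same as provability of the universal closure of [p] from [T]. *)
Definition entails (T : form -> Prop) (p : form) : Prop :=
  forall (M : Type) (E : M -> M -> Prop),
    models E T -> forall v : nat -> M, sat E v p.

(** * Notation for writing formulas

    A term of type [fm] is a formula that still has to be told the least
    variable it may bind.  A quantifier binds that variable and passes on the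
    next one, so [p n] is free of capture whenever all free variables of [p]
    are below [n]. *)

Definition fm : Type := nat -> form.

Definition mMem (x y : nat) : fm := fun _ => fMem x y.
Definition mEq (x y : nat) : fm := fun _ => fEq x y.
Definition mNot (p : fm) : fm := fun n => fImp (p n) fFalse.
Definition mImp (p q : fm) : fm := fun n => fImp (p n) (q n).
Definition mAnd (p q : fm) : fm := fun n => fAnd (p n) (q n).
Definition mOr (p q : fm) : fm := fun n => fOr (p n) (q n).
Definition mIff (p q : fm) : fm := fun n => fIff (p n) (q n).
Definition mAll (f : nat -> fm) : fm := fun n => fAll n (f n (S n)).
Definition mEx (f : nat -> fm) : fm := fun n => fEx n (f n (S n)).

Declare Scope fm_scope.
Delimit Scope fm_scope with fm.
Bind Scope fm_scope with fm.

Notation "x ∈ y" := (mMem x y) (at level 70, no associativity) : fm_scope.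
Notation "x ≡ y" := (mEq x y) (at level 70, no associativity) : fm_scope.
Notation "¬ p" := (mNot p) (at level 75, right associativity) : fm_scope.
Notation "p ∧ q" := (mAnd p q) (at level 80, right associativity) : fm_scope.
Notation "p ∨ q" := (mOr p q) (at level 85, right associativity) : fm_scope.
Notation "p → q" := (mImp p q) (at level 99, q at level 200, right associativity) : fm_scope.
Notation "p ↔ q" := (mIff p q) (at level 95, no associativity) : fm_scope.
Notation "∀ x , p" := (mAll (fun x => p))
  (at level 200, x name, p at level 200, right associativity) : fm_scope.
Notation "∃ x , p" := (mEx (fun x => p))
  (at level 200, x name, p at level 200, right associativity) : fm_scope.
Notation "∀ x ∈ a , p" := (mAll (fun x => mImp (mMem x a) p))
  (at level 200, x name, a at level 69, p at level 200, right associativity) : fm_scope.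
Notation "∃ x ∈ a , p" := (mEx (fun x => mAnd (mMem x a) p))
  (at level 200, x name, a at level 69, p at level 200, right associativity) : fm_scope.

Local Open Scope fm_scope.

(** * ZFC *)

Definition empty (x : nat) : fm := ¬ (∃ z, z ∈ x).
Definition subset (x y : nat) : fm := ∀ z ∈ x, z ∈ y.
Definition disjoint (x y : nat) : fm := ¬ (∃ z ∈ x, z ∈ y).
(* z = {x, y} *)
Definition upair (z x y : nat) : fm := ∀ w, w ∈ z ↔ (w ≡ x ∨ w ≡ y).
(* z = x ∩ y *)
Definition inter (z x y : nat) : fm := ∀ w, w ∈ z ↔ (w ∈ x ∧ w ∈ y).
(* z = ⋃ x *)
Definition union (z x : nat) : fm := ∀ w, w ∈ z ↔ (∃ y ∈ x, w ∈ y).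
(* z = P(x) *)
Definition power (z x : nat) : fm := ∀ w, w ∈ z ↔ subset w x.
(* z = x ∪ {x} *)
Definition succ (z x : nat) : fm := ∀ w, w ∈ z ↔ (w ∈ x ∨ w ≡ x).
Definition inductive (i : nat) : fm :=
  (∃ z ∈ i, empty z) ∧ (∀ n ∈ i, ∃ s ∈ i, succ s n).

Inductive ZFC : form -> Prop :=
| ax_extensionality : ZFC ((∀ x, ∀ y, (∀ z, z ∈ x ↔ z ∈ y) → x ≡ y) 0)
| ax_foundation : ZFC ((∀ x, ¬ empty x → ∃ y ∈ x, disjoint y x) 0)
| ax_pairing : ZFC ((∀ x, ∀ y, ∃ z, upair z x y) 0)
| ax_union : ZFC ((∀ x, ∃ z, union z x) 0)
| ax_power : ZFC ((∀ x, ∃ z, power z x) 0)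
| ax_infinity : ZFC ((∃ i, inductive i) 0)
| ax_choice : ZFC
    ((∀ u, (∀ x ∈ u, ¬ empty x) ∧
           (∀ x ∈ u, ∀ y ∈ u, ¬ (x ≡ y) → disjoint x y) →
      ∃ c, ∀ x ∈ u, ∃ w, ∀ z, (z ∈ x ∧ z ∈ c) ↔ z ≡ w) 0)
| ax_separation (p : form) (x a b : nat) :
    NoDup [x; a; b] -> ~ free b p ->
    ZFC (fAll a (fEx b (fAll x (fIff (fMem x b) (fAnd (fMem x a) p)))))
| ax_replacement (p : form) (x y z a b : nat) :
    NoDup [x; y; z; a; b] -> ~ free z p -> ~ free b p ->
    ZFC (fAll a (fImp
      (fAll x (fImp (fMem x a) (fEx z (fAll y (fIff p (fEq y z))))))
      (fEx b (fAll y (fIff (fMem y b) (fEx x (fAnd (fMem x a) p))))))).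

(** * The Lévy classes *)

Inductive bounded : form -> Prop :=
| bd_mem x y : bounded (fMem x y)
| bd_eq x y : bounded (fEq x y)
| bd_false : bounded fFalse
| bd_imp p q : bounded p -> bounded q -> bounded (fImp p q)
| bd_and p q : bounded p -> bounded q -> bounded (fAnd p q)
| bd_or p q : bounded p -> bounded q -> bounded (fOr p q)
| bd_all x y p : x <> y -> bounded p -> bounded (fAll x (fImp (fMem x y) p))
| bd_ex x y p : x <> y -> bounded p -> bounded (fEx x (fAnd (fMem x y) p)).

Definition ZFC_equiv (p q : form) : Prop := entails ZFC (fIff p q).

Definition Delta0 (p : form) : Prop := exists q, bounded q /\ ZFC_equiv p q.

Definition Sigma1 (p : form) : Prop :=
  exists (xs : list nat) (q : form),
    Delta0 q /\ ZFC_equiv p (fold_right fEx q xs).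

Definition Pi1 (p : form) : Prop :=
  exists (xs : list nat) (q : form),
    Delta0 q /\ ZFC_equiv p (fold_right fAll q xs).

(* "Given d, the statement p is Δ₁": on the parameters satisfying [d], [p]
   agrees, provably in ZFC, with a Σ₁ formula and with a Π₁ formula. *)
Definition Delta1_given (d p : form) : Prop :=
  (exists s, Sigma1 s /\ entails ZFC (fImp d (fIff p s))) /\
  (exists q, Pi1 q /\ entails ZFC (fImp d (fIff p q))).

(** * Relations, functions, finiteness *)

(* p = ⟨x, y⟩ = {{x}, {x, y}} *)
Definition opair (p x y : nat) : fm := ∀ z, z ∈ p ↔ (upair z x x ∨ upair z x y).

(* ⟨x, y⟩ ∈ r *)
Definition rel (r x y : nat) : fm := ∃ p ∈ r, opair p x y.
(* ⟨⟨x, y⟩, z⟩ ∈ f, that is, f(x, y) = z *)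
Definition app2 (f x y z : nat) : fm := ∃ p ∈ f, ∃ q, opair q x y ∧ opair p q z.

(* r ⊆ x × y *)
Definition relation (r x y : nat) : fm := ∀ p ∈ r, ∃ u ∈ x, ∃ v ∈ y, opair p u v.
(* r = x × y *)
Definition product (r x y : nat) : fm :=
  relation r x y ∧ (∀ u ∈ x, ∀ v ∈ y, rel r u v).

(* f : x → y *)
Definition func (f x y : nat) : fm :=
  relation f x y ∧ (∀ u ∈ x, ∃ v ∈ y, ∀ w, rel f u w ↔ w ≡ v).
(* f : x × y → z *)
Definition func2 (f x y z : nat) : fm := ∃ d, product d x y ∧ func f d z.

Definition natural (n : nat) : fm := ∀ i, inductive i → n ∈ i.
Definition bijection (f x y : nat) : fm :=
  func f x y ∧ (∀ v ∈ y, ∃ u ∈ x, ∀ w ∈ x, rel f w v ↔ w ≡ u).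
Definition finite (x : nat) : fm := ∃ n, natural n ∧ ∃ f, bijection f x n.

(** * Topology.  In [x t], [t] is the set of all open subsets of [x]. *)

Definition topology (x t : nat) : fm :=
  (∀ o ∈ t, subset o x) ∧ x ∈ t ∧
  (∀ o ∈ t, ∀ p ∈ t, ∃ q ∈ t, inter q o p) ∧
  (∀ s, subset s t → ∃ q ∈ t, union q s).

Definition hausdorff (x t : nat) : fm :=
  ∀ u ∈ x, ∀ v ∈ x, ¬ (u ≡ v) →
    ∃ o ∈ t, ∃ p ∈ t, u ∈ o ∧ v ∈ p ∧ disjoint o p.

Definition compact (x t : nat) : fm :=
  ∀ s, subset s t ∧ union x s →
    ∃ r, subset r s ∧ finite r ∧ union x r.

(* the point u belongs to the closure of a *)
Definition in_closure (t a u : nat) : fm := ∀ o ∈ t, u ∈ o → ¬ disjoint o a.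

(* f : x × y → z is (jointly) continuous for the topologies tx, ty, tz *)
Definition continuous2 (x tx y ty tz f : nat) : fm :=
  ∀ u ∈ x, ∀ v ∈ y, ∀ o ∈ tz, (∃ w ∈ o, app2 f u v w) →
    ∃ p ∈ tx, ∃ q ∈ ty, u ∈ p ∧ v ∈ q ∧
      (∀ u' ∈ p, ∀ v' ∈ q, ∃ w ∈ o, app2 f u' v' w).

(** * Topological groups and actions; [m] is the multiplication, [e] the unit *)

Definition group (g m e : nat) : fm :=
  func2 m g g g ∧
  (∀ a ∈ g, ∀ b ∈ g, ∀ c ∈ g, ∀ ab, ∀ bc,
     app2 m a b ab ∧ app2 m b c bc → ∃ d, app2 m ab c d ∧ app2 m a bc d) ∧
  e ∈ g ∧
  (∀ a ∈ g, app2 m e a a ∧ app2 m a e a) ∧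
  (∀ a ∈ g, ∃ b ∈ g, app2 m a b e ∧ app2 m b a e).

Definition top_group (g m e t : nat) : fm :=
  group g m e ∧ topology g t ∧ hausdorff g t ∧
  continuous2 g t g t t m ∧
  (∀ a ∈ g, ∀ b ∈ g, ∀ o ∈ t, app2 m a b e ∧ b ∈ o →
     ∃ p ∈ t, a ∈ p ∧ (∀ a' ∈ p, ∃ b' ∈ o, app2 m a' b' e)).

(* n is a base at the point e for the topology t *)
Definition base_at (n e t : nat) : fm :=
  (∀ v ∈ n, v ∈ t ∧ e ∈ v) ∧ (∀ o ∈ t, e ∈ o → ∃ v ∈ n, subset v o).

(* a : g × x → x is a left action *)
Definition action (g m e x a : nat) : fm :=
  func2 a g x x ∧
  (∀ u ∈ x, app2 a e u u) ∧
  (∀ h ∈ g, ∀ k ∈ g, ∀ u ∈ x, ∀ hk, ∀ ku,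
     app2 m h k hk ∧ app2 a k u ku → ∃ w, app2 a hk u w ∧ app2 a h ku w).

(** * Uniform spaces *)

(* v is the set of all entourages of a uniformity on x *)
Definition uniformity (x v : nat) : fm :=
  (∃ c ∈ v, product c x x) ∧
  (∀ c ∈ v, relation c x x ∧ (∀ u ∈ x, rel c u u)) ∧
  (∀ c ∈ v, ∀ d, relation d x x ∧ subset c d → d ∈ v) ∧
  (∀ c ∈ v, ∀ d ∈ v, ∃ b ∈ v, inter b c d) ∧
  (∀ c ∈ v, ∃ d ∈ v, ∀ u ∈ x, ∀ w ∈ x, rel d u w ↔ rel c w u) ∧
  (∀ c ∈ v, ∃ d ∈ v, ∀ u ∈ x, ∀ w ∈ x, ∀ z ∈ x,
     rel d u w ∧ rel d w z → rel c u z).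

(* t is the topology induced by the uniformity v *)
Definition uniform_topology (x v t : nat) : fm :=
  ∀ o, o ∈ t ↔
    (subset o x ∧ (∀ u ∈ o, ∃ c ∈ v, ∀ w ∈ x, rel c u w → w ∈ o)).

(* ⟨u, w⟩ is in the closure of c ⊆ x × x in the product topology *)
Definition in_closure2 (t c u w : nat) : fm :=
  ∀ o ∈ t, ∀ p ∈ t, u ∈ o ∧ w ∈ p → ∃ u' ∈ o, ∃ w' ∈ p, rel c u' w'.

(* c ⊆ x × x equals the interior of its closure in the product topology *)
Definition regular_open2 (x t c : nat) : fm :=
  ∀ u ∈ x, ∀ w ∈ x, rel c u w ↔
    (∃ o ∈ t, ∃ p ∈ t, u ∈ o ∧ w ∈ p ∧
       (∀ u' ∈ o, ∀ w' ∈ p, in_closure2 t c u' w')).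

(* b is a base of regular open entourages, containing x × x, of a Hausdorff
   uniformity on x *)
Definition uniform_space (x b : nat) : fm :=
  ∃ v, ∃ t, uniformity x v ∧ uniform_topology x v t ∧ hausdorff x t ∧
    subset b v ∧ (∀ c ∈ v, ∃ d ∈ b, subset d c) ∧
    (∀ c ∈ b, regular_open2 x t c) ∧
    (∃ c ∈ b, product c x x).

Definition precompact (x b : nat) : fm :=
  ∀ c ∈ b, ∃ s, subset s x ∧ finite s ∧ (∀ u ∈ x, ∃ w ∈ s, rel c w u).

Definition filter (x f : nat) : fm :=
  (∀ a ∈ f, subset a x ∧ ¬ empty a) ∧ x ∈ f ∧
  (∀ a ∈ f, ∀ b ∈ f, ∃ c ∈ f, inter c a b) ∧
  (∀ a ∈ f, ∀ b, subset a b ∧ subset b x → b ∈ f).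

Definition cauchy (v f : nat) : fm :=
  ∀ c ∈ v, ∃ a ∈ f, ∀ u ∈ a, ∀ w ∈ a, rel c u w.

(* every Cauchy filter converges *)
Definition complete (x v t : nat) : fm :=
  ∀ f, filter x f ∧ cauchy v f → ∃ u ∈ x, ∀ o ∈ t, u ∈ o → o ∈ f.

(* (z, v), with topology t, is the Hausdorff completion of the uniform space
   with base (x, b), via i : x → z *)
Definition completion (x b z v t i : nat) : fm :=
  uniformity z v ∧ uniform_topology z v t ∧ hausdorff z t ∧ complete z v t ∧
  func i x z ∧
  (∀ c ∈ v, ∃ d ∈ b, ∀ u ∈ x, ∀ w ∈ x, ∀ iu, ∀ iw,
     rel i u iu ∧ rel i w iw ∧ rel d u w → rel c iu iw) ∧
  (∀ d ∈ b, ∃ c ∈ v, ∀ u ∈ x, ∀ w ∈ x, ∀ iu, ∀ iw,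
     rel i u iu ∧ rel i w iw ∧ rel c iu iw → rel d u w) ∧
  (∀ o ∈ t, ¬ empty o → ∃ u ∈ x, ∃ iu ∈ o, rel i u iu).

(** * Preflows, flows, tameness *)

(* Each group element acts by a uniform isomorphism: since the inverse of the
   map given by h is the map given by its inverse, uniform continuity of all
   these maps is enough. *)
Definition preflow (g m n x b a : nat) : fm :=
  ∃ e, (∃ t, top_group g m e t ∧ base_at n e t) ∧
    uniform_space x b ∧ precompact x b ∧ action g m e x a ∧
    (∀ h ∈ g, ∀ c ∈ b, ∃ d ∈ b, ∀ u ∈ x, ∀ w ∈ x, ∀ hu, ∀ hw,
       app2 a h u hu ∧ app2 a h w hw ∧ rel d u w → rel c hu hw) ∧
    (∀ c ∈ b, ∃ v ∈ n, ∀ u ∈ x, ∀ h ∈ v, ∀ hu, app2 a h u hu → rel c u hu).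

(* (z, t) is a compact Hausdorff space with a continuous left action a of the
   topological group (g, s) *)
Definition flow (g m e s z t a : nat) : fm :=
  topology z t ∧ hausdorff z t ∧ compact z t ∧
  action g m e z a ∧ continuous2 g s z t t a.

Definition shatters (z a A0 A1 s : nat) : fm :=
  ∀ s0, ∀ s1,
    subset s0 s ∧ subset s1 s ∧ (∀ h ∈ s, h ∈ s0 ∨ h ∈ s1) ∧ disjoint s0 s1 →
    ∃ u ∈ z, ∀ h ∈ s, ∀ hu, app2 a h u hu →
      (hu ∈ A0 ↔ h ∈ s0) ∧ (hu ∈ A1 ↔ h ∈ s1).

Definition tame (g z t a : nat) : fm :=
  ¬ (∃ A0 ∈ t, ∃ A1 ∈ t, ∃ s,
       ¬ empty A0 ∧ ¬ empty A1 ∧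
       ¬ (∃ u ∈ z, in_closure t A0 u ∧ in_closure t A1 u) ∧
       subset s g ∧ ¬ finite s ∧ shatters z a A0 A1 s).

(* The completion of the preflow (x, b, a), with the continuous extension α of
   the action, is a tame flow.  Completion and extension are unique up to
   isomorphism and exist for every preflow, so that "some" and "every" agree. *)
Definition tame_completion (g m n x b a : nat) : fm :=
  ∃ e, ∃ s, top_group g m e s ∧ base_at n e s ∧
    ∃ z, ∃ v, ∃ t, ∃ i, ∃ α,
      completion x b z v t i ∧ flow g m e s z t α ∧
      (∀ h ∈ g, ∀ u ∈ x, ∀ hu, ∀ iu, ∀ ihu,
         app2 a h u hu ∧ rel i u iu ∧ rel i hu ihu → app2 α h iu ihu) ∧
      tame g z t α.

(* Free variables: 0 the set G, 1 its multiplication, 2 the base N_G,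
   3 the set X, 4 the base U_X, 5 the action of G on X. *)
Definition is_preflow : form := preflow 0 1 2 3 4 5 6.
Definition completion_is_tame : form := tame_completion 0 1 2 3 4 5 6.

(* Main.v *)
(* Let (X, B) be the preflow.  By compactness and density of X, the completion is not
   tame iff there are an entourage U in B, finite sets E0, E1 of points of X whose
   U-neighbourhoods U[E0], U[E1] are U-apart, and an infinite S in G such that for any
   disjoint finite F0, F1 in S some u in X satisfies F0 u in U[E0] and F1 u in U[E1].
   The witness (U, E0, E1, S), together with a family of sets that contains all
   finite subsets of S but not S itself, makes non-tameness Sigma_1; here E0 and E1 need
   not be finite.  For fixed U, E0, E1 the absence of an infinite S says that the finite
   sets F with the above property are well-founded under adding one element, and this
   has a Sigma_1 witness: a function r on them with r(F + g) in r(F).  Such an r exists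
   by Mostowski collapse, and conversely foundation excludes an infinite S.  The finite
   E0, E1 range over a family containing all finite subsets of X, so tameness is Sigma_1.
   Existence of the completion as a flow is needed for both directions; its points are
   the round Cauchy filters on X, and compactness comes from ultrafilters via Zorn.

   All this takes place in an arbitrary model of ZFC.  Sets are formed there by
   separation and replacement, so every property used must be definable. *)

From Stdlib Require Import Arith List Lia Classical ClassicalEpsilon.
Require Import Defs.
Import ListNotations.

(** The obstacle is that both matrices must be bounded, whereas [finite], [opair] and the completion
    itself quantify over the whole universe. Finiteness is therefore never expressed: closure of a
    family under adding one element is a bounded condition which, by induction on finite sets,
    forces all finite subsets into the family, whatever else it contains. No bounded condition of
    this kind certifies that a family contains all subsets of X; this is why the Σ₁ form of tameness
    restricts E0 and E1 to finite sets, which precompactness makes sufficient. In that form a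
    ranking function is asked for under bounded universal quantifiers over U, E0, E1. The witnesses
    P and Y bound the ranking functions and their values, so that the matrix stays bounded. Both
    normal forms come from one cycle of implications: tame, no shattering certificate, rank
    certificate, tame. Well-foundedness, finiteness and infinity are always those of the model,
    which may be ill-founded or nonstandard from outside; induction is available for definable
    properties only. *)

Class model (M : Type) := {
  mem : M -> M -> Prop;
  mem_ZFC : models mem ZFC;
  point : M }.

Declare Scope zf_scope.
Open Scope zf_scope.
Notation "x ∈ y" := (mem x y) (at level 70, no associativity) : zf_scope.
Notation "x ∉ y" := (~ mem x y) (at level 70, no associativity) : zf_scope.

(** * Definability with parameters *)

(* De Bruijn variables, and constants that name parameters from the model. *)
Inductive term : Type := Var (k : nat) | Cst (k : nat).

Inductive pf : Type :=
| pMem (s t : term)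
| pEq (s t : term)
| pFalse
| pImp (p q : pf)
| pAll (p : pf).

Definition scons {M : Type} (a : M) (v : nat -> M) (n : nat) : M :=
  match n with 0 => a | S n => v n end.

Section Definability.
Context {M : Type} {HM : model M}.
Implicit Types (v w : nat -> M).

Definition eval w v (t : term) : M :=
  match t with Var k => v k | Cst k => w k end.

Fixpoint psat w v (p : pf) : Prop :=
  match p with
  | pMem s t => eval w v s ∈ eval w v t
  | pEq s t => eval w v s = eval w v t
  | pFalse => False
  | pImp p q => psat w v p -> psat w v q
  | pAll p => forall a, psat w (scons a v) p
  end.

Definition tren (f c : nat -> nat) (t : term) : term :=
  match t with Var k => Var (f k) | Cst k => Cst (c k) end.

Definition up (f : nat -> nat) (n : nat) : nat :=
  match n with 0 => 0 | S n => S (f n) end.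

Fixpoint pren (f c : nat -> nat) (p : pf) : pf :=
  match p with
  | pMem s t => pMem (tren f c s) (tren f c t)
  | pEq s t => pEq (tren f c s) (tren f c t)
  | pFalse => pFalse
  | pImp p q => pImp (pren f c p) (pren f c q)
  | pAll p => pAll (pren (up f) c p)
  end.

Lemma eval_tren f c w v w' v' t :
  (forall k, v' k = v (f k)) -> (forall k, w' k = w (c k)) ->
  eval w v (tren f c t) = eval w' v' t.
Proof. intros Hv Hw; destruct t; simpl; auto. Qed.

Lemma psat_pren p : forall f c w v w' v',
  (forall k, v' k = v (f k)) -> (forall k, w' k = w (c k)) ->
  psat w v (pren f c p) <-> psat w' v' p.
Proof.
  induction p; intros f c w v w' v' Hv Hw; simpl.
  - rewrite !(eval_tren f c w v w' v'); tauto.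
  - rewrite !(eval_tren f c w v w' v'); tauto.
  - tauto.
  - rewrite (IHp1 f c w v w' v'), (IHp2 f c w v w' v'); tauto.
  - assert (H : forall a, psat w (scons a v) (pren (up f) c p)
                          <-> psat w' (scons a v') p).
    { intro a; apply IHp; auto. intros [|k]; simpl; auto. }
    split; intros K a; apply H; apply K.
Qed.

(** A predicate on assignments stands for an open formula, so the closure lemmas can follow Rocq
    connectives instead of syntax trees. Variable 0 is the innermost one: under a binder the outer
    assignment is [fun n => v (S n)]. The parameters from the model sit in [w]. *)
Definition def (Q : (nat -> M) -> Prop) : Prop :=
  exists p w, forall v, psat w v p <-> Q v.

(* The class function [t] has a definable graph. *)
Definition dt (t : (nat -> M) -> M) : Prop :=
  def (fun v => v 0 = t (fun n => v (S n))).

Lemma def_ext Q Q' : (forall v, Q v <-> Q' v) -> def Q -> def Q'.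
Proof.
  intros H (p & w & K). exists p, w. intro v. rewrite K. apply H.
Qed.

Lemma def_ren f Q : def Q -> def (fun v => Q (fun n => v (f n))).
Proof.
  intros (p & w & K). exists (pren f (fun k => k) p), w. intro v.
  rewrite <- K. apply psat_pren; auto.
Qed.

(** Nothing about [P] has to be expressible in the language: it does not depend on the assignment,
    so excluded middle replaces it by a true or a false formula. *)
Lemma def_const (P : Prop) : def (fun _ => P).
Proof.
  destruct (classic P) as [H|H].
  - exists (pImp pFalse pFalse), (fun _ => point). simpl; tauto.
  - exists pFalse, (fun _ => point). simpl; tauto.
Qed.

Lemma def_imp P Q : def P -> def Q -> def (fun v => P v -> Q v).
Proof.
  intros (p & w & K) (p' & w' & K').
  (* Each formula comes with its own parameters. Those of [P] move to the even constants and those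
     of [Q] to the odd ones, so that one valuation serves both. *)
  exists (pImp (pren (fun k => k) (fun k => 2 * k) p)
               (pren (fun k => k) (fun k => 2 * k + 1) p')),
    (fun k => if Nat.even k then w (Nat.div2 k) else w' (Nat.div2 k)).
  intro v. cbn [psat].
  rewrite (psat_pren p) with (v' := v) (w' := w),
    (psat_pren p') with (v' := v) (w' := w'), K, K'; auto; try tauto; intro k.
  - cbv beta. rewrite Nat.even_odd. f_equal. replace (2 * k + 1) with (S (2 * k)) by lia.
    now rewrite Nat.div2_succ_double.
  - cbv beta. rewrite Nat.even_even. f_equal. now rewrite Nat.div2_double.
Qed.

Lemma def_all (R : (nat -> M) -> M -> Prop) :
  def (fun v => R (fun n => v (S n)) (v 0)) -> def (fun v => forall a, R v a).
Proof.
  intros (p & w & K). exists (pAll p), w. intro v. simpl.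
  split; intros H a; specialize (H a).
  - now apply K in H.
  - now apply K.
Qed.

Lemma def_not P : def P -> def (fun v => ~ P v).
Proof. intro H. apply def_imp; [exact H | apply def_const]. Qed.

Lemma def_and P Q : def P -> def Q -> def (fun v => P v /\ Q v).
Proof.
  intros HP HQ. apply def_ext with (fun v => ~ (P v -> ~ Q v)).
  - intro v. tauto.
  - apply def_not, def_imp; [|apply def_not]; assumption.
Qed.

Lemma def_or P Q : def P -> def Q -> def (fun v => P v \/ Q v).
Proof.
  intros HP HQ. apply def_ext with (fun v => ~ P v -> Q v).
  - intro v. tauto.
  - apply def_imp; [apply def_not|]; assumption.
Qed.

Lemma def_iff P Q : def P -> def Q -> def (fun v => P v <-> Q v).
Proof. intros HP HQ. apply def_and; apply def_imp; assumption. Qed.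

Lemma def_ex (R : (nat -> M) -> M -> Prop) :
  def (fun v => R (fun n => v (S n)) (v 0)) -> def (fun v => exists a, R v a).
Proof.
  intro H. apply def_ext with (fun v => ~ forall a, ~ R v a).
  - intro v. split.
    + intro K. apply NNPP. intro K'. apply K. intros a Ha. apply K'. eauto.
    + intros [a Ha] K. now apply (K a).
  - apply def_not. apply (def_all (fun v a => ~ R v a)). now apply def_not.
Qed.

(** [pf] has no function symbols: a defined operation such as a pair or a union is eliminated by
    quantifying over its value. The substitution lemmas below all reduce to this one. *)
Lemma def_let (R : (nat -> M) -> M -> Prop) t :
  dt t -> def (fun v => R (fun n => v (S n)) (v 0)) -> def (fun v => R v (t v)).
Proof.
  intros Ht HR. apply def_ext with (fun v => forall a, a = t v -> R v a).
  - intro v. split; [auto | intros H a ->; exact H].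
  - apply (def_all (fun v a => a = t v -> R v a)). now apply def_imp.
Qed.

Lemma dt_var k : dt (fun v => v k).
Proof. exists (pEq (Var 0) (Var (S k))), (fun _ => point). reflexivity. Qed.

Lemma dt_const a : dt (fun _ => a).
Proof. exists (pEq (Var 0) (Cst 0)), (fun _ => a). reflexivity. Qed.

Lemma dt_shift t : dt t -> dt (fun v => t (fun n => v (S n))).
Proof. intro H. exact (def_ren (up S) _ H). Qed.

Lemma def_sub1 (P : M -> Prop) t :
  def (fun v => P (v 0)) -> dt t -> def (fun v => P (t v)).
Proof. intros HP Ht. apply (def_let (fun _ a => P a)); assumption. Qed.

Lemma def_sub2 (P : M -> M -> Prop) t s :
  def (fun v => P (v 0) (v 1)) -> dt t -> dt s -> def (fun v => P (t v) (s v)).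
Proof.
  intros HP Ht Hs. apply (def_let (fun v a => P a (s v))); auto.
  apply (def_let (fun v a => P (v 0) a)); [now apply dt_shift|].
  exact (def_ren (fun n => match n with 0 => 1 | 1 => 0 | n => n end) _ HP).
Qed.

Lemma def_sub3 (P : M -> M -> M -> Prop) t s r :
  def (fun v => P (v 0) (v 1) (v 2)) -> dt t -> dt s -> dt r ->
  def (fun v => P (t v) (s v) (r v)).
Proof.
  intros HP Ht Hs Hr. apply (def_let (fun v a => P a (s v) (r v))); auto.
  apply (def_let (fun v a => P (v 0) a (r (fun n => v (S n))))); [now apply dt_shift|].
  apply (def_let (fun v a => P (v 1) (v 0) a)).
  { apply (dt_shift (fun v => r (fun n => v (S n)))). now apply dt_shift. }
  exact (def_ren (fun n => match n with 0 => 2 | 1 => 1 | 2 => 0 | n => n end) _ HP).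
Qed.

Lemma dt_sub1 (f : M -> M) t :
  dt (fun v => f (v 0)) -> dt t -> dt (fun v => f (t v)).
Proof.
  intros Hf Ht. apply (def_sub2 (fun b a => b = f a) (fun v => v 0)); auto.
  - apply dt_var.
  - now apply dt_shift.
Qed.

Lemma dt_sub2 (f : M -> M -> M) t s :
  dt (fun v => f (v 0) (v 1)) -> dt t -> dt s -> dt (fun v => f (t v) (s v)).
Proof.
  intros Hf Ht Hs. apply (def_sub3 (fun c a b => c = f a b) (fun v => v 0)); auto.
  - apply dt_var.
  - now apply dt_shift.
  - now apply dt_shift.
Qed.

Lemma def_mem t s : dt t -> dt s -> def (fun v => t v ∈ s v).
Proof.
  apply def_sub2. exists (pMem (Var 0) (Var 1)), (fun _ => point). reflexivity.
Qed.

Lemma def_eq t s : dt t -> dt s -> def (fun v => t v = s v).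
Proof.
  apply (def_sub2 (fun a b => a = b)).
  exists (pEq (Var 0) (Var 1)), (fun _ => point). reflexivity.
Qed.

(* Names of variables: bound variables are [3d + 2], free variables [3k],
   constants [3k + 10]; the names 1, 4 and 7 are kept fresh for the axioms of
   separation and replacement. *)
Definition tname (d : nat) (t : term) : nat :=
  match t with
  | Var k => if k <? d then 3 * (d - 1 - k) + 2 else 3 * (k - d)
  | Cst k => 3 * k + 10
  end.

Fixpoint named (d : nat) (p : pf) : form :=
  match p with
  | pMem s t => fMem (tname d s) (tname d t)
  | pEq s t => fEq (tname d s) (tname d t)
  | pFalse => fFalse
  | pImp p q => fImp (named d p) (named d q)
  | pAll p => fAll (3 * d + 2) (named (S d) p)
  end.

Lemma tname_fresh d t n : n < 3 -> tname d t <> 3 * n + 1.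
Proof. destruct t; simpl; [destruct (k <? d)|]; lia. Qed.

Lemma named_fresh n p : n < 3 -> forall d, ~ free (3 * n + 1) (named d p).
Proof.
  intro Hn; induction p; intro d; simpl named; cbn [free]; try tauto.
  - pose proof (tname_fresh d s n Hn). pose proof (tname_fresh d t n Hn).
    intros [H1|H1]; rewrite H1 in *; tauto.
  - pose proof (tname_fresh d s n Hn). pose proof (tname_fresh d t n Hn).
    intros [H1|H1]; rewrite H1 in *; tauto.
  - specialize (IHp1 d). specialize (IHp2 d). tauto.
  - specialize (IHp (S d)). tauto.
Qed.

Lemma eval_tname d t w v u :
  (forall k, d <= k -> u (3 * (k - d)) = v k) ->
  (forall k, k < d -> u (3 * (d - 1 - k) + 2) = v k) ->
  (forall k, u (3 * k + 10) = w k) ->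
  u (tname d t) = eval w v t.
Proof.
  intros Hv Hb Hw. destruct t; unfold tname, eval.
  - destruct (Nat.ltb_spec k d); auto.
  - auto.
Qed.

Lemma sat_named p : forall d w v u,
  (forall k, d <= k -> u (3 * (k - d)) = v k) ->
  (forall k, k < d -> u (3 * (d - 1 - k) + 2) = v k) ->
  (forall k, u (3 * k + 10) = w k) ->
  sat mem u (named d p) <-> psat w v p.
Proof.
  induction p; intros d w v u Hv Hb Hw; simpl named; cbn [sat psat].
  - rewrite !(eval_tname d _ w v); tauto.
  - rewrite !(eval_tname d _ w v); tauto.
  - tauto.
  - rewrite (IHp1 d w v), (IHp2 d w v); tauto.
  - assert (H : forall a, sat mem (upd u (3 * d + 2) a) (named (S d) p)
                          <-> psat w (scons a v) p).
    { intro a. apply IHp; unfold upd; intro k.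
      - intro Hk. destruct (Nat.eqb_spec (3 * (k - S d)) (3 * d + 2)); [lia|].
        destruct k as [|k]; [lia|]. simpl scons. apply Hv. lia.
      - intro Hk. destruct k as [|k]; simpl scons.
        + replace (S d - 1 - 0) with d by lia. now rewrite Nat.eqb_refl.
        + replace (S d - 1 - S k) with (d - 1 - k) by lia.
          destruct (Nat.eqb_spec (3 * (d - 1 - k) + 2) (3 * d + 2)); [lia|].
          apply Hb. lia.
      - destruct (Nat.eqb_spec (3 * k + 10) (3 * d + 2)); [lia|]. apply Hw. }
    split; intros K a; apply H; apply K.
Qed.

(** Inverse of the naming scheme at depth 0. The values at 1, 4, 7 and at names of bound variables
    are junk on which no formula [named 0 p] depends. *)
Definition assign w v (n : nat) : M :=
  if n mod 3 =? 0 then v (n / 3) else w ((n - 10) / 3).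

Lemma sat_assign p w v u :
  (forall n, n mod 3 = 0 -> u n = assign w v n) ->
  (forall n, 10 <= n -> u n = assign w v n) ->
  sat mem u (named 0 p) <-> psat w v p.
Proof.
  intros H1 H2. apply sat_named.
  - intros k _. rewrite H1; unfold assign.
    + replace (3 * (k - 0)) with (k * 3) by lia.
      now rewrite Nat.Div0.mod_mul, Nat.div_mul.
    + replace (3 * (k - 0)) with (k * 3) by lia. apply Nat.Div0.mod_mul.
  - lia.
  - intro k. rewrite H2; [|lia]. unfold assign.
    replace (3 * k + 10) with (1 + (k + 3) * 3) by lia.
    rewrite Nat.Div0.mod_add. simpl (1 mod 3 =? 0). cbn iota.
    replace (1 + (k + 3) * 3 - 10) with (k * 3) by lia. now rewrite Nat.div_mul.
Qed.

(** * Separation and replacement for definable classes *)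

Definition isset (P : M -> Prop) : Prop := exists s, forall x, x ∈ s <-> P x.

Lemma isset_sep (P : (nat -> M) -> M -> Prop) v a :
  def (fun v => P (fun n => v (S n)) (v 0)) -> isset (fun x => x ∈ a /\ P v x).
Proof.
  intros (p & w & K).
  assert (Hax := mem_ZFC _ (ax_separation (named 0 p) 0 1 4
    ltac:(repeat constructor; simpl; lia) (named_fresh 1 p ltac:(lia) 0))).
  (* Name 0 is the variable of the separated element, so [v] is shifted by one; the [point] at name
     0 is overwritten by the quantifier of the axiom. *)
  specialize (Hax (assign w (scons point v))). cbn [sat fIff] in Hax.
  destruct (Hax a) as [b Hb]. exists b. intro x. specialize (Hb x).
  assert (Hs : sat mem (upd (upd (upd (assign w (scons point v)) 1 a) 4 b) 0 x) (named 0 p)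
               <-> P v x).
  { transitivity (psat w (scons x v) p); [|apply K].
    apply sat_assign; intros n Hn.
    - unfold upd, assign. rewrite Hn.
      destruct n as [|n]; [reflexivity|]. simpl Nat.eqb at 1. cbv iota.
      destruct (Nat.eqb_spec (S n) 4) as [e|e]; [rewrite e in Hn; discriminate|].
      destruct (Nat.eqb_spec (S n) 1) as [e1|e1]; [rewrite e1 in Hn; discriminate|].
      simpl (0 =? 0). cbv iota.
      assert (3 <= S n). { destruct n as [|[|n]]; try discriminate; lia. }
      destruct (S n / 3) eqn:E3; [|reflexivity].
      apply Nat.div_small_iff in E3; lia.
    - unfold upd, assign.
      destruct (Nat.eqb_spec n 0); [lia|]. destruct (Nat.eqb_spec n 4); [lia|].
      destruct (Nat.eqb_spec n 1); [lia|].
      destruct (n mod 3 =? 0); [|reflexivity].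
      destruct (n / 3) eqn:E3; [|reflexivity].
      apply Nat.div_small_iff in E3; lia. }
  rewrite Hs in Hb. unfold upd in Hb; cbn in Hb. split; apply Hb.
Qed.

Lemma isset_repl (P : (nat -> M) -> M -> M -> Prop) v a :
  def (fun v => P (fun n => v (S (S n))) (v 0) (v 1)) ->
  (forall x, x ∈ a -> exists z, forall y, P v x y <-> y = z) ->
  isset (fun y => exists x, x ∈ a /\ P v x y).
Proof.
  intros (p & w & K) Hfun.
  assert (Hax := mem_ZFC _ (ax_replacement (named 0 p) 0 3 7 1 4
    ltac:(repeat constructor; simpl; lia) (named_fresh 2 p ltac:(lia) 0)
    (named_fresh 1 p ltac:(lia) 0))).
  (* Names 0 and 3 are the argument and value variables of the axiom, so [v] is shifted by two. *)
  set (v0 := assign w (scons point (scons point v))).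
  specialize (Hax v0). cbn [sat fIff] in Hax. specialize (Hax a).
  assert (Hs : forall u x y,
    (forall n, n <> 0 -> n <> 3 -> n <> 1 -> n <> 4 -> n <> 7 -> u n = v0 n) ->
    u 0 = x -> u 3 = y -> sat mem u (named 0 p) <-> P v x y).
  { intros u x y Hu <- <-. transitivity (psat w (scons (u 0) (scons (u 3) v)) p); [|apply K].
    apply sat_assign; intros n Hn.
    - destruct (Nat.eq_dec n 0) as [->|e0]; [reflexivity|].
      destruct (Nat.eq_dec n 3) as [->|e3]; [reflexivity|].
      rewrite Hu; auto; try (intros ->; discriminate).
      unfold v0, assign. rewrite Hn. simpl (0 =? 0). cbv iota.
      assert (6 <= n). { destruct n as [|[|[|[|[|[|n]]]]]]; try discriminate; lia. }
      assert (2 <= n / 3). { apply Nat.div_le_lower_bound; lia. }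
      destruct (n / 3) as [|[|k]]; try lia; reflexivity.
    - rewrite Hu by lia. unfold v0, assign. destruct (n mod 3 =? 0); [|reflexivity].
      assert (2 <= n / 3). { apply Nat.div_le_lower_bound; lia. }
      destruct (n / 3) as [|[|k]]; try lia; reflexivity. }
  destruct Hax as [b Hb].
  - intros x Hx. cbn in Hx. destruct (Hfun x Hx) as [z Hz]. exists z. intro y.
    assert (Hxy := Hs (upd (upd (upd (upd v0 1 a) 0 x) 7 z) 3 y) x y).
    rewrite Hxy; try reflexivity.
    + cbn. split; apply Hz.
    + intros n ? ? ? ? ?. unfold upd.
      repeat match goal with |- context [n =? ?k] =>
        destruct (Nat.eqb_spec n k); [lia|] end. reflexivity.
  - exists b. intro y. specialize (Hb y).
    assert (Hxy : forall x, sat mem (upd (upd (upd (upd v0 1 a) 4 b) 3 y) 0 x) (named 0 p)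
      <-> P v x y).
    { intro x. apply Hs; try reflexivity. intros n ? ? ? ? ?. unfold upd.
      repeat match goal with |- context [n =? ?k] =>
        destruct (Nat.eqb_spec n k); [lia|] end. reflexivity. }
    cbn in Hb. destruct Hb as [Hb1 Hb2]. split.
    + intro H. destruct (Hb1 H) as (x & Hx & Hp). exists x. split; auto.
      now apply Hxy.
    + intros (x & Hx & Hp). apply Hb2. exists x. split; auto. now apply Hxy.
Qed.

End Definability.

(** * Set operations *)

Notation "a ⊆ b" := (forall z, mem z a -> mem z b)
  (at level 70, no associativity) : zf_scope.

(** [dfn] proves definability by recursion on the shape of a Rocq predicate. The hook is redefined
    once the set operations are known to be definable. Predicates and functions that are variables
    are discharged by a definability hypothesis, and remaining notions are unfolded through the hint
    database. *)
Ltac dfn_hook := fail.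

Ltac dfn :=
  cbv beta;
  lazymatch goal with
  | |- def (fun _ => ?P) => apply def_const
  | |- def (fun v => @?A v /\ @?B v) => apply (def_and A B); dfn
  | |- def (fun v => @?A v \/ @?B v) => apply (def_or A B); dfn
  | |- def (fun v => @?A v <-> @?B v) => apply (def_iff A B); dfn
  | |- def (fun v => ~ @?A v) => apply (def_not A); dfn
  | |- def (fun v => @?A v -> @?B v) => apply (def_imp A B); dfn
  | |- def (fun v => forall a, @?R v a) => apply (def_all R); dfn
  | |- def (fun v => exists a, @?R v a) => apply (def_ex R); dfn
  | |- def (fun v => @?s v ∈ @?t v) => apply (def_mem s t); dfn
  | |- def (fun v => @?s v = @?t v) => apply (def_eq s t); dfn
  | |- dt (fun v => v _) => apply dt_var
  | |- dt (fun _ => ?c) => apply dt_const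
  | |- _ => first
      [ dfn_hook
      | match goal with
        | |- def (fun v => ?P (@?t v)) => apply (def_sub1 P t); [assumption|dfn]
        | |- def (fun v => ?P (@?t v) (@?s v)) =>
            apply (def_sub2 P t s); [assumption|dfn|dfn]
        | |- dt (fun v => ?P (@?t v)) => apply (dt_sub1 P t); [assumption|dfn]
        end
      | progress autounfold with dfn; dfn ]
  end.

Section Sets.
Context {M : Type} {HM : model M}.

Lemma set_ext (x y : M) : (forall z, z ∈ x <-> z ∈ y) -> x = y.
Proof. apply (mem_ZFC _ ax_extensionality (fun _ => point)). Qed.

(* Junk unless the class [P] is a set. *)
Definition setof (P : M -> Prop) : M :=
  epsilon (inhabits point) (fun s => forall x, x ∈ s <-> P x).

Lemma in_setof (P : M -> Prop) : isset P -> forall x, x ∈ setof P <-> P x.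
Proof.
  intro H. exact (epsilon_spec (inhabits point) (fun s => forall x, x ∈ s <-> P x) H).
Qed.

Lemma isset_sub (P : M -> Prop) a :
  def (fun v => P (v 0)) -> (forall x, P x -> x ∈ a) -> isset P.
Proof.
  intros HP Ha. destruct (isset_sep (fun _ => P) (fun _ => point) a HP) as [s Hs].
  exists s. intro x. rewrite Hs. split; [tauto|]. auto.
Qed.

(** The operator [epsilon] is not definable, but extensionality makes the graph of [setof]
    definable: a set is determined by the condition that its elements are those satisfying [R v]. *)
Lemma dt_setof (R : (nat -> M) -> M -> Prop) :
  (forall v, isset (R v)) -> def (fun v => R (fun n => v (S n)) (v 0)) ->
  dt (fun v => setof (R v)).
Proof.
  intros Hs HR. apply def_ext with
    (fun v => forall x, x ∈ v 0 <-> R (fun n => v (S n)) x).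
  - intro v. split.
    + intro H. apply set_ext. intro z. rewrite H, in_setof; auto. tauto.
    + intros H x. rewrite H, in_setof; auto. tauto.
  - apply (def_all (fun v x => x ∈ v 0 <-> R (fun n => v (S n)) x)).
    apply def_iff; [dfn|]. exact (def_ren (up S) _ HR).
Qed.

Definition Sep (a : M) (P : M -> Prop) : M := setof (fun x => x ∈ a /\ P x).

Lemma in_Sep a P : def (fun v => P (v 0)) -> forall x, x ∈ Sep a P <-> x ∈ a /\ P x.
Proof. intro HP. apply in_setof, isset_sub with a; [dfn | tauto]. Qed.

Lemma dt_Sep a (P : (nat -> M) -> M -> Prop) :
  dt a -> def (fun v => P (fun n => v (S n)) (v 0)) -> dt (fun v => Sep (a v) (P v)).
Proof.
  intros Ha HP. apply dt_setof.
  - intro v. now apply isset_sep.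
  - apply def_and; auto. apply def_mem; [dfn|]. now apply dt_shift.
Qed.

Definition Img (a : M) (f : M -> M) : M :=
  setof (fun y => exists x, x ∈ a /\ y = f x).

Lemma isset_img a (f : (nat -> M) -> M -> M) v :
  dt (fun v => f (fun n => v (S n)) (v 0)) ->
  isset (fun y => exists x, x ∈ a /\ y = f v x).
Proof.
  intro Hf. apply isset_repl with (P := fun v x y => y = f v x).
  - exact (def_ren (fun n => match n with 0 => 1 | 1 => 0 | n => n end) _ Hf).
  - intros x _. exists (f v x). tauto.
Qed.

Lemma in_Img a f : dt (fun v => f (v 0)) ->
  forall y, y ∈ Img a f <-> exists x, x ∈ a /\ y = f x.
Proof.
  intro Hf. apply in_setof.
  apply (isset_img a (fun _ => f) (fun _ => point)). exact Hf.
Qed.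

Lemma dt_Img a (f : (nat -> M) -> M -> M) :
  dt a -> dt (fun v => f (fun n => v (S n)) (v 0)) -> dt (fun v => Img (a v) (f v)).
Proof.
  intros Ha Hf. apply dt_setof.
  - intro v. now apply isset_img.
  - apply (def_ex (fun v x => x ∈ a (fun n => v (S n)) /\ v 0 = f (fun n => v (S n)) x)).
    apply def_and.
    + apply def_mem; [dfn|]. apply (dt_shift (fun v => a (fun n => v (S n)))).
      now apply dt_shift.
    + exact (def_ren (fun n => match n with 0 => 1 | 1 => 0 | n => n end) _ Hf).
Qed.

Definition Emp : M := setof (fun _ => False).
Definition Upair (x y : M) : M := setof (fun z => z = x \/ z = y).
Definition Union (x : M) : M := setof (fun z => exists y, y ∈ x /\ z ∈ y).
Definition Pow (x : M) : M := setof (fun z => z ⊆ x).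
Definition Cup (x y : M) : M := Union (Upair x y).
Definition Add (s x : M) : M := Cup s (Upair x x).
Definition Cap (x y : M) : M := Sep x (fun z => z ∈ y).
Definition Diff (x y : M) : M := Sep x (fun z => z ∉ y).
Definition Pair (x y : M) : M := Upair (Upair x x) (Upair x y).
Definition Prod (a b : M) : M := Union (Img a (fun x => Img b (fun y => Pair x y))).
(** For a functional [f] the separated set is the singleton of the value, and the outer union
    extracts it. Second components of Kuratowski pairs in [f] lie in [Union (Union f)]. Being total,
    [App] can occur in definable terms without side conditions. *)
Definition App (f x : M) : M :=
  Union (Sep (Union (Union f)) (fun y => Pair x y ∈ f)).
Definition Rsep (a b : M) (R : M -> M -> Prop) : M :=
  Sep (Prod a b) (fun p => exists x y, p = Pair x y /\ R x y).
Definition Lam (a : M) (f : M -> M) : M := Img a (fun x => Pair x (f x)).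

Lemma in_Emp x : x ∈ Emp <-> False.
Proof. apply in_setof, isset_sub with point; [dfn | tauto]. Qed.

Lemma isset_Upair x y : isset (fun z => z = x \/ z = y).
Proof.
  destruct (mem_ZFC _ ax_pairing (fun _ => point) x y) as [z Hz].
  exists z. intro w. exact (Hz w).
Qed.

Lemma in_Upair x y z : z ∈ Upair x y <-> z = x \/ z = y.
Proof. apply in_setof, isset_Upair. Qed.

Lemma isset_Union x : isset (fun z => exists y, y ∈ x /\ z ∈ y).
Proof.
  destruct (mem_ZFC _ ax_union (fun _ => point) x) as [z Hz].
  exists z. intro w. exact (Hz w).
Qed.

Lemma in_Union x z : z ∈ Union x <-> exists y, y ∈ x /\ z ∈ y.
Proof. apply in_setof, isset_Union. Qed.

Lemma isset_Pow x : isset (fun z => z ⊆ x).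
Proof.
  destruct (mem_ZFC _ ax_power (fun _ => point) x) as [z Hz].
  exists z. intro w. exact (Hz w).
Qed.

Lemma in_Pow x z : z ∈ Pow x <-> z ⊆ x.
Proof. apply in_setof, isset_Pow. Qed.

Lemma in_Cup x y z : z ∈ Cup x y <-> z ∈ x \/ z ∈ y.
Proof.
  unfold Cup. rewrite in_Union. setoid_rewrite in_Upair. firstorder (subst; auto).
Qed.

Lemma in_Add s x z : z ∈ Add s x <-> z ∈ s \/ z = x.
Proof. unfold Add. rewrite in_Cup, in_Upair. tauto. Qed.

Lemma in_Cap x y z : z ∈ Cap x y <-> z ∈ x /\ z ∈ y.
Proof. unfold Cap. rewrite in_Sep by dfn. tauto. Qed.

Lemma in_Diff x y z : z ∈ Diff x y <-> z ∈ x /\ z ∉ y.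
Proof. unfold Diff. rewrite in_Sep by dfn. tauto. Qed.

Lemma dt_Upair t s : dt t -> dt s -> dt (fun v => Upair (t v) (s v)).
Proof.
  apply dt_sub2. apply (dt_setof (fun v z => z = v 0 \/ z = v 1)); [|dfn].
  intro. apply isset_Upair.
Qed.

Lemma dt_Union t : dt t -> dt (fun v => Union (t v)).
Proof.
  apply dt_sub1. apply (dt_setof (fun v z => exists y, y ∈ v 0 /\ z ∈ y)); [|dfn].
  intro. apply isset_Union.
Qed.

Lemma dt_Pow t : dt t -> dt (fun v => Pow (t v)).
Proof.
  apply dt_sub1. apply (dt_setof (fun v z => z ⊆ v 0)); [|dfn].
  intro. apply isset_Pow.
Qed.

Lemma dt_Pair t s : dt t -> dt s -> dt (fun v => Pair (t v) (s v)).
Proof. intros. repeat apply dt_Upair; auto. Qed.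

Lemma dt_Cup t s : dt t -> dt s -> dt (fun v => Cup (t v) (s v)).
Proof. intros. apply dt_Union, dt_Upair; auto. Qed.

Lemma dt_Add t s : dt t -> dt s -> dt (fun v => Add (t v) (s v)).
Proof. intros. apply dt_Cup; auto. apply dt_Upair; auto. Qed.

Lemma dt_Cap t s : dt t -> dt s -> dt (fun v => Cap (t v) (s v)).
Proof. apply dt_sub2. apply (dt_Sep (fun v => v 0) (fun v z => z ∈ v 1)); dfn. Qed.

Lemma dt_Diff t s : dt t -> dt s -> dt (fun v => Diff (t v) (s v)).
Proof. apply dt_sub2. apply (dt_Sep (fun v => v 0) (fun v z => z ∉ v 1)); dfn. Qed.

End Sets.

Ltac dfn_hook ::=
  lazymatch goal with
  | |- dt (fun v => Sep (@?a v) (@?P v)) => apply (dt_Sep a P); dfn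
  | |- dt (fun v => Img (@?a v) (@?f v)) => apply (dt_Img a f); dfn
  | |- dt (fun v => Upair (@?a v) (@?b v)) => apply (dt_Upair a b); dfn
  | |- dt (fun v => Pair (@?a v) (@?b v)) => apply (dt_Pair a b); dfn
  | |- dt (fun v => Union (@?a v)) => apply (dt_Union a); dfn
  | |- dt (fun v => Pow (@?a v)) => apply (dt_Pow a); dfn
  | |- dt (fun v => Cup (@?a v) (@?b v)) => apply (dt_Cup a b); dfn
  | |- dt (fun v => Add (@?a v) (@?b v)) => apply (dt_Add a b); dfn
  | |- dt (fun v => Cap (@?a v) (@?b v)) => apply (dt_Cap a b); dfn
  | |- dt (fun v => Diff (@?a v) (@?b v)) => apply (dt_Diff a b); dfn
  end.

Create HintDb dfn.
#[export] Hint Unfold Prod App Rsep Lam : dfn.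

(** * Ordered pairs, relations as sets, foundation *)

Section Pairs.
Context {M : Type} {HM : model M}.

Lemma Upair_inj (x y x' y' : M) :
  Upair x y = Upair x' y' -> (x = x' /\ y = y') \/ (x = y' /\ y = x').
Proof.
  intro H.
  assert (K : forall z, (z = x \/ z = y) <-> (z = x' \/ z = y')).
  { intro z. now rewrite <- !in_Upair, H. }
  destruct (proj1 (K x)), (proj1 (K y)), (proj2 (K x')), (proj2 (K y')); subst; auto.
Qed.

Lemma Pair_inj (x y x' y' : M) : Pair x y = Pair x' y' <-> x = x' /\ y = y'.
Proof.
  split; [|intros [-> ->]; reflexivity]. intro H.
  apply Upair_inj in H.
  destruct H as [[H1 H2]|[H1 H2]]; apply Upair_inj in H1; apply Upair_inj in H2;
    intuition congruence.
Qed.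

Lemma in_Prod (a b p : M) : p ∈ Prod a b <-> exists x y, x ∈ a /\ y ∈ b /\ p = Pair x y.
Proof.
  unfold Prod. rewrite in_Union. split.
  - intros (s & Hs & Hp). rewrite in_Img in Hs by dfn. destruct Hs as (x & Hx & ->).
    rewrite in_Img in Hp by dfn. destruct Hp as (y & Hy & ->). eauto.
  - intros (x & y & Hx & Hy & ->). exists (Img b (Pair x)). split.
    + apply in_Img; [dfn|]. eauto.
    + apply in_Img; [dfn|]. eauto.
Qed.

Lemma Pair_in_Prod (a b x y : M) : Pair x y ∈ Prod a b <-> x ∈ a /\ y ∈ b.
Proof.
  rewrite in_Prod. split.
  - intros (x' & y' & Hx & Hy & H). apply Pair_inj in H. destruct H; subst; auto.
  - intros []. eauto.
Qed.

Lemma in_Rsep (a b : M) R : def (fun v => R (v 0) (v 1)) ->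
  forall x y, Pair x y ∈ Rsep a b R <-> x ∈ a /\ y ∈ b /\ R x y.
Proof.
  intros HR x y. unfold Rsep. rewrite in_Sep by dfn. rewrite Pair_in_Prod. split.
  - intros ((Hx & Hy) & x' & y' & H & K). apply Pair_inj in H. destruct H; subst; auto.
  - intros (Hx & Hy & H). split; auto. eauto.
Qed.

Lemma Rsep_sub (a b : M) R : def (fun v => R (v 0) (v 1)) -> Rsep a b R ⊆ Prod a b.
Proof. intros HR p. unfold Rsep. rewrite in_Sep by dfn. tauto. Qed.

Lemma App_eq (f x y : M) : Pair x y ∈ f -> (forall y', Pair x y' ∈ f -> y' = y) ->
  App f x = y.
Proof.
  intros H Hu. apply set_ext. intro z. unfold App. rewrite in_Union. split.
  - intros (y' & Hy' & Hz). rewrite in_Sep in Hy' by dfn. destruct Hy' as [_ Hy'].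
    now rewrite <- (Hu _ Hy').
  - intro Hz. exists y. split; auto. apply in_Sep; [dfn|]. split; auto.
    apply in_Union. exists (Upair x y). split; [|apply in_Upair; auto].
    apply in_Union. exists (Pair x y). split; auto. apply in_Upair; auto.
Qed.

Lemma in_Lam (a : M) f : dt (fun v => f (v 0)) ->
  forall x y, Pair x y ∈ Lam a f <-> x ∈ a /\ y = f x.
Proof.
  intros Hf x y. unfold Lam. rewrite in_Img by dfn. setoid_rewrite Pair_inj.
  split; [intros (x' & H & -> & ->) | intros []]; eauto.
Qed.

Lemma foundation (a x : M) : x ∈ a -> exists y, y ∈ a /\ forall z, z ∈ y -> z ∉ a.
Proof.
  intro Hx. destruct (mem_ZFC _ ax_foundation (fun _ => point) a) as (y & Hy & H).
  - intro K. apply K. now exists x.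
  - exists y. split; [exact Hy|]. intros z Hz Hza. apply H. now exists z.
Qed.

Lemma mem_irrefl (x : M) : x ∉ x.
Proof.
  intro H. destruct (foundation (Upair x x) x) as (y & Hy & K).
  - apply in_Upair; auto.
  - apply in_Upair in Hy. assert (y = x) by tauto. subst y.
    apply (K x H). apply in_Upair; auto.
Qed.

End Pairs.

(** * Finite sets *)

Section Finite.
Context {M : Type} {HM : model M}.

(** These predicates, like those on topologies, uniformities, actions and flows below, copy the
    formulas of the statement quantifier by quantifier, so that evaluation can match formula and
    predicate node by node. *)
Definition Ind (i : M) : Prop := Emp ∈ i /\ forall n, n ∈ i -> Add n n ∈ i.
Definition Natural (n : M) : Prop := forall i, Ind i -> n ∈ i.
Definition Func (f x y : M) : Prop :=
  f ⊆ Prod x y /\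
  forall u, u ∈ x -> exists v, v ∈ y /\ forall w, Pair u w ∈ f <-> w = v.
Definition Biject (f x y : M) : Prop :=
  Func f x y /\
  forall v, v ∈ y -> exists u, u ∈ x /\ forall w, w ∈ x -> (Pair w v ∈ f <-> w = u).
Definition Finite (x : M) : Prop := exists n, Natural n /\ exists f, Biject f x n.
End Finite.

#[export] Hint Unfold Ind Natural Func Biject Finite : dfn.

Section FiniteSets.
Context {M : Type} {HM : model M}.

(** Cutting a set given by the axiom of infinity down to the natural numbers with [P] leaves an
    inductive set, which every natural number belongs to. *)
Lemma Natural_ind (P : M -> Prop) : def (fun v => P (v 0)) -> P Emp ->
  (forall n, Natural n -> P n -> P (Add n n)) -> forall n, Natural n -> P n.
Proof.
  intros HP H0 HS n Hn.
  destruct (mem_ZFC _ ax_infinity (fun _ => point)) as (i & Hi0 & HiS).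
  set (s := Sep i (fun n => Natural n /\ P n)).
  assert (Hs : forall n, n ∈ s <-> n ∈ i /\ Natural n /\ P n).
  { apply in_Sep. dfn. }
  apply Hs, Hn. split.
  - apply Hs. destruct Hi0 as (z & Hz & Hz').
    assert (z = Emp) as ->.
    { apply set_ext. intro w. rewrite in_Emp. split; [|tauto]. intro. apply Hz'. now exists w. }
    split; [exact Hz|]. split; [|exact H0]. intros j Hj. apply Hj.
  - intros k Hk. apply Hs in Hk. destruct Hk as (Hk & Hk' & HPk). apply Hs.
    destruct (HiS k Hk) as (s' & Hs' & E).
    assert (s' = Add k k) as ->.
    { apply set_ext. intro w. rewrite in_Add. exact (E w). }
    split; [exact Hs'|]. split; [|now apply HS].
    intros j Hj. apply Hj, Hk', Hj.
Qed.

Lemma Natural_Emp : Natural Emp.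
Proof. intros i Hi. apply Hi. Qed.

Lemma Natural_Add n : Natural n -> Natural (Add n n).
Proof. intros Hn i Hi. apply Hi, Hn, Hi. Qed.

Lemma Func_dom (f x y u v : M) : Func f x y -> Pair u v ∈ f -> u ∈ x /\ v ∈ y.
Proof. intros [H _] K. apply H, Pair_in_Prod in K. exact K. Qed.

Lemma Func_uniq (f x y u v v' : M) :
  Func f x y -> Pair u v ∈ f -> Pair u v' ∈ f -> v = v'.
Proof.
  intros H K K'. destruct (Func_dom _ _ _ _ _ H K) as [Hu _].
  destruct H as [_ H]. destruct (H u Hu) as (w & _ & Hw).
  apply Hw in K. apply Hw in K'. congruence.
Qed.

Lemma Func_App (f x y u : M) : Func f x y -> u ∈ x ->
  App f u ∈ y /\ Pair u (App f u) ∈ f.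
Proof.
  intros Hf Hu. assert (H := Hf). destruct H as [_ H].
  destruct (H u Hu) as (v & Hv & Hw). rewrite (App_eq f u v).
  - split; [exact Hv|]. now apply Hw.
  - now apply Hw.
  - intros y'. apply Hw.
Qed.

Lemma Func_iff (f x y u v : M) : Func f x y -> u ∈ x -> (Pair u v ∈ f <-> v = App f u).
Proof.
  intros Hf Hu. destruct (Func_App f x y u Hf Hu) as [H1 H2]. split.
  - intro K. exact (Func_uniq _ _ _ _ _ _ Hf K H2).
  - now intros ->.
Qed.

Lemma Lam_Func (a b : M) f : dt (fun v => f (v 0)) ->
  (forall x, x ∈ a -> f x ∈ b) -> Func (Lam a f) a b.
Proof.
  intros Hf H. split.
  - intros p Hp. unfold Lam in Hp. rewrite in_Img in Hp by dfn.
    destruct Hp as (x & Hx & ->). apply Pair_in_Prod. auto.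
  - intros u Hu. exists (f u). split; auto. intro w. rewrite in_Lam by dfn. tauto.
Qed.

Lemma Add_in (s x : M) : x ∈ s -> Add s x = s.
Proof.
  intro H. apply set_ext. intro z. rewrite in_Add. split; [|tauto].
  intros [| ->]; auto.
Qed.

Lemma Finite_Emp : Finite Emp.
Proof.
  exists Emp. split; [apply Natural_Emp|]. exists Emp. split; [split|].
  - intros z Hz. now apply in_Emp in Hz.
  - intros z Hz. now apply in_Emp in Hz.
  - intros z Hz. now apply in_Emp in Hz.
Qed.

Lemma Finite_Add s x : Finite s -> Finite (Add s x).
Proof.
  intros H. destruct (classic (x ∈ s)) as [Hx|Hx]; [now rewrite Add_in|].
  destruct H as (n & Hn & f & Hf & Hsurj).
  exists (Add n n). split; [now apply Natural_Add|].
  (* The new element [x] is sent to [n], the new element of the successor; [mem_irrefl] keeps this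
     value apart from the old ones. *)
  assert (HP : forall u w, Pair u w ∈ Add f (Pair x n) <->
                 Pair u w ∈ f \/ u = x /\ w = n).
  { intros u w. rewrite in_Add, Pair_inj. tauto. }
  exists (Add f (Pair x n)). split; [split|].
  - intros p Hp. apply in_Add in Hp. destruct Hp as [Hp| ->].
    + apply Hf, in_Prod in Hp. destruct Hp as (u & w & Hu & Hw & ->).
      apply Pair_in_Prod. rewrite !in_Add. tauto.
    + apply Pair_in_Prod. rewrite !in_Add. tauto.
  - intros u Hu. apply in_Add in Hu. destruct Hu as [Hu| ->].
    + destruct Hf as [_ Hf]. destruct (Hf u Hu) as (w & Hw & Hw').
      exists w. split; [rewrite in_Add; tauto|]. intro z. rewrite HP, Hw'.
      split; [intros [|[-> _]]; tauto|tauto].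
    + exists n. split; [rewrite in_Add; tauto|]. intro z. rewrite HP.
      split; [intros [K|]; [|tauto]|tauto].
      apply (Func_dom _ _ _ _ _ Hf) in K. tauto.
  - intros w Hw. apply in_Add in Hw. destruct Hw as [Hw| ->].
    + destruct (Hsurj w Hw) as (u & Hu & Hu'). exists u.
      split; [rewrite in_Add; tauto|]. intros z Hz. rewrite HP.
      apply in_Add in Hz. destruct Hz as [Hz| ->].
      * rewrite (Hu' z Hz). split; [intros [|[-> _]]; tauto|tauto].
      * split.
        -- intros [K|[_ ->]]; [apply (Func_dom _ _ _ _ _ Hf) in K; tauto|].
           now apply mem_irrefl in Hw.
        -- intros ->. tauto.
    + exists x. split; [rewrite in_Add; tauto|]. intros z Hz. rewrite HP.
      split; [intros [K|]; [|tauto]|tauto].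
      apply (Func_dom _ _ _ _ _ Hf) in K. destruct K as [_ K].
      now apply mem_irrefl in K.
Qed.

(** Induction on the size: the preimage [u] of the last number [n] is removed from [s], and the
    bijection is restricted to what remains. *)
Lemma Finite_ind (P : M -> Prop) : def (fun v => P (v 0)) -> P Emp ->
  (forall s x, Finite s -> x ∉ s -> P s -> P (Add s x)) -> forall s, Finite s -> P s.
Proof.
  intros HP H0 HS s (n & Hn & f & Hf). revert s f Hf.
  pattern n. revert n Hn. apply Natural_ind.
  - dfn.
  - intros s f Hf. replace s with (Emp : M); auto. apply set_ext. intro z.
    rewrite in_Emp. split; [tauto|]. intro Hz. destruct Hf as [[_ Hf] _].
    destruct (Hf z Hz) as (v & Hv & _). now apply in_Emp in Hv.
  - intros n Hn IH s f [Hf Hsurj].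
    destruct (Hsurj n) as (u & Hu & Hu'); [rewrite in_Add; tauto|].
    assert (Hun : Pair u n ∈ f) by now apply Hu'.
    set (s' := Diff s (Upair u u)).
    assert (Hs' : forall z, z ∈ s' <-> z ∈ s /\ z <> u).
    { intro z. unfold s'. rewrite in_Diff, in_Upair. tauto. }
    assert (Es : s = Add s' u).
    { apply set_ext. intro z. rewrite in_Add, Hs'. split; [intro|intros [| ->]]; tauto. }
    set (f' := Rsep s' n (fun x y => Pair x y ∈ f)).
    assert (Hf' : forall x y, Pair x y ∈ f' <-> x ∈ s' /\ y ∈ n /\ Pair x y ∈ f).
    { apply in_Rsep. dfn. }
    assert (HB : Biject f' s' n).
    { split; [split|].
      - apply Rsep_sub. dfn.
      - intros x Hx. assert (Hx' := Hx). apply Hs' in Hx'. destruct Hx' as [Hxs Hxu].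
        assert (K := Hf). destruct K as [_ K]. destruct (K x Hxs) as (v & Hv & Hv').
        assert (Hxv : Pair x v ∈ f) by now apply Hv'.
        assert (Hvn : v ∈ n).
        { apply in_Add in Hv. destruct Hv as [| ->]; auto. apply Hu' in Hxv; tauto. }
        exists v. split; auto. intro w. rewrite Hf', Hv'. split; [tauto|]. intros ->. tauto.
      - intros v Hv. destruct (Hsurj v) as (x & Hx & Hx'); [rewrite in_Add; tauto|].
        assert (Hxv : Pair x v ∈ f) by now apply Hx'.
        assert (Hxu : x <> u).
        { intros ->. assert (v = n) as -> by exact (Func_uniq _ _ _ _ _ _ Hf Hxv Hun).
          now apply mem_irrefl in Hv. }
        exists x. split; [apply Hs'; tauto|]. intros w Hw. rewrite Hf'.
        assert (Hws := Hw). apply Hs' in Hws. rewrite (Hx' w) by tauto. tauto. }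
    rewrite Es. apply HS; [|rewrite Hs'; tauto|now apply (IH s' f')].
    exists n. eauto.
Qed.

Lemma Finite_sub (s : M) : Finite s -> forall r, r ⊆ s -> Finite r.
Proof.
  intro Hs. pattern s. revert s Hs. apply Finite_ind.
  - dfn.
  - intros r Hr. replace r with (Emp : M); [apply Finite_Emp|].
    apply set_ext. intro z. rewrite in_Emp. split; [tauto|].
    intro Hz. apply Hr, in_Emp in Hz. exact Hz.
  - intros s x Hs Hx IH r Hr. destruct (classic (x ∈ r)) as [Hxr|Hxr].
    + replace r with (Add (Diff r (Upair x x)) x).
      * apply Finite_Add, IH. intros z Hz. rewrite in_Diff, in_Upair in Hz.
        destruct Hz as [Hz Hz']. apply Hr, in_Add in Hz. tauto.
      * apply set_ext. intro z. rewrite in_Add, in_Diff, in_Upair.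
        split; [intros [| ->]; tauto|]. destruct (classic (z = x)); tauto.
    + apply IH. intros z Hz. assert (K := Hr z Hz). apply in_Add in K.
      destruct K as [| ->]; tauto.
Qed.

Lemma Cup_Add (a s x : M) : Cup a (Add s x) = Add (Cup a s) x.
Proof. apply set_ext. intro z. rewrite !in_Add, !in_Cup, in_Add. tauto. Qed.

Lemma Finite_Cup (a s : M) : Finite a -> Finite s -> Finite (Cup a s).
Proof.
  intro Ha. revert s. apply Finite_ind.
  - dfn.
  - replace (Cup a Emp) with a; auto. apply set_ext. intro z.
    rewrite in_Cup, in_Emp. tauto.
  - intros s x Hs Hx IH. rewrite Cup_Add. now apply Finite_Add.
Qed.

Lemma Finite_Upair (x y : M) : Finite (Upair x y).
Proof.
  replace (Upair x y) with (Add (Add Emp x) y).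
  - apply Finite_Add, Finite_Add, Finite_Emp.
  - apply set_ext. intro z. rewrite !in_Add, in_Upair, in_Emp. tauto.
Qed.

Lemma Finite_Img (s : M) f : dt (fun v => f (v 0)) -> Finite s -> Finite (Img s f).
Proof.
  intro Hf. revert s. apply Finite_ind.
  - dfn.
  - replace (Img Emp f) with (Emp : M); [apply Finite_Emp|]. apply set_ext. intro z.
    rewrite in_Img, in_Emp by dfn. split; [tauto|].
    intros (x & Hx & _). now apply in_Emp in Hx.
  - intros s x Hs Hx IH. replace (Img (Add s x) f) with (Add (Img s f) (f x)).
    + now apply Finite_Add.
    + apply set_ext. intro z. rewrite in_Add, !in_Img by dfn. split.
      * intros [(y & Hy & ->)| ->]; [exists y | exists x]; rewrite in_Add; auto.
      * intros (y & Hy & ->). apply in_Add in Hy. destruct Hy as [| ->]; eauto.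
Qed.

End FiniteSets.

(** * Zorn's lemma *)

Section Zorn.
Context {M : Type} {HM : model M}.

(** The axiom selects from disjoint families only, so each [w] is replaced by its copy {w} × w. The
    result is a class function, definable with the selecting set as parameter. *)
Lemma choice_function (W : M) : (forall w, w ∈ W -> exists y, y ∈ w) ->
  exists c : M -> M, dt (fun v => c (v 0)) /\ forall w, w ∈ W -> c w ∈ w.
Proof.
  intro HW.
  set (u := Img W (fun w => Prod (Upair w w) w)).
  assert (Hu : forall x, x ∈ u <-> exists w, w ∈ W /\ x = Prod (Upair w w) w).
  { apply in_Img. dfn. }
  assert (AC : forall u, (forall x, x ∈ u -> ~ ~ exists z, z ∈ x) /\
      (forall x, x ∈ u -> forall y, y ∈ u -> x <> y -> ~ exists z, z ∈ x /\ z ∈ y) ->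
      exists c, forall x, x ∈ u -> exists w, forall z, z ∈ x /\ z ∈ c <-> z = w)
    by exact (mem_ZFC _ ax_choice (fun _ => point)).
  destruct (AC u) as [c Hc].
  - split.
    + intros x Hx K. apply Hu in Hx. destruct Hx as (w & Hw & ->).
      destruct (HW w Hw) as [y Hy]. apply K. exists (Pair w y).
      rewrite Pair_in_Prod, in_Upair. tauto.
    + intros x Hx y Hy Hxy [z [Hzx Hzy]]. apply Hu in Hx. apply Hu in Hy. apply Hxy.
      destruct Hx as (w & Hw & ->). destruct Hy as (w' & Hw' & ->).
      apply in_Prod in Hzx. destruct Hzx as (a & b & Ha & Hb & ->).
      apply Pair_in_Prod in Hzy. rewrite in_Upair in *.
      destruct Hzy as [K _]. intuition congruence.
  - exists (fun w => Union (Sep w (fun y => Pair w y ∈ c))). split; [dfn|].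
    intros w Hw. destruct (Hc (Prod (Upair w w) w)) as [p Hp].
    { apply Hu. now exists w. }
    destruct (proj2 (Hp p) eq_refl) as [H1 H2]. apply in_Prod in H1.
    destruct H1 as (w' & y & Hw' & Hy & E).
    assert (w' = w) as -> by (rewrite in_Upair in Hw'; tauto).
    replace (Union (Sep w (fun y => Pair w y ∈ c))) with y; auto.
    apply set_ext. intro z. rewrite in_Union. split.
    + intro Hz. exists y. rewrite in_Sep by dfn. now rewrite <- E.
    + intros (y' & Hy' & Hz). rewrite in_Sep in Hy' by dfn.
      assert (E' : Pair w y' = p).
      { apply Hp. rewrite Pair_in_Prod, in_Upair. tauto. }
      rewrite E in E'. apply Pair_inj in E'. destruct E' as [_ ->]. exact Hz.
Qed.

Definition chain (C : M) : Prop := forall x y, x ∈ C -> y ∈ C -> x ⊆ y \/ y ⊆ x.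

(** The closed families of the Bourbaki-Witt argument; working with them avoids ordinals and
    transfinite recursion. *)
Definition tower (A A0 : M) (next : M -> M) (T : M) : Prop :=
  T ⊆ A /\ A0 ∈ T /\ (forall a, a ∈ T -> next a ∈ T) /\
  (forall C, C ⊆ T -> chain C -> (exists c, c ∈ C) -> Union C ∈ T).
End Zorn.

#[export] Hint Unfold chain tower : dfn.

Section ZornLemma.
Context {M : Type} {HM : model M}.

Lemma sub_antisym (a b : M) : a ⊆ b -> b ⊆ a -> a = b.
Proof. intros H K. apply set_ext. intro z. split; auto. Qed.

(** Bourbaki-Witt: the least tower [T0] is a chain, hence contains its own union, which [next] would
    have to fix. *)
Lemma no_inflation (A A0 : M) (next : M -> M) :
  dt (fun v => next (v 0)) -> A0 ∈ A -> (forall a, a ∈ A -> A0 ⊆ a) ->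
  (forall a, a ∈ A -> next a ∈ A /\ a ⊆ next a /\ next a <> a) ->
  (forall C, C ⊆ A -> chain C -> (exists c, c ∈ C) -> Union C ∈ A) -> False.
Proof.
  intros Hdt HA0 Hmin Hnext Hchain.
  set (T0 := Sep A (fun a => forall T, tower A A0 next T -> a ∈ T)).
  assert (HT0 : forall a, a ∈ T0 <-> a ∈ A /\ forall T, tower A A0 next T -> a ∈ T).
  { apply in_Sep. dfn. }
  assert (HT : tower A A0 next T0).
  { split; [|split; [|split]].
    - intros a Ha. now apply HT0 in Ha.
    - rewrite HT0. split; auto. intros T HT. apply HT.
    - intros a Ha. apply HT0 in Ha. rewrite HT0. split; [apply Hnext, (proj1 Ha)|].
      intros T HT. assert (K := HT). destruct K as (_ & _ & K & _). now apply K, Ha.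
    - intros C HC Hc Hne. rewrite HT0. split.
      + apply Hchain; auto. intros z Hz. apply HC, HT0 in Hz. tauto.
      + intros T HT. assert (K := HT). destruct K as (_ & _ & _ & K).
        apply K; auto. intros z Hz. apply HC, HT0 in Hz. now apply Hz. }
  assert (Hind : forall P, def (fun v => P (v 0)) -> P A0 ->
    (forall a, a ∈ T0 -> P a -> P (next a)) ->
    (forall C, C ⊆ T0 -> (forall c, c ∈ C -> P c) -> P (Union C)) ->
    forall a, a ∈ T0 -> P a).
  { intros P HP H0 HS HC a Ha.
    set (T := Sep T0 P).
    assert (HinT : forall x, x ∈ T <-> x ∈ T0 /\ P x) by (apply in_Sep; dfn).
    apply HinT. apply HT0 in Ha. apply Ha.
    destruct HT as (Ht1 & Ht2 & Ht3 & Ht4). split; [|split; [|split]].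
    - intros z Hz. apply HinT in Hz. now apply Ht1.
    - apply HinT. auto.
    - intros b Hb. apply HinT in Hb. apply HinT. split; [now apply Ht3|now apply HS].
    - intros C HCT Hch Hne. apply HinT. split.
      + apply Ht4; auto. intros z Hz. now apply HCT, HinT in Hz.
      + apply HC; intros z Hz; now apply HCT, HinT in Hz. }
  destruct HT as (Ht1 & Ht2 & Ht3 & Ht4).
  (* Elements [c] such that [next] carries whatever is strictly below [c] to something still below
     [c]. Such a [c] is comparable with all of [T0] ([L1]), and every element of [T0] is of this
     kind ([L2]); together they make [T0] a chain. *)
  set (extr := fun c => forall a, a ∈ T0 -> a ⊆ c -> a <> c -> next a ⊆ c).
  assert (L1 : forall c, c ∈ T0 -> extr c ->
    forall a, a ∈ T0 -> a ⊆ c \/ next c ⊆ a).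
  { intros c Hc He. apply Hind.
    - dfn.
    - left. apply Hmin, Ht1, Hc.
    - intros a Ha [H|H].
      + destruct (classic (a = c)) as [-> |Hne]; [tauto|]. left. now apply He.
      + right. intros z Hz. apply (Hnext a (Ht1 a Ha)). now apply H.
    - intros C HC H. destruct (classic (forall a, a ∈ C -> a ⊆ c)) as [K|K].
      + left. intros z Hz. apply in_Union in Hz. destruct Hz as (y & Hy & Hz). eapply K; eauto.
      + right. apply not_all_ex_not in K. destruct K as [a Ka].
        apply imply_to_and in Ka. destruct Ka as [Ha Ka].
        destruct (H a Ha) as [K|K]; [tauto|].
        intros z Hz. apply in_Union. exists a. auto. }
  assert (L2 : forall c, c ∈ T0 -> extr c).
  { apply Hind.
    - unfold extr. dfn.
    - intros a Ha H Hne. exfalso. apply Hne, sub_antisym; auto.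
    - intros c Hc He a Ha H Hne. destruct (L1 c Hc He a Ha) as [K|K].
      + destruct (classic (a = c)) as [-> |Hne']; [tauto|].
        intros z Hz. apply (Hnext c (Ht1 c Hc)). now apply (He a Ha K Hne').
      + exfalso. apply Hne, sub_antisym; auto.
    - intros C HC H a Ha Hsub Hne.
      destruct (classic (forall c, c ∈ C -> c ⊆ a)) as [K|K].
      + exfalso. apply Hne, sub_antisym; auto.
        intros z Hz. apply in_Union in Hz. destruct Hz as (y & Hy & Hz). eapply K; eauto.
      + apply not_all_ex_not in K. destruct K as [c Kc].
        apply imply_to_and in Kc. destruct Kc as [Hc Kc].
        destruct (L1 c (HC c Hc) (H c Hc) a Ha) as [K|K].
        * intros z Hz. apply in_Union. exists c. split; auto.
          apply (H c Hc a Ha K); auto. intros ->. auto.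
        * exfalso. apply Kc. intros z Hz. apply K. now apply (Hnext c (Ht1 c (HC c Hc))). }
  assert (Hch : chain T0).
  { intros x y Hx Hy. destruct (L1 y Hy (L2 y Hy) x Hx) as [K|K]; auto.
    right. intros z Hz. apply K. now apply (Hnext y (Ht1 y Hy)). }
  assert (HU : Union T0 ∈ T0) by (apply Ht4; eauto).
  destruct (Hnext _ (Ht1 _ HU)) as (_ & H1 & H2). apply H2, sub_antisym; auto.
  intros z Hz. apply in_Union. exists (next (Union T0)). auto.
Qed.

(** Were no element above [A0] maximal, choice would give a strictly increasing operation, against
    [no_inflation]. The chain condition concerns nonempty chains because the empty union need not
    lie in [A]. *)
Theorem zorn (A A0 : M) : A0 ∈ A ->
  (forall C, C ⊆ A -> chain C -> (exists c, c ∈ C) -> Union C ∈ A) ->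
  exists m, m ∈ A /\ A0 ⊆ m /\ forall m', m' ∈ A -> m ⊆ m' -> m' = m.
Proof.
  intros HA0 Hchain. apply NNPP. intro Hno.
  set (A' := Sep A (fun a => A0 ⊆ a)).
  assert (HA' : forall a, a ∈ A' <-> a ∈ A /\ A0 ⊆ a) by (apply in_Sep; dfn).
  set (larger := fun a => Sep A' (fun b => a ⊆ b /\ b <> a)).
  assert (Hl : forall a b, b ∈ larger a <-> b ∈ A' /\ a ⊆ b /\ b <> a).
  { intro a. apply in_Sep. dfn. }
  destruct (choice_function (Img A' larger)) as (c & Hc & Hc').
  { intros w Hw. unfold larger in Hw. rewrite in_Img in Hw by dfn.
    destruct Hw as (a & Ha & ->). fold (larger a). apply NNPP. intro K. apply Hno.
    apply HA' in Ha. exists a. split; [tauto|]. split; [tauto|].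
    intros m' Hm' Hsub. apply NNPP. intro Hne. apply K. exists m'.
    rewrite Hl, HA'. intuition auto. }
  apply (no_inflation A' A0 (fun a => c (larger a))).
  - unfold larger. dfn.
  - apply HA'. auto.
  - intros a Ha. now apply HA' in Ha.
  - intros a Ha. rewrite <- Hl. apply Hc'. unfold larger. rewrite in_Img by dfn. eauto.
  - intros C HC Hch [x Hx]. apply HA'. split.
    + apply Hchain; eauto. intros z Hz. now apply HC, HA' in Hz.
    + intros z Hz. apply in_Union. exists x. split; auto.
      apply HC, HA' in Hx. now apply Hx.
Qed.

End ZornLemma.

(** * Uniform spaces and compactness *)

Notation "u ~[ c ] w" := (mem (Pair u w) c)
  (at level 70, c at level 200, no associativity) : zf_scope.

Section TopologyDefs.
Context {M : Type} {HM : model M}.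

Definition Empty (a : M) : Prop := ~ exists z, z ∈ a.
Definition Disj (x y : M) : Prop := ~ exists z, z ∈ x /\ z ∈ y.

Definition Topology (x t : M) : Prop :=
  (forall o, o ∈ t -> o ⊆ x) /\ x ∈ t /\
  (forall o, o ∈ t -> forall p, p ∈ t -> exists q, q ∈ t /\ q = Cap o p) /\
  (forall s, s ⊆ t -> exists q, q ∈ t /\ q = Union s).

Definition Hausdorff (x t : M) : Prop :=
  forall u, u ∈ x -> forall v, v ∈ x -> ~ u = v ->
    exists o, o ∈ t /\ exists p, p ∈ t /\ u ∈ o /\ v ∈ p /\ Disj o p.

Definition Compact (x t : M) : Prop :=
  forall s, s ⊆ t /\ x = Union s -> exists r, r ⊆ s /\ Finite r /\ x = Union r.

Definition InCl (t a u : M) : Prop := forall o, o ∈ t -> u ∈ o -> ~ Disj o a.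

Definition Uniformity (x v : M) : Prop :=
  (exists c, c ∈ v /\ c = Prod x x) /\
  (forall c, c ∈ v -> c ⊆ Prod x x /\ forall u, u ∈ x -> u ~[c] u) /\
  (forall c, c ∈ v -> forall d, d ⊆ Prod x x /\ c ⊆ d -> d ∈ v) /\
  (forall c, c ∈ v -> forall d, d ∈ v -> exists b, b ∈ v /\ b = Cap c d) /\
  (forall c, c ∈ v -> exists d, d ∈ v /\
     forall u, u ∈ x -> forall w, w ∈ x -> (u ~[d] w <-> w ~[c] u)) /\
  (forall c, c ∈ v -> exists d, d ∈ v /\
     forall u, u ∈ x -> forall w, w ∈ x -> forall z, z ∈ x ->
       u ~[d] w /\ w ~[d] z -> u ~[c] z).

Definition UTop (x v t : M) : Prop :=
  forall o, o ∈ t <->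
    (o ⊆ x /\ forall u, u ∈ o -> exists c, c ∈ v /\
       forall w, w ∈ x -> u ~[c] w -> w ∈ o).

Definition Precompact (x b : M) : Prop :=
  forall c, c ∈ b -> exists s, s ⊆ x /\ Finite s /\
    forall u, u ∈ x -> exists w, w ∈ s /\ w ~[c] u.

Definition Filter (x f : M) : Prop :=
  (forall a, a ∈ f -> a ⊆ x /\ ~ Empty a) /\ x ∈ f /\
  (forall a, a ∈ f -> forall b, b ∈ f -> exists c, c ∈ f /\ c = Cap a b) /\
  (forall a, a ∈ f -> forall b, a ⊆ b /\ b ⊆ x -> b ∈ f).

Definition Cauchy (v f : M) : Prop :=
  forall c, c ∈ v -> exists a, a ∈ f /\
    forall u, u ∈ a -> forall w, w ∈ a -> u ~[c] w.

Definition Complete (x v t : M) : Prop :=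
  forall f, Filter x f /\ Cauchy v f ->
    exists u, u ∈ x /\ forall o, o ∈ t -> u ∈ o -> o ∈ f.
End TopologyDefs.

#[export] Hint Unfold Empty Disj Topology Hausdorff Compact InCl Uniformity UTop
  Precompact Filter Cauchy Complete : dfn.

Section Uniform.
Context {M : Type} {HM : model M}.

Lemma not_Empty (a : M) : ~ Empty a <-> exists z, z ∈ a.
Proof. unfold Empty. tauto. Qed.

Lemma not_Disj (a b : M) : ~ Disj a b <-> exists z, z ∈ a /\ z ∈ b.
Proof. unfold Disj. tauto. Qed.

Section Space.
Variables (x v : M).
Hypothesis Hv : Uniformity x v.

Lemma unif_full : Prod x x ∈ v.
Proof. destruct Hv as ((c & Hc & ->) & _). exact Hc. Qed.

Lemma unif_dom c u w : c ∈ v -> u ~[c] w -> u ∈ x /\ w ∈ x.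
Proof.
  intros Hc H. destruct Hv as (_ & K & _). apply (K c Hc), Pair_in_Prod in H. exact H.
Qed.

Lemma unif_refl c u : c ∈ v -> u ∈ x -> u ~[c] u.
Proof. intros Hc H. destruct Hv as (_ & K & _). now apply (K c Hc). Qed.

Lemma unif_cap c d : c ∈ v -> d ∈ v -> Cap c d ∈ v.
Proof.
  intros Hc Hd. destruct Hv as (_ & _ & _ & K & _).
  destruct (K c Hc d Hd) as (b & Hb & ->). exact Hb.
Qed.

Lemma unif_half c : c ∈ v -> exists d, d ∈ v /\
  (forall u w, u ~[d] w -> w ~[d] u) /\
  (forall u w z, u ~[d] w -> w ~[d] z -> u ~[c] z).
Proof.
  intro Hc. assert (K := Hv). destruct K as (_ & _ & _ & _ & Hinv & Hcomp).
  destruct (Hcomp c Hc) as (d & Hd & Hd').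
  destruct (Hinv d Hd) as (e & He & He').
  exists (Cap d e). split; [now apply unif_cap|]. split.
  - intros u w. rewrite !in_Cap. intros [H1 H2].
    destruct (unif_dom d u w Hd H1) as [Hu Hw].
    split; [now apply (He' u Hu w Hw)|now apply (He' w Hw u Hu)].
  - intros u w z. rewrite !in_Cap. intros [H1 _] [H2 _].
    destruct (unif_dom d u w Hd H1) as [Hu Hw].
    destruct (unif_dom d w z Hd H2) as [_ Hz]. eapply (Hd' u Hu w Hw z Hz); auto.
Qed.

(** One entourage fine enough for chains of up to four steps; shorter chains are padded by
    reflexivity. *)
Lemma unif_quarter c : c ∈ v -> exists d, d ∈ v /\
  (forall u w, u ~[d] w -> w ~[d] u) /\
  (forall u w, u ~[d] w -> u ~[c] w) /\
  (forall u w z, u ~[d] w -> w ~[d] z -> u ~[c] z) /\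
  (forall u w z y, u ~[d] w -> w ~[d] z -> z ~[d] y -> u ~[c] y) /\
  (forall u w z y r, u ~[d] w -> w ~[d] z -> z ~[d] y -> y ~[d] r -> u ~[c] r).
Proof.
  intro Hc. destruct (unif_half c Hc) as (c' & Hc' & _ & Hc'').
  destruct (unif_half c' Hc') as (d & Hd & Hs & Hd'').
  assert (K4 : forall u w z y r, u ~[d] w -> w ~[d] z -> z ~[d] y -> y ~[d] r -> u ~[c] r)
    by eauto.
  assert (Hr : forall u w, u ~[d] w -> w ~[d] w).
  { intros u w H. apply unif_refl; auto. now apply (unif_dom d u w Hd). }
  exists d. split; [auto|]. split; [auto|].
  split; [intros; eapply K4; eauto|]. split; [intros; eapply K4; eauto|].
  split; [intros; eapply K4; eauto|exact K4].
Qed.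

Definition utop : M :=
  Sep (Pow x) (fun o => forall u, u ∈ o -> exists c, c ∈ v /\
    forall w, w ∈ x -> u ~[c] w -> w ∈ o).

Lemma utop_UTop : UTop x v utop.
Proof. intro o. unfold utop. rewrite in_Sep by dfn. rewrite in_Pow. tauto. Qed.

Variable t : M.
Hypothesis Ht : UTop x v t.

Lemma open_sub o : o ∈ t -> o ⊆ x.
Proof. intro H. apply Ht in H. tauto. Qed.

Lemma open_nbhd o u : o ∈ t -> u ∈ o -> exists c, c ∈ v /\ forall w, u ~[c] w -> w ∈ o.
Proof.
  intros H Hu. apply Ht in H. destruct H as [_ H]. destruct (H u Hu) as (c & Hc & K).
  exists c. split; auto. intros w Hw. apply K; auto. now apply (unif_dom c u w).
Qed.

(** The ball of [c] around [u] need not be open; the points that have some ball inside it form its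
    interior. *)
Lemma ball_nbhd c u : c ∈ v -> u ∈ x ->
  exists o, o ∈ t /\ u ∈ o /\ forall w, w ∈ o -> u ~[c] w.
Proof.
  intros Hc Hu.
  set (o := Sep x (fun w => exists d, d ∈ v /\ forall z, w ~[d] z -> u ~[c] z)).
  assert (Ho : forall w, w ∈ o <-> w ∈ x /\ exists d, d ∈ v /\ forall z, w ~[d] z -> u ~[c] z).
  { apply in_Sep. dfn. }
  exists o. split; [|split].
  - apply Ht. split.
    + intros w Hw. apply Ho in Hw. tauto.
    + intros w Hw. apply Ho in Hw. destruct Hw as (Hw & d & Hd & K).
      destruct (unif_half d Hd) as (e & He & _ & He').
      exists e. split; auto. intros z Hz Hwz. apply Ho. split; auto.
      exists e. split; auto. intros y Hy. apply K. eauto.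
  - apply Ho. split; auto. exists c. auto.
  - intros w Hw. apply Ho in Hw. destruct Hw as (Hw & d & Hd & K).
    apply K. now apply unif_refl.
Qed.

Lemma UTop_Topology : Topology x t.
Proof.
  split; [|split; [|split]].
  - exact open_sub.
  - apply Ht. split; auto. intros u Hu. exists (Prod x x). split; [apply unif_full|auto].
  - intros o Ho p Hp. exists (Cap o p). split; auto. apply Ht. split.
    + intros z Hz. apply in_Cap in Hz. now apply (open_sub o Ho).
    + intros u Hu. apply in_Cap in Hu. destruct Hu as [Hu Hu'].
      destruct (open_nbhd o u Ho Hu) as (c & Hc & K).
      destruct (open_nbhd p u Hp Hu') as (d & Hd & L).
      exists (Cap c d). split; [now apply unif_cap|].
      intros w Hw H. apply in_Cap in H. apply in_Cap. split; [apply K|apply L]; tauto.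
  - intros s Hs. exists (Union s). split; auto. apply Ht. split.
    + intros z Hz. apply in_Union in Hz. destruct Hz as (o & Ho & Hz).
      now apply (open_sub o (Hs _ Ho)).
    + intros u Hu. apply in_Union in Hu. destruct Hu as (o & Ho & Hu).
      destruct (open_nbhd o u (Hs _ Ho) Hu) as (c & Hc & K).
      exists c. split; auto. intros w _ H. apply in_Union. eauto.
Qed.

Lemma separated_Hausdorff :
  (forall u w, u ∈ x -> w ∈ x -> (forall c, c ∈ v -> u ~[c] w) -> u = w) ->
  Hausdorff x t.
Proof.
  intros H u Hu w Hw Hne.
  assert (exists c, c ∈ v /\ ~ u ~[c] w) as (c & Hc & K).
  { apply NNPP. intro K. apply Hne, H; auto. intros c Hc. apply NNPP. intro. apply K. eauto. }
  destruct (unif_half c Hc) as (d & Hd & Hs & Hd').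
  destruct (ball_nbhd d u Hd Hu) as (o & Ho & Huo & Ho').
  destruct (ball_nbhd d w Hd Hw) as (p & Hp & Hwp & Hp').
  exists o. split; auto. exists p. do 3 (split; auto). intros (z & Hz1 & Hz2).
  apply K. eauto.
Qed.

End Space.

(** * Filters, ultrafilters and compactness *)

Lemma Filter_cap (x f a b : M) : Filter x f -> a ∈ f -> b ∈ f -> Cap a b ∈ f.
Proof.
  intros (_ & _ & H & _) Ha Hb. destruct (H a Ha b Hb) as (c & Hc & ->). exact Hc.
Qed.

Lemma Filter_up (x f a b : M) : Filter x f -> a ∈ f -> b ⊆ x -> a ⊆ b -> b ∈ f.
Proof. intros (_ & _ & _ & H) Ha Hb K. apply (H a Ha b). auto. Qed.

Lemma Filter_nonempty (x f a : M) : Filter x f -> a ∈ f -> exists z, z ∈ a.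
Proof. intros (H & _) Ha. apply not_Empty. now apply (H a Ha). Qed.

Lemma Filter_meet (x f a b : M) : Filter x f -> a ∈ f -> b ∈ f -> exists z, z ∈ a /\ z ∈ b.
Proof.
  intros H Ha Hb. destruct (Filter_nonempty x f (Cap a b)) as [z Hz]; auto.
  - now apply (Filter_cap x).
  - exists z. now apply in_Cap.
Qed.

Lemma Filter_sub (x f a : M) : Filter x f -> a ∈ f -> a ⊆ x.
Proof. intros (H & _) Ha. now apply (H a Ha). Qed.

Lemma Filter_intro (x f : M) :
  (forall a, a ∈ f -> a ⊆ x) -> (forall a, a ∈ f -> exists z, z ∈ a) -> x ∈ f ->
  (forall a b, a ∈ f -> b ∈ f -> Cap a b ∈ f) ->
  (forall a b, a ∈ f -> b ⊆ x -> a ⊆ b -> b ∈ f) -> Filter x f.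
Proof.
  intros H1 H2 H3 H4 H5. split; [|split; [|split]]; auto.
  - intros a Ha. rewrite not_Empty. split; eauto.
  - intros a Ha b Hb. exists (Cap a b). auto.
  - intros a Ha b [K L]. eauto.
Qed.

(** A maximal filter [g] decides every [a]: if the complement is not in [g], then [a] meets every
    member of [g], so the filter [h] generated by [g] and [a] is proper and equals [g]. *)
Lemma ultrafilter (x f : M) : Filter x f ->
  exists g, Filter x g /\ f ⊆ g /\ forall a, a ⊆ x -> a ∈ g \/ Diff x a ∈ g.
Proof.
  intro Hf.
  set (F := Sep (Pow (Pow x)) (Filter x)).
  assert (HF : forall g, g ∈ F <-> Filter x g).
  { intro g. unfold F. rewrite in_Sep by dfn. split; [tauto|]. intro H. split; auto.
    apply in_Pow. intros a Ha. apply in_Pow. now apply (Filter_sub x g). }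
  destruct (zorn F f) as (g & Hg & Hfg & Hmax).
  - now apply HF.
  - intros C HC Hch [c Hc]. apply HF. apply Filter_intro.
    + intros a Ha. apply in_Union in Ha. destruct Ha as (g & Hg & Ha).
      apply HC, HF in Hg. now apply (Filter_sub x g).
    + intros a Ha. apply in_Union in Ha. destruct Ha as (g & Hg & Ha).
      apply HC, HF in Hg. now apply (Filter_nonempty x g).
    + apply in_Union. exists c. split; auto. apply HC, HF in Hc. apply Hc.
    + intros a b Ha Hb. apply in_Union in Ha. destruct Ha as (g & Hg & Ha).
      apply in_Union in Hb. destruct Hb as (h & Hh & Hb). apply in_Union.
      assert (Hg' := proj1 (HF _) (HC _ Hg)). assert (Hh' := proj1 (HF _) (HC _ Hh)).
      destruct (Hch g h Hg Hh) as [K|K]; [exists h|exists g]; split; auto;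
        now apply (Filter_cap x); auto.
    + intros a b Ha Hb Hab. apply in_Union in Ha. destruct Ha as (g & Hg & Ha).
      apply in_Union. exists g. split; auto. apply HC, HF in Hg. now apply (Filter_up x g a).
  - apply HF in Hg. exists g. split; [exact Hg|]. split; [exact Hfg|].
    intros a Ha. apply NNPP. intro Hno.
    set (h := Sep (Pow x) (fun b => exists c, c ∈ g /\ Cap c a ⊆ b)).
    assert (Hh : forall b, b ∈ h <-> b ⊆ x /\ exists c, c ∈ g /\ Cap c a ⊆ b).
    { intro b. unfold h. rewrite in_Sep by dfn. now rewrite in_Pow. }
    assert (Hmeet : forall c, c ∈ g -> exists z, z ∈ c /\ z ∈ a).
    { intros c Hc. apply NNPP. intro K. apply Hno. right.
      apply (Filter_up x g c); auto.
      - intros z Hz. apply in_Diff in Hz. tauto.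
      - intros z Hz. apply in_Diff. split; [now apply (Filter_sub x g c)|]. eauto. }
    assert (Hhg : h = g).
    { apply Hmax.
      - apply HF, Filter_intro.
        + intros b Hb. apply Hh in Hb. tauto.
        + intros b Hb. apply Hh in Hb. destruct Hb as (Hb & c & Hc & K).
          destruct (Hmeet c Hc) as (z & Hz). exists z. apply K. now apply in_Cap.
        + apply Hh. split; auto. exists x. split; [apply Hg|].
          intros z Hz. now apply in_Cap in Hz.
        + intros b b' Hb Hb'. apply Hh in Hb. apply Hh in Hb'. apply Hh.
          destruct Hb as (Hb & c & Hc & K), Hb' as (Hb' & c' & Hc' & K'). split.
          * intros z Hz. apply in_Cap in Hz. now apply Hb.
          * exists (Cap c c'). split; [now apply (Filter_cap x)|].
            intros z Hz. rewrite !in_Cap in *.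
            split; [apply K|apply K']; rewrite in_Cap; tauto.
        + intros b b' Hb Hb' Hsub. apply Hh in Hb. apply Hh. split; auto.
          destruct Hb as (Hb & c & Hc & K). exists c. auto.
      - intros b Hb. apply Hh. split; [now apply (Filter_sub x g)|].
        exists b. split; auto. intros z Hz. now apply in_Cap in Hz. }
    apply Hno. left. rewrite <- Hhg. apply Hh. split; auto. exists x.
    split; [apply Hg|]. intros z Hz. now apply in_Cap in Hz.
Qed.

Lemma ultrafilter_Cauchy (x v f : M) : Uniformity x v -> Precompact x v ->
  Filter x f -> (forall a, a ⊆ x -> a ∈ f \/ Diff x a ∈ f) -> Cauchy v f.
Proof.
  intros Hv Hpre Hf Hult c Hc.
  destruct (unif_half x v Hv c Hc) as (d & Hd & Hs & Hd').
  destruct (Hpre d Hd) as (s & Hsx & Hfin & Hcov).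
  set (ball := fun w => Sep x (fun u => w ~[d] u)).
  assert (Hball : forall w u, u ∈ ball w <-> u ∈ x /\ w ~[d] u).
  { intro w. apply in_Sep. dfn. }
  (* The union of the balls is only assumed to be a member of [f], not all of [x], so that centers
     can be removed one at a time. *)
  assert (H : Sep x (fun u => exists w, w ∈ s /\ w ~[d] u) ∈ f ->
              exists w, w ∈ s /\ ball w ∈ f).
  { clear Hcov Hsx. unfold ball. pattern s. revert s Hfin. apply Finite_ind; [dfn| |].
    - intro K. apply (Filter_nonempty x f) in K; auto. destruct K as [z Hz].
      rewrite in_Sep in Hz by dfn. destruct Hz as (_ & w & Hw & _). now apply in_Emp in Hw.
    - intros s w Hfin Hw IH K. fold (ball w). destruct (Hult (ball w)) as [H|H].
      + intros z Hz. apply Hball in Hz. tauto.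
      + exists w. rewrite in_Add. auto.
      + destruct IH as (w' & Hw' & IH).
        * eapply (Filter_up x f); [auto|exact (Filter_cap x f _ _ Hf H K)| |].
          -- intros z Hz. rewrite in_Sep in Hz by dfn. tauto.
          -- intros z Hz. rewrite in_Cap, in_Diff, Hball in Hz.
             rewrite in_Sep in * by dfn. destruct Hz as ((Hz & Hz') & _ & w' & Hw' & Hz'').
             split; auto. exists w'. split; auto. apply in_Add in Hw'.
             destruct Hw' as [Hw'| ->]; tauto.
        * exists w'. rewrite in_Add. auto. }
  destruct H as (w & Hw & H).
  - replace (Sep x (fun u => exists w, w ∈ s /\ w ~[d] u)) with x; [apply Hf|].
    apply set_ext. intro z. rewrite in_Sep by dfn. split; [auto|tauto].
  - exists (ball w). split; auto. intros u Hu u' Hu'. apply Hball in Hu. apply Hball in Hu'.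
    apply (Hd' u w u'); [apply Hs|]; tauto.
Qed.

Lemma Union_Emp : Union Emp = Emp.
Proof.
  apply set_ext. intro z. rewrite in_Union, in_Emp. split; [|tauto].
  intros (y & Hy & _). now apply in_Emp in Hy.
Qed.

Lemma Union_Add (s a : M) : Union (Add s a) = Cup (Union s) a.
Proof.
  apply set_ext. intro z. rewrite in_Cup, !in_Union. split.
  - intros (y & Hy & Hz). apply in_Add in Hy. destruct Hy as [Hy| ->]; eauto.
  - intros [(y & Hy & Hz)|Hz]; [exists y|exists a]; rewrite in_Add; auto.
Qed.

(** Without a finite subcover the complements of finite unions generate a proper filter. An
    ultrafilter above it is Cauchy and converges to a point, and then contains a covering open set
    together with its complement. *)
Lemma precompact_complete_Compact (x v t : M) :
  Uniformity x v -> UTop x v t -> Precompact x v -> Complete x v t -> Compact x t.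
Proof.
  intros Hv Ht Hpre Hcomp s (Hst & Hcov). apply NNPP. intro Hno.
  set (f := Sep (Pow x) (fun a => exists r, r ⊆ s /\ Finite r /\ Diff x (Union r) ⊆ a)).
  assert (Hf : forall a, a ∈ f <->
    a ⊆ x /\ exists r, r ⊆ s /\ Finite r /\ Diff x (Union r) ⊆ a).
  { intro a. unfold f. rewrite in_Sep by dfn. now rewrite in_Pow. }
  assert (HF : Filter x f).
  { apply Filter_intro.
    - intros a Ha. apply Hf in Ha. tauto.
    - intros a Ha. apply Hf in Ha. destruct Ha as (Ha & r & Hr & Hfin & K).
      apply NNPP. intro Hemp. apply Hno. exists r. split; auto. split; auto.
      apply sub_antisym.
      + intros z Hz. apply NNPP. intro Hz'. apply Hemp. exists z. apply K, in_Diff. auto.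
      + intros z Hz. apply in_Union in Hz. destruct Hz as (o & Ho & Hz).
        now apply (open_sub x v t Ht o (Hst _ (Hr _ Ho))).
    - apply Hf. split; auto. exists Emp. split; [|split; [apply Finite_Emp|]].
      + intros z Hz. now apply in_Emp in Hz.
      + intros z Hz. now apply in_Diff in Hz.
    - intros a b Ha Hb. apply Hf in Ha. apply Hf in Hb. apply Hf.
      destruct Ha as (Ha & r & Hr & Hfin & K), Hb as (Hb & r' & Hr' & Hfin' & K').
      split; [intros z Hz; apply in_Cap in Hz; now apply Ha|].
      exists (Cup r r'). split; [intros z Hz; apply in_Cup in Hz; destruct Hz; auto|].
      split; [now apply Finite_Cup|].
      intros z Hz. apply in_Diff in Hz. rewrite in_Union in Hz. destruct Hz as [Hz Hz'].
      apply in_Cap. split; [apply K|apply K']; apply in_Diff; split; auto;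
        intro L; apply in_Union in L; destruct L as (y & Hy & L); apply Hz';
        exists y; rewrite in_Cup; auto.
    - intros a b Ha Hb Hab. apply Hf in Ha. apply Hf. split; auto.
      destruct Ha as (Ha & r & Hr & Hfin & K). exists r. auto. }
  destruct (ultrafilter x f HF) as (g & Hg & Hfg & Hult).
  destruct (Hcomp g) as (u & Hu & Hlim).
  { split; auto. now apply (ultrafilter_Cauchy x). }
  assert (Hu' := Hu). rewrite Hcov in Hu'. apply in_Union in Hu'.
  destruct Hu' as (o & Ho & Huo).
  destruct (Filter_meet x g o (Diff x o)) as (z & Hz & Hz'); auto.
  - apply Hfg, Hf. split; [intros z Hz; apply in_Diff in Hz; tauto|].
    exists (Add Emp o). split; [|split; [apply Finite_Add, Finite_Emp|]].
    + intros z Hz. apply in_Add in Hz. rewrite in_Emp in Hz.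
      destruct Hz as [[]| ->]; auto.
    + intros z Hz. rewrite Union_Add, Union_Emp in Hz.
      rewrite in_Diff, in_Cup, in_Emp in Hz. rewrite in_Diff. tauto.
  - apply in_Diff in Hz'. tauto.
Qed.

(** The later compactness arguments pass through this principle, which spares explicit finite
    subcovers and the choice of data along them. *)
Lemma compact_induction (z t : M) (P : M -> Prop) :
  Topology z t -> Compact z t -> def (fun v => P (v 0)) ->
  P Emp -> (forall o p, P o -> P p -> P (Cup o p)) ->
  (forall u, u ∈ z -> exists o, o ∈ t /\ u ∈ o /\ P o) -> P z.
Proof.
  intros Ht Hc HP H0 HU Hloc.
  set (s := Sep t P).
  assert (Hs : forall o, o ∈ s <-> o ∈ t /\ P o) by (apply in_Sep; dfn).
  destruct (Hc s) as (r & Hr & Hfin & E).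
  - split; [intros o Ho; apply Hs in Ho; tauto|]. apply sub_antisym.
    + intros u Hu. destruct (Hloc u Hu) as (o & Ho & Huo & K). apply in_Union.
      exists o. rewrite Hs. auto.
    + intros u Hu. apply in_Union in Hu. destruct Hu as (o & Ho & Hu). apply Hs in Ho.
      destruct Ht as [Ht _]. apply (Ht o); tauto.
  - rewrite E. clear E. revert Hr. pattern r. revert r Hfin. apply Finite_ind.
    + dfn.
    + now rewrite Union_Emp.
    + intros r o Hfin Ho IH K. rewrite Union_Add. apply HU.
      * apply IH. intros w Hw. apply K, in_Add. auto.
      * apply (Hs o), K, in_Add. auto.
Qed.

End Uniform.

(** * Group actions *)

Section GroupDefs.
Context {M : Type} {HM : model M}.

Definition App2 (f x y z : M) : Prop := Pair (Pair x y) z ∈ f.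

Definition Cont2 (x tx y ty tz f : M) : Prop :=
  forall u, u ∈ x -> forall v, v ∈ y -> forall o, o ∈ tz ->
    (exists w, w ∈ o /\ App2 f u v w) ->
    exists p, p ∈ tx /\ exists q, q ∈ ty /\ u ∈ p /\ v ∈ q /\
      (forall u', u' ∈ p -> forall v', v' ∈ q -> exists w, w ∈ o /\ App2 f u' v' w).

Definition Group (g m e : M) : Prop :=
  Func m (Prod g g) g /\
  (forall a, a ∈ g -> forall b, b ∈ g -> forall c, c ∈ g -> forall ab, forall bc,
     App2 m a b ab /\ App2 m b c bc -> exists d, App2 m ab c d /\ App2 m a bc d) /\
  e ∈ g /\
  (forall a, a ∈ g -> App2 m e a a /\ App2 m a e a) /\
  (forall a, a ∈ g -> exists b, b ∈ g /\ App2 m a b e /\ App2 m b a e).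

Definition TopGroup (g m e t : M) : Prop :=
  Group g m e /\ Topology g t /\ Hausdorff g t /\ Cont2 g t g t t m /\
  (forall a, a ∈ g -> forall b, b ∈ g -> forall o, o ∈ t -> App2 m a b e /\ b ∈ o ->
     exists p, p ∈ t /\ a ∈ p /\ (forall a', a' ∈ p -> exists b', b' ∈ o /\ App2 m a' b' e)).

Definition BaseAt (n e t : M) : Prop :=
  (forall v, v ∈ n -> v ∈ t /\ e ∈ v) /\
  (forall o, o ∈ t -> e ∈ o -> exists v, v ∈ n /\ v ⊆ o).

Definition Action (g m e x a : M) : Prop :=
  Func a (Prod g x) x /\
  (forall u, u ∈ x -> App2 a e u u) /\
  (forall h, h ∈ g -> forall k, k ∈ g -> forall u, u ∈ x -> forall hk, forall ku,
     App2 m h k hk /\ App2 a k u ku -> exists w, App2 a hk u w /\ App2 a h ku w).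

Definition InCl2 (t c u w : M) : Prop :=
  forall o, o ∈ t -> forall p, p ∈ t -> u ∈ o /\ w ∈ p ->
    exists u', u' ∈ o /\ exists w', w' ∈ p /\ u' ~[c] w'.

Definition RegOpen2 (x t c : M) : Prop :=
  forall u, u ∈ x -> forall w, w ∈ x -> (u ~[c] w <->
    (exists o, o ∈ t /\ exists p, p ∈ t /\ u ∈ o /\ w ∈ p /\
       (forall u', u' ∈ o -> forall w', w' ∈ p -> InCl2 t c u' w'))).

Definition UniformSpace (x b : M) : Prop :=
  exists v, exists t, Uniformity x v /\ UTop x v t /\ Hausdorff x t /\
    b ⊆ v /\ (forall c, c ∈ v -> exists d, d ∈ b /\ d ⊆ c) /\
    (forall c, c ∈ b -> RegOpen2 x t c) /\
    (exists c, c ∈ b /\ c = Prod x x).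

Definition Completion (x b z v t i : M) : Prop :=
  Uniformity z v /\ UTop z v t /\ Hausdorff z t /\ Complete z v t /\
  Func i x z /\
  (forall c, c ∈ v -> exists d, d ∈ b /\ forall u, u ∈ x -> forall w, w ∈ x ->
     forall iu, forall iw, u ~[i] iu /\ w ~[i] iw /\ u ~[d] w -> iu ~[c] iw) /\
  (forall d, d ∈ b -> exists c, c ∈ v /\ forall u, u ∈ x -> forall w, w ∈ x ->
     forall iu, forall iw, u ~[i] iu /\ w ~[i] iw /\ iu ~[c] iw -> u ~[d] w) /\
  (forall o, o ∈ t -> ~ Empty o -> exists u, u ∈ x /\ exists iu, iu ∈ o /\ u ~[i] iu).

Definition Preflow (g m n x b a : M) : Prop :=
  exists e, (exists t, TopGroup g m e t /\ BaseAt n e t) /\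
    UniformSpace x b /\ Precompact x b /\ Action g m e x a /\
    (forall h, h ∈ g -> forall c, c ∈ b -> exists d, d ∈ b /\
       forall u, u ∈ x -> forall w, w ∈ x -> forall hu, forall hw,
       App2 a h u hu /\ App2 a h w hw /\ u ~[d] w -> hu ~[c] hw) /\
    (forall c, c ∈ b -> exists v, v ∈ n /\ forall u, u ∈ x -> forall h, h ∈ v ->
       forall hu, App2 a h u hu -> u ~[c] hu).

Definition Flow (g m e s z t a : M) : Prop :=
  Topology z t /\ Hausdorff z t /\ Compact z t /\
  Action g m e z a /\ Cont2 g s z t t a.

Definition Shatters (z a A0 A1 s : M) : Prop :=
  forall s0, forall s1,
    s0 ⊆ s /\ s1 ⊆ s /\ (forall h, h ∈ s -> h ∈ s0 \/ h ∈ s1) /\ Disj s0 s1 ->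
    exists u, u ∈ z /\ forall h, h ∈ s -> forall hu, App2 a h u hu ->
      (hu ∈ A0 <-> h ∈ s0) /\ (hu ∈ A1 <-> h ∈ s1).

Definition Tame (g z t a : M) : Prop :=
  ~ (exists A0, A0 ∈ t /\ exists A1, A1 ∈ t /\ exists s,
       ~ Empty A0 /\ ~ Empty A1 /\
       ~ (exists u, u ∈ z /\ InCl t A0 u /\ InCl t A1 u) /\
       s ⊆ g /\ ~ Finite s /\ Shatters z a A0 A1 s).

Definition Extends (g x a i α : M) : Prop :=
  forall h, h ∈ g -> forall u, u ∈ x -> forall hu, forall iu, forall ihu,
    App2 a h u hu /\ u ~[i] iu /\ hu ~[i] ihu -> App2 α h iu ihu.

Definition TameCompletion (g m n x b a : M) : Prop :=
  exists e, exists s, TopGroup g m e s /\ BaseAt n e s /\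
    exists z, exists v, exists t, exists i, exists α,
      Completion x b z v t i /\ Flow g m e s z t α /\ Extends g x a i α /\
      Tame g z t α.
End GroupDefs.

#[export] Hint Unfold App2 : dfn.

Section Actions.
Context {M : Type} {HM : model M}.

Definition op (f x y : M) : M := App f (Pair x y).

Lemma Func2_op (f x y z u w : M) : Func f (Prod x y) z -> u ∈ x -> w ∈ y ->
  op f u w ∈ z /\ forall r, App2 f u w r <-> r = op f u w.
Proof.
  intros Hf Hu Hw. assert (H : Pair u w ∈ Prod x y) by now apply Pair_in_Prod.
  split; [apply (Func_App _ _ _ _ Hf H)|]. intro r. exact (Func_iff _ _ _ _ r Hf H).
Qed.

Variables (g m e : M).
Hypothesis Hg : Group g m e.

Lemma mul_in h k : h ∈ g -> k ∈ g -> op m h k ∈ g.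
Proof. intros Hh Hk. destruct Hg as [H _]. apply (Func2_op _ _ _ _ _ _ H Hh Hk). Qed.

Lemma mul_App2 h k r : h ∈ g -> k ∈ g -> (App2 m h k r <-> r = op m h k).
Proof. intros Hh Hk. destruct Hg as [H _]. apply (Func2_op _ _ _ _ _ _ H Hh Hk). Qed.

Lemma unit_in : e ∈ g.
Proof. apply Hg. Qed.

Lemma mul_unit_r h : h ∈ g -> op m h e = h.
Proof.
  intro Hh. symmetry. apply mul_App2; auto using unit_in.
  destruct Hg as (_ & _ & _ & H & _). now apply H.
Qed.

Lemma mul_assoc h k l : h ∈ g -> k ∈ g -> l ∈ g ->
  op m (op m h k) l = op m h (op m k l).
Proof.
  intros Hh Hk Hl. assert (K := Hg). destruct K as (_ & K & _).
  destruct (K h Hh k Hk l Hl (op m h k) (op m k l)) as (d & H1 & H2).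
  - split; now apply mul_App2.
  - apply mul_App2 in H1; auto using mul_in. apply mul_App2 in H2; auto using mul_in.
    congruence.
Qed.

Lemma mul_inv h : h ∈ g -> exists k, k ∈ g /\ op m h k = e /\ op m k h = e.
Proof.
  intro Hh. assert (K := Hg). destruct K as (_ & _ & _ & _ & K).
  destruct (K h Hh) as (k & Hk & H1 & H2). exists k. split; auto.
  apply mul_App2 in H1; auto. apply mul_App2 in H2; auto.
Qed.

Variables (x a : M).
Hypothesis Ha : Action g m e x a.

Lemma act_in h u : h ∈ g -> u ∈ x -> op a h u ∈ x.
Proof. intros Hh Hu. destruct Ha as [H _]. apply (Func2_op _ _ _ _ _ _ H Hh Hu). Qed.

Lemma act_App2 h u r : h ∈ g -> u ∈ x -> (App2 a h u r <-> r = op a h u).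
Proof. intros Hh Hu. destruct Ha as [H _]. apply (Func2_op _ _ _ _ _ _ H Hh Hu). Qed.

Lemma act_unit u : u ∈ x -> op a e u = u.
Proof.
  intro Hu. symmetry. apply act_App2; auto using unit_in. now apply Ha.
Qed.

Lemma act_mul h k u : h ∈ g -> k ∈ g -> u ∈ x -> op a (op m h k) u = op a h (op a k u).
Proof.
  intros Hh Hk Hu. assert (K := Ha). destruct K as (_ & _ & K).
  destruct (K h Hh k Hk u Hu (op m h k) (op a k u)) as (w & H1 & H2).
  - split; [now apply mul_App2|now apply act_App2].
  - apply act_App2 in H1; auto using mul_in. apply act_App2 in H2; auto using act_in.
    congruence.
Qed.

Lemma act_cancel h k u : h ∈ g -> k ∈ g -> u ∈ x -> op m h k = e -> op a h (op a k u) = u.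
Proof. intros Hh Hk Hu E. rewrite <- act_mul, E, act_unit; auto. Qed.

End Actions.

#[export] Hint Unfold op : dfn.

(** * The completion by round Cauchy filters *)

Section Round.
Context {M : Type} {HM : model M}.

(** Every Cauchy filter contains exactly one round Cauchy filter, the least one equivalent to it.
    Taking these as points gives a Hausdorff completion without forming a quotient. *)
Definition Round (v f : M) : Prop :=
  forall a, a ∈ f -> exists c, c ∈ v /\ exists a', a' ∈ f /\
    forall u w, u ∈ a' -> u ~[c] w -> w ∈ a.

Definition rcf (x v : M) : M :=
  Sep (Pow (Pow x)) (fun p => Filter x p /\ Cauchy v p /\ Round v p).

Definition near (c p q : M) : Prop :=
  exists a, a ∈ p /\ a ∈ q /\ forall u w, u ∈ a -> w ∈ a -> u ~[c] w.

Definition rcf_unif (x v : M) : M :=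
  Sep (Pow (Prod (rcf x v) (rcf x v))) (fun d => exists c, c ∈ v /\
    forall p q, p ∈ rcf x v -> q ∈ rcf x v -> near c p q -> p ~[d] q).

(** The image of the point [u] in the completion: its neighbourhood filter, which is the round
    filter converging to [u]. *)
Definition nbhds (x v u : M) : M :=
  Sep (Pow x) (fun a => exists c, c ∈ v /\ forall w, u ~[c] w -> w ∈ a).
End Round.

#[export] Hint Unfold Round rcf near rcf_unif nbhds utop : dfn.

Section Completion.
Context {M : Type} {HM : model M}.
Variables (x v : M).
Hypothesis Hv : Uniformity x v.

Let Z := rcf x v.
Let vZ := rcf_unif x v.

Lemma in_rcf p : p ∈ Z <-> Filter x p /\ Cauchy v p /\ Round v p.
Proof.
  unfold Z, rcf. rewrite in_Sep by dfn. split; [tauto|]. intro H. split; auto.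
  apply in_Pow. intros a Ha. apply in_Pow. now apply (Filter_sub x p).
Qed.

Lemma rcf_Filter p : p ∈ Z -> Filter x p.
Proof. intro H. now apply in_rcf in H. Qed.

Lemma in_rcf_unif d : d ∈ vZ <-> d ⊆ Prod Z Z /\ exists c, c ∈ v /\
    forall p q, p ∈ Z -> q ∈ Z -> near c p q -> p ~[d] q.
Proof. unfold vZ, rcf_unif. rewrite in_Sep by dfn. now rewrite in_Pow. Qed.

Lemma near_refl c p : c ∈ v -> p ∈ Z -> near c p p.
Proof.
  intros Hc Hp. apply in_rcf in Hp. destruct Hp as (_ & H & _).
  destruct (H c Hc) as (a & Ha & K). exists a. auto.
Qed.

Lemma near_sym c p q : near c p q -> near c q p.
Proof. intros (a & H1 & H2 & H3). exists a. auto. Qed.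

Lemma near_mono c d p q : (forall u w, u ~[c] w -> u ~[d] w) -> near c p q -> near d p q.
Proof. intros H (a & H1 & H2 & H3). exists a. auto. Qed.

(** The small sets [a] and [b] both belong to the middle filter, hence share a point, which links
    any two points of [Cup a b]. *)
Lemma near_trans c d p q r : d ∈ v -> p ∈ Z -> q ∈ Z -> r ∈ Z ->
  (forall u w z, u ~[d] w -> w ~[d] z -> u ~[c] z) ->
  near d p q -> near d q r -> near c p r.
Proof.
  intros Hd Hp Hq Hr Hcd (a & Hap & Haq & Ha) (b & Hbq & Hbr & Hb).
  apply rcf_Filter in Hp, Hq, Hr.
  assert (Hax : a ⊆ x) by now apply (Filter_sub x p).
  assert (Hbx : b ⊆ x) by now apply (Filter_sub x r).
  destruct (Filter_meet x q a b) as (z & Hza & Hzb); auto.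
  exists (Cup a b). split; [|split].
  - apply (Filter_up x p a); auto; intros y; rewrite in_Cup; [intros []|]; auto.
  - apply (Filter_up x r b); auto; intros y; rewrite in_Cup; [intros []|]; auto.
  - intros u w Hu Hw. apply in_Cup in Hu, Hw. destruct Hu, Hw; apply (Hcd u z w); auto.
Qed.

Lemma near_in_unif d : d ∈ v -> exists D, D ∈ vZ /\
  forall p q, p ~[D] q <-> p ∈ Z /\ q ∈ Z /\ near d p q.
Proof.
  intro Hd. exists (Rsep Z Z (near d)). split; [|apply in_Rsep; dfn].
  apply in_rcf_unif. split; [apply Rsep_sub; dfn|]. exists d. split; auto.
  intros p q Hp Hq H. rewrite in_Rsep by dfn. auto.
Qed.

Lemma rcf_Uniformity : Uniformity Z vZ.
Proof.
  split; [|split; [|split; [|split; [|split]]]].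
  - exists (Prod Z Z). split; auto. apply in_rcf_unif. split; auto.
    exists (Prod x x). split; [now apply unif_full|]. intros. now apply Pair_in_Prod.
  - intros c Hc. apply in_rcf_unif in Hc. destruct Hc as (Hc & d & Hd & K). split; auto.
    intros p Hp. apply K; auto. now apply near_refl.
  - intros c Hc d [Hd Hcd]. apply in_rcf_unif in Hc. apply in_rcf_unif.
    destruct Hc as (Hc & b & Hb & K). split; auto. exists b. split; auto.
  - intros c Hc d Hd. exists (Cap c d). split; auto. apply in_rcf_unif in Hc, Hd.
    destruct Hc as (Hc & c' & Hc' & K), Hd as (Hd & d' & Hd' & L).
    apply in_rcf_unif. split; [intros z Hz; apply in_Cap in Hz; now apply Hc|].
    exists (Cap c' d'). split; [now apply (unif_cap x)|].
    intros p q Hp Hq H. apply in_Cap.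
    split; [apply K|apply L]; auto; apply (near_mono (Cap c' d')); auto;
      intros u w Huw; now apply in_Cap in Huw.
  - intros c Hc. apply in_rcf_unif in Hc. destruct Hc as (Hc & d & Hd & K).
    exists (Rsep Z Z (fun p q => q ~[c] p)). split.
    + apply in_rcf_unif. split; [apply Rsep_sub; dfn|]. exists d. split; auto.
      intros p q Hp Hq H. rewrite in_Rsep by dfn. split; auto. split; auto.
      apply K; auto. now apply near_sym.
    + intros p Hp q Hq. rewrite in_Rsep by dfn. tauto.
  - intros c Hc. apply in_rcf_unif in Hc. destruct Hc as (Hc & c' & Hc' & K).
    destruct (unif_half x v Hv c' Hc') as (d & Hd & _ & Hd').
    destruct (near_in_unif d Hd) as (D & HD & HD').
    exists D. split; auto. intros p Hp q Hq r Hr [H1 H2]. apply HD' in H1, H2.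
    apply K; auto. apply (near_trans c' d p q r); tauto.
Qed.

Lemma rcf_near d : d ∈ vZ -> exists c, c ∈ v /\
  forall p q, p ∈ Z -> q ∈ Z -> near c p q -> p ~[d] q.
Proof. intro H. now apply in_rcf_unif in H. Qed.

(** Roundness makes the uniformity separated: a member [a] of [p] contains a [c]-neighbourhood of
    some [a'] in [p]; a [c]-small set common to [p] and [q] meets [a'], hence lies inside [a]. *)
Lemma rcf_separated p q : p ∈ Z -> q ∈ Z -> (forall c, c ∈ vZ -> p ~[c] q) -> p = q.
Proof.
  assert (H : forall p q, p ∈ Z -> q ∈ Z -> (forall c, c ∈ v -> near c p q) -> p ⊆ q).
  { clear p q. intros p q Hp Hq H a Ha. assert (K := Hp). apply in_rcf in K.
    destruct K as (Fp & _ & Rp). apply rcf_Filter in Hq.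
    destruct (Rp a Ha) as (c & Hc & a' & Ha' & K).
    destruct (H c Hc) as (b & Hbp & Hbq & L).
    destruct (Filter_meet x p a' b) as (z & Hz & Hz'); auto.
    apply (Filter_up x q b); auto.
    - now apply (Filter_sub x p).
    - intros w Hw. apply (K z w); auto. }
  intros Hp Hq K.
  assert (L : forall c, c ∈ v -> near c p q).
  { intros c Hc. destruct (near_in_unif c Hc) as (D & HD & HD'). now apply HD', K. }
  apply sub_antisym; apply H; auto. intros c Hc. now apply near_sym, L.
Qed.

Lemma rcf_Complete t : UTop Z vZ t -> Complete Z vZ t.
Proof.
  intros Ht F [HF HC].
  (* The limit of [F]: a set belongs to it when it is a uniform neighbourhood of some [a'] that lies
     in [F]-almost every filter. The margin [c] makes [f] round. *)
  set (f := Sep (Pow x) (fun a => exists c, c ∈ v /\ exists a', a' ⊆ x /\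
    (forall u w, u ∈ a' -> u ~[c] w -> w ∈ a) /\ Sep Z (fun p => a' ∈ p) ∈ F)).
  assert (Hf : forall a, a ∈ f <-> a ⊆ x /\ exists c, c ∈ v /\ exists a', a' ⊆ x /\
    (forall u w, u ∈ a' -> u ~[c] w -> w ∈ a) /\ Sep Z (fun p => a' ∈ p) ∈ F).
  { intro a. unfold f. rewrite in_Sep by dfn. now rewrite in_Pow. }
  assert (Hup : forall a b, b ⊆ x -> Sep Z (fun p => a ∈ p) ∈ F -> a ⊆ b ->
    Sep Z (fun p => b ∈ p) ∈ F).
  { intros a b Hb Ha Hab. apply (Filter_up Z F _ _ HF Ha).
    - intros p Hp. rewrite in_Sep in Hp by dfn. tauto.
    - intros p Hp. rewrite in_Sep in * by dfn. split; [tauto|].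
      apply (Filter_up x p a); try tauto. now apply rcf_Filter. }
  assert (Hsmall : forall c, c ∈ v -> exists a, a ∈ f /\
    (forall u w, u ∈ a -> w ∈ a -> u ~[c] w) /\ Sep Z (fun p => a ∈ p) ∈ F).
  (* Points of [ball (ball b)] are joined by five [d]-steps, two down to [b], one across and two up.
     Four of them make a [c1]-step, and the fifth completes a [c]-step. *)
  { intros c Hc. destruct (unif_half x v Hv c Hc) as (c1 & Hc1 & _ & Hcc).
    destruct (unif_quarter x v Hv c1 Hc1) as (d & Hd & Hs & Hd1 & Hd2 & _ & Hd4).
    destruct (near_in_unif d Hd) as (D & HD & HD').
    destruct (HC D HD) as (A & HA & HA').
    destruct (Filter_nonempty Z F A HF HA) as (p & Hp).
    assert (HpZ : p ∈ Z) by now apply (Filter_sub Z F A).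
    assert (K := HpZ). apply in_rcf in K. destruct K as (Fp & Cp & _).
    destruct (Cp d Hd) as (b & Hb & Hb').
    assert (Hbx : b ⊆ x) by now apply (Filter_sub x p).
    set (ball := fun b => Sep x (fun w => exists u, u ∈ b /\ u ~[d] w)).
    assert (Hball : forall b w, w ∈ ball b <-> w ∈ x /\ exists u, u ∈ b /\ u ~[d] w).
    { intro b'. apply in_Sep. dfn. }
    assert (Hincl : forall b, b ⊆ x -> b ⊆ ball b).
    { intros b' H z Hz. apply Hball. split; auto. exists z. split; auto.
      apply (unif_refl x v); auto. }
    assert (H1 : Sep Z (fun q => ball b ∈ q) ∈ F).
    { apply (Filter_up Z F A); auto.
      - intros q Hq. rewrite in_Sep in Hq by dfn. tauto.
      - intros q Hq. rewrite in_Sep by dfn.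
        assert (HqZ : q ∈ Z) by now apply (Filter_sub Z F A). split; auto.
        assert (Hpq : near d p q) by now apply HD', HA'.
        destruct Hpq as (c' & Hc'p & Hc'q & L).
        destruct (Filter_meet x p c' b) as (z & Hz & Hz'); auto.
        apply (Filter_up x q c'); auto.
        + now apply rcf_Filter.
        + intros w Hw. now apply Hball in Hw.
        + intros w Hw. apply Hball.
          split; [now apply (Filter_sub x p c' Fp)|]. exists z. auto. }
    exists (ball (ball b)). split; [|split].
    - apply Hf. split; [intros w Hw; now apply Hball in Hw|].
      exists d. split; auto. exists (ball b). split; [intros w Hw; now apply Hball in Hw|].
      split; auto. intros u w Hu Huw. apply Hball.
      split; [now apply (unif_dom x v Hv d u w)|]. eauto.
    - intros u w Hu Hw. apply Hball in Hu, Hw.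
      destruct Hu as (_ & u1 & Hu & Huu), Hw as (_ & w1 & Hw & Hww).
      apply Hball in Hu, Hw.
      destruct Hu as (_ & u2 & Hu & Huu'), Hw as (_ & w2 & Hw & Hww').
      apply (Hcc u w1 w); auto. apply (Hd4 u u1 u2 w2 w1); auto.
    - apply (Hup (ball b)); auto; intros w Hw; [now apply Hball in Hw|].
      apply Hincl; auto. intros z Hz. now apply Hball in Hz. }
  assert (Ff : Filter x f).
  { apply Filter_intro.
    - intros a Ha. apply Hf in Ha. tauto.
    - intros a Ha. apply Hf in Ha. destruct Ha as (Ha & c & Hc & a' & Ha' & K & L).
      destruct (Filter_nonempty Z F _ HF L) as (p & Hp).
      rewrite in_Sep in Hp by dfn. destruct Hp as (Hp & Hp').
      destruct (Filter_nonempty x p a') as (z & Hz); auto; [now apply rcf_Filter|].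
      exists z. apply (K z z); auto. apply (unif_refl x v); auto.
    - apply Hf. split; auto. exists (Prod x x). split; [now apply unif_full|].
      exists x. split; auto. split.
      + intros u w _ H. apply Pair_in_Prod in H. tauto.
      + replace (Sep Z (fun p => x ∈ p)) with Z; [apply HF|].
        apply set_ext. intro p. rewrite in_Sep by dfn. split; [|tauto].
        intro Hp. split; auto. apply rcf_Filter in Hp. apply Hp.
    - intros a b Ha Hb. apply Hf in Ha, Hb. apply Hf.
      destruct Ha as (Ha & c & Hc & a' & Ha' & K & L).
      destruct Hb as (Hb & d & Hd & b' & Hb' & K' & L').
      split; [intros z Hz; apply in_Cap in Hz; now apply Ha|].
      exists (Cap c d). split; [now apply (unif_cap x)|]. exists (Cap a' b').
      split; [intros z Hz; apply in_Cap in Hz; now apply Ha'|]. split.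
      + intros u w Hu H. rewrite in_Cap in *.
        split; [apply (K u)|apply (K' u)]; tauto.
      + apply (Filter_up Z F _ _ HF (Filter_cap Z F _ _ HF L L')).
        * intros p Hp. rewrite in_Sep in Hp by dfn. tauto.
        * intros p Hp. rewrite in_Cap in Hp. rewrite !in_Sep in * by dfn.
          split; [tauto|]. apply (Filter_cap x p); try tauto. now apply rcf_Filter.
    - intros a b Ha Hb Hab. apply Hf in Ha. apply Hf. split; auto.
      destruct Ha as (Ha & c & Hc & a' & Ha' & K & L). exists c. split; auto.
      exists a'. split; auto. split; auto. intros u w Hu Huw. apply Hab. eauto. }
  assert (HfZ : f ∈ Z).
  { apply in_rcf. split; auto. split.
    - intros c Hc. destruct (Hsmall c Hc) as (a & Ha & K & _). exists a. auto.
    - intros a Ha. apply Hf in Ha. destruct Ha as (Ha & c & Hc & a' & Ha' & K & L).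
      destruct (unif_half x v Hv c Hc) as (d & Hd & _ & Hd').
      exists d. split; auto. exists (Sep x (fun w => exists u, u ∈ a' /\ u ~[d] w)).
      assert (Hb : forall w, w ∈ Sep x (fun w => exists u, u ∈ a' /\ u ~[d] w) <->
        w ∈ x /\ exists u, u ∈ a' /\ u ~[d] w) by (apply in_Sep; dfn).
      split.
      + apply Hf. split; [intros w Hw; now apply Hb in Hw|].
        exists d. split; auto. exists a'. split; auto. split; auto.
        intros u w Hu Huw. apply Hb. split; [now apply (unif_dom x v Hv d u w)|]. eauto.
      + intros u w Hu Huw. apply Hb in Hu. destruct Hu as (_ & u' & Hu' & K').
        apply (K u' w); eauto. }
  exists f. split; auto. intros o Ho Hfo.
  destruct (open_nbhd Z vZ rcf_Uniformity t Ht o f Ho Hfo) as (D & HD & HDo).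
  destruct (rcf_near D HD) as (c & Hc & Hc').
  destruct (Hsmall c Hc) as (a & Ha & Hac & HaF).
  apply (Filter_up Z F _ _ HF HaF).
  - now apply (open_sub Z vZ t Ht).
  - intros p Hp. rewrite in_Sep in Hp by dfn. apply HDo, Hc'; try tauto.
    exists a. tauto.
Qed.

Lemma in_nbhds u a : a ∈ nbhds x v u <->
  a ⊆ x /\ exists c, c ∈ v /\ forall w, u ~[c] w -> w ∈ a.
Proof. unfold nbhds. rewrite in_Sep by dfn. now rewrite in_Pow. Qed.

Lemma nbhds_self u a : u ∈ x -> a ∈ nbhds x v u -> u ∈ a.
Proof.
  intros Hu Ha. apply in_nbhds in Ha. destruct Ha as (_ & c & Hc & K).
  apply K. now apply (unif_refl x v).
Qed.

Lemma nbhds_rcf u : u ∈ x -> nbhds x v u ∈ Z.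
Proof.
  intro Hu. apply in_rcf. split; [|split].
  - apply Filter_intro.
    + intros a Ha. apply in_nbhds in Ha. tauto.
    + intros a Ha. exists u. now apply nbhds_self.
    + apply in_nbhds. split; auto. exists (Prod x x). split; [now apply unif_full|].
      intros w Hw. apply Pair_in_Prod in Hw. tauto.
    + intros a b Ha Hb. apply in_nbhds in Ha, Hb. apply in_nbhds.
      destruct Ha as (Ha & c & Hc & K), Hb as (Hb & d & Hd & L).
      split; [intros z Hz; apply in_Cap in Hz; now apply Ha|].
      exists (Cap c d). split; [now apply (unif_cap x)|].
      intros w Hw. rewrite in_Cap in *. split; [apply K|apply L]; tauto.
    + intros a b Ha Hb Hab. apply in_nbhds in Ha. apply in_nbhds. split; auto.
      destruct Ha as (Ha & c & Hc & K). exists c. auto.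
  - intros c Hc. destruct (unif_half x v Hv c Hc) as (d & Hd & Hs & Hd').
    exists (Sep x (fun w => u ~[d] w)). split.
    + apply in_nbhds. split; [intros w Hw; rewrite in_Sep in Hw by dfn; tauto|].
      exists d. split; auto. intros w Hw. rewrite in_Sep by dfn.
      split; auto. now apply (unif_dom x v Hv d u w).
    + intros w Hw w' Hw'. rewrite in_Sep in * by dfn. apply (Hd' w u w'); [apply Hs|]; tauto.
  - intros a Ha. apply in_nbhds in Ha. destruct Ha as (Ha & c & Hc & K).
    destruct (unif_half x v Hv c Hc) as (d & Hd & Hs & Hd').
    exists d. split; auto. exists (Sep x (fun w => u ~[d] w)). split.
    + apply in_nbhds. split; [intros w Hw; rewrite in_Sep in Hw by dfn; tauto|].
      exists d. split; auto. intros w Hw. rewrite in_Sep by dfn.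
      split; auto. now apply (unif_dom x v Hv d u w).
    + intros w w' Hw Hww. rewrite in_Sep in Hw by dfn. apply K. apply (Hd' u w w'); tauto.
Qed.

Lemma nbhds_near c : c ∈ v -> exists d, d ∈ v /\
  forall u w, u ~[d] w -> near c (nbhds x v u) (nbhds x v w).
Proof.
  intro Hc. destruct (unif_quarter x v Hv c Hc) as (d & Hd & Hs & H1 & H2 & H3 & H4).
  exists d. split; auto. intros u w Huw.
  exists (Sep x (fun z => u ~[d] z \/ w ~[d] z)).
  assert (K : forall z, z ∈ Sep x (fun z => u ~[d] z \/ w ~[d] z) <->
    z ∈ x /\ (u ~[d] z \/ w ~[d] z)) by (apply in_Sep; dfn).
  split; [|split].
  - apply in_nbhds. split; [intros z Hz; now apply K in Hz|]. exists d. split; auto.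
    intros z Hz. apply K. split; auto. now apply (unif_dom x v Hv d u z).
  - apply in_nbhds. split; [intros z Hz; now apply K in Hz|]. exists d. split; auto.
    intros z Hz. apply K. split; auto. now apply (unif_dom x v Hv d w z).
  - intros y z Hy Hz. apply K in Hy, Hz. destruct Hy as [_ [Hy|Hy]], Hz as [_ [Hz|Hz]].
    + apply (H2 y u z); auto.
    + apply (H3 y u w z); auto.
    + apply (H3 y w u z); auto.
    + apply (H2 y w z); auto.
Qed.

Lemma near_nbhds c u w : u ∈ x -> w ∈ x ->
  near c (nbhds x v u) (nbhds x v w) -> u ~[c] w.
Proof. intros Hu Hw (a & H1 & H2 & H3). apply H3; now apply nbhds_self. Qed.

Lemma nbhds_dense c p : c ∈ v -> p ∈ Z -> exists u, u ∈ x /\ near c p (nbhds x v u).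
Proof.
  intros Hc Hp. apply in_rcf in Hp. destruct Hp as (Fp & Cp & _).
  destruct (unif_half x v Hv c Hc) as (d & Hd & Hs & Hd').
  destruct (Cp d Hd) as (a & Ha & K). destruct (Filter_nonempty x p a) as (u & Hu); auto.
  assert (Hux : u ∈ x) by now apply (Filter_sub x p a).
  assert (L : forall z, z ∈ Sep x (fun z => u ~[d] z) <-> z ∈ x /\ u ~[d] z)
    by (apply in_Sep; dfn).
  exists u. split; auto. exists (Sep x (fun z => u ~[d] z)). split; [|split].
  - apply (Filter_up x p a); auto; intros z Hz; [now apply L in Hz|].
    apply L. split; [now apply (Filter_sub x p a)|auto].
  - apply in_nbhds. split; [intros z Hz; now apply L in Hz|]. exists d. split; auto.
    intros z Hz. apply L. split; auto. now apply (unif_dom x v Hv d u z).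
  - intros y z Hy Hz. apply L in Hy, Hz. apply (Hd' y u z); [apply Hs|]; tauto.
Qed.

Lemma rcf_Precompact : Precompact x v -> Precompact Z vZ.
Proof.
  intros Hpre D HD. destruct (rcf_near D HD) as (c & Hc & Hc').
  destruct (unif_half x v Hv c Hc) as (d & Hd & Hs & Hd').
  destruct (nbhds_near d Hd) as (b & Hb & Hb').
  destruct (Hpre b Hb) as (s & Hsx & Hfin & Hcov).
  exists (Img s (nbhds x v)). split; [|split].
  - intros p Hp. rewrite in_Img in Hp by dfn. destruct Hp as (u & Hu & ->).
    apply nbhds_rcf. auto.
  - apply Finite_Img; auto. dfn.
  - intros p Hp. destruct (nbhds_dense d p Hd Hp) as (u & Hu & Hpu).
    destruct (Hcov u Hu) as (w & Hw & Hwu). exists (nbhds x v w). split.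
    + rewrite in_Img by dfn. eauto.
    + assert (nbhds x v w ∈ Z) by (apply nbhds_rcf; auto).
      apply Hc'; auto.
      apply (near_trans c d _ (nbhds x v u) p); auto using near_sym. now apply nbhds_rcf.
Qed.

Lemma rcf_Completion b : b ⊆ v -> (forall c, c ∈ v -> exists d, d ∈ b /\ d ⊆ c) ->
  Completion x b Z vZ (utop Z vZ) (Lam x (nbhds x v)).
Proof.
  intros Hb Hbase.
  assert (Hi : forall u p, u ~[Lam x (nbhds x v)] p <-> u ∈ x /\ p = nbhds x v u).
  { apply in_Lam. dfn. }
  assert (Ht := utop_UTop Z vZ).
  split; [exact rcf_Uniformity|]. split; [exact Ht|].
  split; [exact (separated_Hausdorff Z vZ rcf_Uniformity _ Ht rcf_separated)|].
  split; [exact (rcf_Complete _ Ht)|].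
  split; [apply Lam_Func; [dfn|exact nbhds_rcf]|]. split; [|split].
  - intros D HD. destruct (rcf_near D HD) as (c & Hc & Hc').
    destruct (nbhds_near c Hc) as (d & Hd & Hd').
    destruct (Hbase d Hd) as (d' & Hd'b & Hsub). exists d'. split; auto.
    intros u Hu w Hw p q (Hp & Hq & Huw). apply Hi in Hp, Hq.
    destruct Hp as [_ ->], Hq as [_ ->]. apply Hc'; auto using nbhds_rcf.
  - intros d Hd. destruct (near_in_unif d (Hb d Hd)) as (D & HD & HD').
    exists D. split; auto. intros u Hu w Hw p q (Hp & Hq & Huw). apply Hi in Hp, Hq.
    destruct Hp as [_ ->], Hq as [_ ->]. apply near_nbhds; auto. now apply HD'.
  - intros o Ho Hne. apply not_Empty in Hne. destruct Hne as [p Hp].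
    destruct (open_nbhd Z vZ rcf_Uniformity _ Ht o p Ho Hp) as (D & HD & HDo).
    destruct (rcf_near D HD) as (c & Hc & Hc').
    assert (HpZ := open_sub _ _ _ Ht _ Ho p Hp).
    destruct (nbhds_dense c p Hc HpZ) as (u & Hu & Hpu).
    exists u. split; auto. exists (nbhds x v u). split; [|now apply Hi].
    apply HDo, Hc'; auto. now apply nbhds_rcf.
Qed.

End Completion.

(** * The flow on the completion *)

Section Extension.
Context {M : Type} {HM : model M}.
Variables (g m e x v a : M).
Hypothesis Hg : Group g m e.
Hypothesis Hv : Uniformity x v.
Hypothesis Ha : Action g m e x a.
Hypothesis Huc : forall h, h ∈ g -> forall c, c ∈ v -> exists d, d ∈ v /\
  forall u w, u ~[d] w -> op a h u ~[c] op a h w.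

Let Z := rcf x v.
Let vZ := rcf_unif x v.

(** The image filter of [p] under [h], described through preimages. It is again round and Cauchy
    because both [h] and its inverse act uniformly continuously. *)
Definition shift (h p : M) : M :=
  Sep (Pow x) (fun b => Sep x (fun u => op a h u ∈ b) ∈ p).

Lemma in_shift h p b :
  b ∈ shift h p <-> b ⊆ x /\ Sep x (fun u => op a h u ∈ b) ∈ p.
Proof. unfold shift. rewrite in_Sep by dfn. now rewrite in_Pow. Qed.

Lemma in_preim h b u : u ∈ Sep x (fun u => op a h u ∈ b) <-> u ∈ x /\ op a h u ∈ b.
Proof. revert u. apply in_Sep. dfn. Qed.

Definition trans (h b : M) : M := Sep x (fun w => exists u, u ∈ b /\ w = op a h u).

Lemma in_trans h b w : w ∈ trans h b <-> w ∈ x /\ exists u, u ∈ b /\ w = op a h u.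
Proof. unfold trans. revert w. apply in_Sep. dfn. Qed.

Lemma shift_up h p b d : h ∈ g -> Filter x p -> b ∈ p -> d ⊆ x ->
  (forall u, u ∈ b -> op a h u ∈ d) -> d ∈ shift h p.
Proof.
  intros Hh Hp Hb Hd H. apply in_shift. split; auto.
  apply (Filter_up x p b); auto; intros u Hu; [now apply in_preim in Hu|].
  apply in_preim. split; auto. now apply (Filter_sub x p b).
Qed.

Lemma shift_rcf h p : h ∈ g -> p ∈ Z -> shift h p ∈ Z.
Proof.
  intros Hh Hp. apply (in_rcf x v) in Hp. destruct Hp as (Fp & Cp & Rp).
  assert (Hact : forall u, u ∈ x -> op a h u ∈ x).
  { intros u Hu. now apply (act_in g m e x a Ha). }
  apply (in_rcf x v). split; [|split].
  - apply Filter_intro.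
    + intros b Hb. now apply in_shift in Hb.
    + intros b Hb. apply in_shift in Hb. destruct Hb as [Hb Hb'].
      destruct (Filter_nonempty x p _ Fp Hb') as [u Hu]. apply in_preim in Hu.
      exists (op a h u). tauto.
    + apply (shift_up h p x); auto. apply Fp.
    + intros b d Hb Hd. apply in_shift in Hb, Hd.
      apply (shift_up h p _ _ Hh Fp (Filter_cap x p _ _ Fp (proj2 Hb) (proj2 Hd))).
      * intros z Hz. apply in_Cap in Hz. now apply Hb.
      * intros u Hu. apply in_Cap in Hu. rewrite !in_preim in Hu. apply in_Cap. tauto.
    + intros b d Hb Hd Hbd. apply in_shift in Hb.
      apply (shift_up h p _ _ Hh Fp (proj2 Hb)); auto.
      intros u Hu. apply in_preim in Hu. apply Hbd. tauto.
  - intros c Hc. destruct (Huc h Hh c Hc) as (d & Hd & K).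
    destruct (Cp d Hd) as (b & Hb & L). exists (trans h b). split.
    + apply (shift_up h p b); auto; [intros w Hw; now apply in_trans in Hw|].
      intros u Hu. apply in_trans. assert (u ∈ x) by now apply (Filter_sub x p b).
      split; eauto.
    + intros w Hw w' Hw'. apply in_trans in Hw, Hw'.
      destruct Hw as (_ & u & Hu & ->), Hw' as (_ & u' & Hu' & ->). auto.
  - intros b Hb. apply in_shift in Hb. destruct Hb as [Hb Hb'].
    destruct (Rp _ Hb') as (c & Hc & b' & Hb'' & K).
    (* Roundness of the image rests on uniform continuity of the inverse [k]: a [d]-neighbour of h·u
       is pulled back to a [c]-neighbour of u. *)
    destruct (mul_inv g m e Hg h Hh) as (k & Hk & E1 & E2).
    destruct (Huc k Hk c Hc) as (d & Hd & L). exists d. split; auto.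
    exists (trans h b'). split.
    + apply (shift_up h p b'); auto; [intros w Hw; now apply in_trans in Hw|].
      intros u Hu. apply in_trans. assert (u ∈ x) by now apply (Filter_sub x p b').
      split; eauto.
    + intros w w' Hw Hww. apply in_trans in Hw. destruct Hw as (_ & u & Hu & ->).
      assert (Hux : u ∈ x) by now apply (Filter_sub x p b').
      assert (Hw' : w' ∈ x) by now apply (unif_dom x v Hv d (op a h u) w').
      apply L in Hww. rewrite (act_cancel g m e Hg x a Ha) in Hww; auto.
      apply (K u) in Hww; auto. apply in_preim in Hww. destruct Hww as [_ Hww].
      now rewrite (act_cancel g m e Hg x a Ha) in Hww.
Qed.

Lemma shift_unit p : p ∈ Z -> shift e p = p.
Proof.
  intro Hp. apply (in_rcf x v) in Hp. destruct Hp as (Fp & _).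
  assert (K : forall b, b ⊆ x -> Sep x (fun u => op a e u ∈ b) = b).
  { intros b Hb. apply sub_antisym; intros u Hu.
    - apply in_preim in Hu. rewrite (act_unit g m e Hg x a Ha) in Hu; tauto.
    - apply in_preim. rewrite (act_unit g m e Hg x a Ha); auto. }
  apply sub_antisym; intros b Hb.
  - apply in_shift in Hb. rewrite K in Hb; tauto.
  - apply in_shift. assert (b ⊆ x) by now apply (Filter_sub x p). rewrite K; auto.
Qed.

Lemma shift_mul h k p : h ∈ g -> k ∈ g -> p ∈ Z -> shift (op m h k) p = shift h (shift k p).
Proof.
  intros Hh Hk Hp. apply (in_rcf x v) in Hp. destruct Hp as (Fp & _).
  apply set_ext. intro b. rewrite !in_shift.
  replace (Sep x (fun u => op a k u ∈ Sep x (fun u => op a h u ∈ b)))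
    with (Sep x (fun u => op a (op m h k) u ∈ b)).
  - split; [intros []; split; auto; split; auto|tauto].
    intros z Hz. now apply in_preim in Hz.
  - apply set_ext. intro u. rewrite !in_preim. split; intros [Hu H]; split; auto.
    + rewrite (act_mul g m e Hg x a Ha) in H; auto.
      split; auto. now apply (act_in g m e x a Ha).
    + rewrite (act_mul g m e Hg x a Ha); tauto.
Qed.

Lemma shift_nbhds h u : h ∈ g -> u ∈ x -> nbhds x v (op a h u) = shift h (nbhds x v u).
Proof.
  intros Hh Hu. apply sub_antisym; intros b Hb.
  - apply in_nbhds in Hb. destruct Hb as (Hb & c & Hc & K).
    destruct (Huc h Hh c Hc) as (d & Hd & L). apply in_shift. split; auto.
    apply in_nbhds. split; [intros z Hz; now apply in_preim in Hz|].
    exists d. split; auto. intros w Hw. apply in_preim. split; auto.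
    now apply (unif_dom x v Hv d u w).
  - apply in_shift in Hb. destruct Hb as [Hb Hb'].
    apply in_nbhds in Hb'. destruct Hb' as (_ & c & Hc & K).
    destruct (mul_inv g m e Hg h Hh) as (k & Hk & E1 & E2).
    destruct (Huc k Hk c Hc) as (d & Hd & L).
    apply in_nbhds. split; auto. exists d. split; auto. intros w Hw.
    assert (w ∈ x) by now apply (unif_dom x v Hv d (op a h u) w).
    apply L in Hw. rewrite (act_cancel g m e Hg x a Ha) in Hw; auto.
    apply K, in_preim in Hw. rewrite (act_cancel g m e Hg x a Ha) in Hw; tauto.
Qed.

Lemma shift_near h c : h ∈ g -> c ∈ v -> exists d, d ∈ v /\
  forall p q, p ∈ Z -> q ∈ Z -> near d p q -> near c (shift h p) (shift h q).
Proof.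
  intros Hh Hc. destruct (Huc h Hh c Hc) as (d & Hd & K). exists d. split; auto.
  intros p q Hp Hq (b & Hbp & Hbq & Hb).
  apply (rcf_Filter x v) in Hp, Hq. exists (trans h b).
  assert (L : forall u, u ∈ b -> op a h u ∈ trans h b).
  { intros u Hu. apply in_trans. assert (u ∈ x) by now apply (Filter_sub x p b).
    split; [now apply (act_in g m e x a Ha)|eauto]. }
  split; [|split].
  - apply (shift_up h p b); auto. intros w Hw. now apply in_trans in Hw.
  - apply (shift_up h q b); auto. intros w Hw. now apply in_trans in Hw.
  - intros w w' Hw Hw'. apply in_trans in Hw, Hw'.
    destruct Hw as (_ & u & Hu & ->), Hw' as (_ & u' & Hu' & ->). auto.
Qed.

(** Carries the preflow condition on small group elements over to the completion, uniformly in [p]: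
    a [d]-small member of [p] and its translate together form a [c]-small set. *)
Lemma small_shift c : c ∈ v -> exists d, d ∈ v /\
  forall k, k ∈ g -> (forall u, u ∈ x -> u ~[d] op a k u) ->
  forall p, p ∈ Z -> near c p (shift k p).
Proof.
  intros Hc. destruct (unif_quarter x v Hv c Hc) as (d & Hd & Hs & H1 & H2 & H3 & _).
  exists d. split; auto. intros k Hk Hsmall p Hp. apply (in_rcf x v) in Hp.
  destruct Hp as (Fp & Cp & _). destruct (Cp d Hd) as (b & Hb & Hb').
  assert (Hbx : b ⊆ x) by now apply (Filter_sub x p).
  exists (Cup b (trans k b)).
  assert (Hsub : Cup b (trans k b) ⊆ x).
  { intros z Hz. apply in_Cup in Hz. rewrite in_trans in Hz. destruct Hz as [Hz|Hz]; [auto|tauto]. }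
  split; [|split].
  - apply (Filter_up x p b); auto. intros z Hz. apply in_Cup. auto.
  - apply (shift_up k p b); auto. intros u Hu. rewrite in_Cup, in_trans. right.
    split; [apply (act_in g m e x a Ha)|]; eauto.
  - intros w w' Hw Hw'. apply in_Cup in Hw, Hw'. rewrite in_trans in Hw, Hw'.
    destruct Hw as [Hw|(_ & u & Hu & ->)], Hw' as [Hw'|(_ & u' & Hu' & ->)].
    + apply H1. auto.
    + apply (H2 w u' _); auto.
    + apply (H2 _ u w'); auto.
    + apply (H3 _ u u' _); auto.
Qed.

Definition ext_action : M :=
  Rsep (Prod g Z) Z (fun r q => exists h p, r = Pair h p /\ q = shift h p).

Lemma ext_action_App2 h p q :
  App2 ext_action h p q <-> h ∈ g /\ p ∈ Z /\ q = shift h p.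
Proof.
  unfold App2, ext_action. rewrite in_Rsep by (unfold shift; dfn). rewrite Pair_in_Prod.
  split.
  - intros ([Hh Hp] & Hq & h' & p' & E & ->). apply Pair_inj in E. destruct E as [<- <-]. auto.
  - intros (Hh & Hp & ->). split; auto. split; [now apply shift_rcf|]. eauto.
Qed.

Lemma ext_action_Action : Action g m e Z ext_action.
Proof.
  split; [split|split].
  - unfold ext_action. apply Rsep_sub. unfold shift. dfn.
  - intros r Hr. apply in_Prod in Hr. destruct Hr as (h & p & Hh & Hp & ->).
    exists (shift h p). split; [now apply shift_rcf|]. intro q.
    change (Pair (Pair h p) q ∈ ext_action) with (App2 ext_action h p q).
    rewrite ext_action_App2. tauto.
  - intros p Hp. apply ext_action_App2. rewrite shift_unit; auto.
    split; [apply Hg|auto].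
  - intros h Hh k Hk p Hp hk kp [H1 H2]. apply ext_action_App2 in H2.
    destruct H2 as (_ & _ & ->). apply (mul_App2 g m e Hg) in H1; auto. subst hk.
    exists (shift h (shift k p)). rewrite !ext_action_App2.
    rewrite shift_mul; auto using shift_rcf. split.
    + split; auto. now apply (mul_in g m e Hg).
    + auto using shift_rcf.
Qed.

Variables (n s t : M).
Hypothesis Hs : TopGroup g m e s.
Hypothesis Hn : BaseAt n e s.
Hypothesis Hcont : forall c, c ∈ v -> exists V, V ∈ n /\
  forall u h, u ∈ x -> h ∈ V -> u ~[c] op a h u.
Hypothesis Ht : UTop Z vZ t.

Lemma ext_action_Cont2 : Cont2 g s Z t t ext_action.
Proof.
  intros h Hh p Hp o Ho (q & Hqo & Hq). apply ext_action_App2 in Hq.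
  destruct Hq as (_ & _ & ->).
  destruct (open_nbhd Z vZ (rcf_Uniformity x v Hv) t Ht o _ Ho Hqo) as (D & HD & HDo).
  destruct (rcf_near x v D HD) as (c & Hc & Hc').
  destruct (unif_half x v Hv c Hc) as (c1 & Hc1 & _ & Hcc).
  destruct (shift_near h c1 Hh Hc1) as (d & Hd & Hd').
  destruct (near_in_unif x v d Hd) as (D1 & HD1 & HD1').
  destruct (ball_nbhd Z vZ (rcf_Uniformity x v Hv) t Ht D1 p HD1 Hp) as (Q & HQ & HpQ & HQ').
  destruct (small_shift c1 Hc1) as (d2 & Hd2 & Hd2').
  destruct (Hcont d2 Hd2) as (V & HV & HV').
  destruct Hn as [Hn1 _]. destruct (Hn1 V HV) as [HVs HeV].
  destruct (mul_inv g m e Hg h Hh) as (k & Hk & E1 & E2).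
  destruct Hs as (_ & Htop & _ & Hm & _).
  (* For [h'] near [h], write h' = (h' k) h with [k] the inverse of [h]. Continuity of the
     multiplication at (h, k) puts h' k into [V], where [small_shift] applies; the remaining factor
     [h] is a fixed uniformly continuous map. *)
  destruct (Hm h Hh k Hk V HVs) as (P & HP & Q' & HQ1 & HhP & HkQ & HPQ).
  { exists e. split; auto. apply (mul_App2 g m e Hg); auto. }
  exists P. split; auto. exists Q. do 3 (split; auto).
  intros h' Hh' q Hq.
  assert (Hh'g : h' ∈ g) by (destruct Htop as [K _]; now apply (K P)).
  assert (HqZ : q ∈ Z) by now apply (open_sub Z vZ t Ht Q).
  exists (shift h' q). split; [|now apply ext_action_App2].
  assert (HhkV : op m h' k ∈ V).
  { destruct (HPQ h' Hh' k HkQ) as (w & Hw & Hw'). apply (mul_App2 g m e Hg) in Hw'; auto.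
    now subst w. }
  assert (Hhk : op m h' k ∈ g) by now apply (mul_in g m e Hg).
  assert (Eh : shift h' q = shift (op m h' k) (shift h q)).
  { rewrite <- shift_mul; auto.
    rewrite (mul_assoc g m e Hg), E2, (mul_unit_r g m e Hg); auto. }
  apply HDo, Hc'; auto using shift_rcf.
  apply (near_trans x v c c1 _ (shift h q) _ Hc1); auto using shift_rcf.
  - apply Hd'; auto. now apply HQ', HD1' in Hq.
  - rewrite Eh. apply Hd2'; auto using shift_rcf.
Qed.

End Extension.

(** * The completion of a preflow is a flow *)

Section PreflowFacts.
Context {M : Type} {HM : model M}.

Lemma Preflow_completion (g m n x b a : M) : Preflow g m n x b a ->
  exists e s, TopGroup g m e s /\ BaseAt n e s /\
  exists z v t i α, Completion x b z v t i /\ Flow g m e s z t α /\ Extends g x a i α.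
Proof.
  intros (e & (s & Hs & Hn) & (v & t & Hv & Ht & HH & Hbv & Hbase & _ & _)
    & Hpre & Ha & Huc & Hcont).
  exists e, s. split; auto. split; auto.
  assert (Hg : Group g m e) by apply Hs.
  assert (Hpre' : Precompact x v).
  { intros c Hc. destruct (Hbase c Hc) as (d & Hd & Hdc).
    destruct (Hpre d Hd) as (f & Hf & Hfin & Hcov). exists f. split; auto. split; auto.
    intros u Hu. destruct (Hcov u Hu) as (w & Hw & K). exists w. auto. }
  assert (Huc' : forall h, h ∈ g -> forall c, c ∈ v -> exists d, d ∈ v /\
    forall u w, u ~[d] w -> op a h u ~[c] op a h w).
  { intros h Hh c Hc. destruct (Hbase c Hc) as (c' & Hc' & Hsub).
    destruct (Huc h Hh c' Hc') as (d & Hd & K). exists d. split; [now apply Hbv|].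
    intros u w Huw. destruct (unif_dom x v Hv d u w (Hbv d Hd) Huw) as [Hu Hw].
    apply Hsub, (K u Hu w Hw); auto. split; [|split]; auto; now apply (act_App2 g m e x a Ha). }
  assert (Hcont' : forall c, c ∈ v -> exists V, V ∈ n /\
    forall u h, u ∈ x -> h ∈ V -> u ~[c] op a h u).
  { intros c Hc. destruct (Hbase c Hc) as (c' & Hc' & Hsub).
    destruct (Hcont c' Hc') as (V & HV & K). exists V. split; auto.
    intros u h Hu Hh. apply Hsub, (K u Hu h Hh). apply (act_App2 g m e x a Ha); auto.
    destruct Hs as (_ & [Htop _] & _). destruct Hn as [Hn _].
    now apply (Htop V (proj1 (Hn V HV))). }
  set (z := rcf x v). set (vz := rcf_unif x v). set (tz := utop z vz).
  assert (Htz : UTop z vz tz) by apply utop_UTop.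
  assert (Hvz := rcf_Uniformity x v Hv).
  exists z, vz, tz, (Lam x (nbhds x v)), (ext_action g x v a).
  split; [now apply rcf_Completion|]. split.
  - split; [exact (UTop_Topology z vz Hvz tz Htz)|].
    split; [exact (separated_Hausdorff z vz Hvz tz Htz (rcf_separated x v))|]. split.
    + apply (precompact_complete_Compact z vz tz Hvz Htz).
      * now apply rcf_Precompact.
      * now apply rcf_Complete.
    + split.
      * now apply ext_action_Action.
      * now apply (ext_action_Cont2 g m e x v a Hg Hv Ha Huc' n s tz Hs Hn Hcont').
  - intros h Hh u Hu hu iu ihu (H1 & H2 & H3).
    apply (act_App2 g m e x a Ha) in H1; auto. subst hu.
    rewrite in_Lam in H2 by dfn. rewrite in_Lam in H3 by dfn.
    destruct H2 as [_ ->], H3 as [_ ->].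
    apply (ext_action_App2 g m e x v a Hg Hv Ha Huc'). split; auto.
    split; [now apply nbhds_rcf|]. now apply (shift_nbhds g m e).
Qed.

End PreflowFacts.

(** * Tameness in terms of finite sets *)

Section NotTameDefs.
Context {M : Type} {HM : model M}.

Definition Hits (a U E u F : M) : Prop :=
  forall h, h ∈ F -> exists w, w ∈ E /\ w ~[U] op a h u.

(** A uniform form of disjointness, strong enough to keep the closures of the two neighbourhoods
    apart in the completion. *)
Definition Apart (U E0 E1 : M) : Prop :=
  forall y z w0 w1, w0 ∈ E0 -> w1 ∈ E1 -> w0 ~[U] y -> w1 ~[U] z -> ~ y ~[U] z.

Definition Indep (x a U E0 E1 s : M) : Prop :=
  forall F0 F1, Finite F0 -> Finite F1 -> F0 ⊆ s -> F1 ⊆ s -> Disj F0 F1 ->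
    exists u, u ∈ x /\ Hits a U E0 u F0 /\ Hits a U E1 u F1.
End NotTameDefs.

#[export] Hint Unfold Hits Apart Indep : dfn.

Section Tameness.
Context {M : Type} {HM : model M}.

Variables (g m e s x b v a z vz t i α : M).
Hypothesis Hv : Uniformity x v.
Hypothesis Hbv : b ⊆ v.
Hypothesis Hbase : forall c, c ∈ v -> exists d, d ∈ b /\ d ⊆ c.
Hypothesis Hpre : Precompact x b.
Hypothesis Ha : Action g m e x a.
Hypothesis HZ : Completion x b z vz t i.
Hypothesis Hflow : Flow g m e s z t α.
Hypothesis Hext : Extends g x a i α.

Let Hvz : Uniformity z vz := proj1 HZ.
Let Ht : UTop z vz t := proj1 (proj2 HZ).
Let Htop : Topology z t := proj1 Hflow.
Let Hcpt : Compact z t := proj1 (proj2 (proj2 Hflow)).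
Let Hα : Action g m e z α := proj1 (proj2 (proj2 (proj2 Hflow))).
Let Hcont : Cont2 g s z t t α := proj2 (proj2 (proj2 (proj2 Hflow))).

Let I (u : M) : M := App i u.

Local Lemma i_Func : Func i x z.
Proof. pose proof HZ as (_ & _ & _ & _ & H & _). exact H. Qed.

Local Lemma I_in u : u ∈ x -> I u ∈ z.
Proof. intro Hu. apply (Func_App i x z u i_Func Hu). Qed.

Local Lemma I_graph u : u ∈ x -> u ~[i] I u.
Proof. intro Hu. apply (Func_App i x z u i_Func Hu). Qed.

Local Lemma I_eq u p : u ~[i] p -> p = I u.
Proof.
  intro H. destruct (Func_dom i x z u p i_Func H) as [Hu _].
  now apply (Func_iff i x z u p i_Func Hu).
Qed.

Local Lemma I_unif c : c ∈ vz -> exists d, d ∈ b /\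
  forall u w, u ~[d] w -> I u ~[c] I w.
Proof.
  intro Hc. pose proof HZ as (_ & _ & _ & _ & _ & H & _).
  destruct (H c Hc) as (d & Hd & K). exists d. split; auto. intros u w Huw.
  destruct (unif_dom x v Hv d u w (Hbv d Hd) Huw) as [Hu Hw].
  apply (K u Hu w Hw). auto using I_graph.
Qed.

Local Lemma I_unif_inv d : d ∈ b -> exists c, c ∈ vz /\
  forall u w, u ∈ x -> w ∈ x -> I u ~[c] I w -> u ~[d] w.
Proof.
  intro Hd. pose proof HZ as (_ & _ & _ & _ & _ & _ & H & _).
  destruct (H d Hd) as (c & Hc & K). exists c. split; auto. intros u w Hu Hw Huw.
  apply (K u Hu w Hw (I u) (I w)). auto using I_graph.
Qed.

Local Lemma I_dense o p : o ∈ t -> p ∈ o -> exists u, u ∈ x /\ I u ∈ o.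
Proof.
  intros Ho Hp. pose proof HZ as (_ & _ & _ & _ & _ & _ & _ & H).
  destruct (H o Ho) as (u & Hu & q & Hq & E).
  - apply not_Empty. eauto.
  - exists u. split; auto. now rewrite <- (I_eq u q).
Qed.

Local Lemma I_act h u : h ∈ g -> u ∈ x -> op α h (I u) = I (op a h u).
Proof.
  intros Hh Hu. symmetry. apply (act_App2 g m e z α Hα); auto using I_in.
  assert (Hhu : op a h u ∈ x) by now apply (act_in g m e x a Ha).
  apply (Hext h Hh u Hu (op a h u)). split; [|auto using I_graph].
  now apply (act_App2 g m e x a Ha).
Qed.

Local Lemma act_nbhd h p o : h ∈ g -> p ∈ z -> o ∈ t -> op α h p ∈ o ->
  exists Q, Q ∈ t /\ p ∈ Q /\ forall q, q ∈ Q -> op α h q ∈ o.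
Proof.
  intros Hh Hp Ho Hpo.
  destruct (Hcont h Hh p Hp o Ho) as (P & HP & Q & HQ & HhP & HpQ & K).
  - exists (op α h p). split; auto. now apply (act_App2 g m e z α Hα).
  - exists Q. split; auto. split; auto. intros q Hq.
    destruct (K h HhP q Hq) as (w & Hw & E). apply (act_App2 g m e z α Hα) in E; auto.
    + now subst w.
    + now apply (open_sub z vz t Ht Q).
Qed.

Local Lemma finite_act_nbhd A p : A ∈ t -> p ∈ z -> forall F, Finite F -> F ⊆ g ->
  (forall h, h ∈ F -> op α h p ∈ A) ->
  exists Q, Q ∈ t /\ p ∈ Q /\ forall q, q ∈ Q -> forall h, h ∈ F -> op α h q ∈ A.
Proof.
  intros HA Hp F HF. pattern F. revert F HF. apply Finite_ind.
  - dfn.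
  - intros _ _. exists z. split; [apply Htop|]. split; auto.
    intros q _ h Hh. now apply in_Emp in Hh.
  - intros F h _ _ IH HF H.
    destruct IH as (Q & HQ & HpQ & K).
    { intros k Hk. apply HF, in_Add. auto. }
    { intros k Hk. apply H, in_Add. auto. }
    destruct (act_nbhd h p A) as (Q' & HQ' & HpQ' & K'); auto.
    { apply HF, in_Add. auto. }
    { apply H, in_Add. auto. }
    pose proof Htop as (_ & _ & Hcap & _). destruct (Hcap Q HQ Q' HQ') as (Q2 & HQ2 & ->).
    exists (Cap Q Q'). split; auto. split; [now apply in_Cap|].
    intros q Hq k Hk. apply in_Cap in Hq. apply in_Add in Hk. destruct Hk as [Hk| ->].
    + now apply K.
    + now apply K'.
Qed.

Lemma Hits_sub c E u F F' : F ⊆ F' -> Hits a c E u F' -> Hits a c E u F.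
Proof. intros H K h Hh. apply K. auto. Qed.

(** Finite parts of a partition of [S] are realized by points of X, and compactness of the
    completion merges these into one point. Limits satisfy only closed conditions, so the open sets
    [B E0] and [B E1] are taken slightly larger than the closures of the [c]-neighbourhoods of [E0]
    and [E1]; apartness leaves the room for this. *)
Theorem independent_not_tame c E0 E1 S : c ∈ b -> E0 ⊆ x -> E1 ⊆ x -> Apart c E0 E1 ->
  S ⊆ g -> ~ Finite S -> Indep x a c E0 E1 S -> ~ Tame g z t α.
Proof.
  intros Hc HE0 HE1 Hap HS Hinf Hind Htame.
  destruct (I_unif_inv c Hc) as (C & HC & HCc).
  destruct (unif_quarter z vz Hvz C HC) as (d & Hd & Hsym & Hd1 & _ & _ & Hd4).
  destruct (unif_half z vz Hvz d Hd) as (d' & Hd' & Hsym' & Hd'').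
  set (inA := fun E u => u ∈ x /\ exists w, w ∈ E /\ w ~[c] u).
  (* [B E] is the interior of the [d]-neighbourhood of the image of [inA E]. A common closure point
     of [B E0] and [B E1] would join images of [inA E0] and [inA E1] by four [d]-steps, that is by a
     [C]-step, against apartness. *)
  set (B := fun E => Union (Sep t (fun o => forall q, q ∈ o ->
    exists u, inA E u /\ I u ~[d] q))).
  assert (HB : forall E p, p ∈ B E <-> exists o, (o ∈ t /\ forall q, q ∈ o ->
    exists u, inA E u /\ I u ~[d] q) /\ p ∈ o).
  { intros E p. unfold B. rewrite in_Union. split; intros (o & Ho & Hp); exists o;
      rewrite in_Sep in * by (unfold inA, I; dfn); auto. }
  assert (HBt : forall E, B E ∈ t).
  { intro E. pose proof Htop as (_ & _ & _ & HU).
    destruct (HU (Sep t (fun o => forall q, q ∈ o -> exists u, inA E u /\ I u ~[d] q)))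
      as (q & Hq & Eq).
    - intros o Ho. rewrite in_Sep in Ho by (unfold inA, I; dfn). tauto.
    - unfold B. now rewrite <- Eq. }
  set (cl := fun E p => p ∈ z /\ forall o, o ∈ t -> p ∈ o -> exists u, inA E u /\ I u ∈ o).
  assert (HclB : forall E p, cl E p -> p ∈ B E).
  { intros E p [Hp H]. apply HB.
    destruct (ball_nbhd z vz Hvz t Ht d' p Hd' Hp) as (o & Ho & Hpo & K).
    exists o. split; auto. split; auto. intros q Hq.
    destruct (H o Ho Hpo) as (u & Hu & Huo). exists u. split; auto.
    apply (Hd'' _ p q); auto. }
  assert (HAcl : forall E u, inA E u -> cl E (I u)).
  { intros E u Hu. split; [apply I_in, Hu|]. eauto. }
  assert (Hdisj : forall p, p ∈ z -> InCl t (B E0) p -> InCl t (B E1) p -> False).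
  { intros p Hp H0 H1.
    destruct (ball_nbhd z vz Hvz t Ht d p Hd Hp) as (o & Ho & Hpo & K).
    destruct (proj1 (not_Disj _ _) (H0 o Ho Hpo)) as (q0 & Hq0 & Hq0').
    destruct (proj1 (not_Disj _ _) (H1 o Ho Hpo)) as (q1 & Hq1 & Hq1').
    apply HB in Hq0', Hq1'. destruct Hq0' as (o0 & [_ L0] & Hq0').
    destruct Hq1' as (o1 & [_ L1] & Hq1').
    destruct (L0 q0 Hq0') as (u0 & (Hu0 & w0 & Hw0 & Hwu0) & Hd0).
    destruct (L1 q1 Hq1') as (u1 & (Hu1 & w1 & Hw1 & Hwu1) & Hd11).
    apply (Hap u0 u1 w0 w1 Hw0 Hw1 Hwu0 Hwu1). apply HCc; auto.
    apply (Hd4 (I u0) q0 p q1 (I u1)); auto. }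
  assert (HinCl : forall E p, p ∈ B E -> InCl t (B E) p).
  { intros E p Hp o Ho Hpo. apply not_Disj. eauto. }
  assert (HBz : forall E, B E ⊆ z) by (intro E; apply (open_sub z vz t Ht), HBt).
  (* Nonemptiness of [B E0] and [B E1] is read off from one element of [S]; an empty [S] would be
     finite. *)
  destruct (classic (exists h, h ∈ S)) as [[h0 Hh0]|Hno].
  2:{ apply Hinf. replace S with (Emp : M); [apply Finite_Emp|].
      apply set_ext. intro h. rewrite in_Emp. split; [tauto|]. intro. apply Hno. eauto. }
  assert (Hone : forall h, h ∈ S -> Upair h h ⊆ S).
  { intros h Hh k Hk. apply in_Upair in Hk. destruct Hk; subst; auto. }
  assert (HEmp : Emp ⊆ S) by (intros h Hh; now apply in_Emp in Hh).
  assert (HinA : forall E u h, h ∈ g -> u ∈ x -> Hits a c E u (Upair h h) -> inA E (op a h u)).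
  { intros E u h Hh Hu H. split; [now apply (act_in g m e x a Ha)|].
    apply H. apply in_Upair. auto. }
  apply Htame. exists (B E0). split; auto. exists (B E1). split; auto. exists S.
  split; [|split; [|split; [|split; [|split]]]]; auto.
  - apply not_Empty. destruct (Hind (Upair h0 h0) Emp) as (u & Hu & H0 & _);
      auto using Finite_Upair, Finite_Emp.
    { now apply Hone. }
    { intros (k & _ & Hk). now apply in_Emp in Hk. }
    exists (I (op a h0 u)). apply HclB, HAcl, HinA; auto.
  - apply not_Empty. destruct (Hind Emp (Upair h0 h0)) as (u & Hu & _ & H1);
      auto using Finite_Upair, Finite_Emp.
    { now apply Hone. }
    { intros (k & Hk & _). now apply in_Emp in Hk. }
    exists (I (op a h0 u)). apply HclB, HAcl, HinA; auto.
  - intros (p & Hp & H0 & H1). eauto.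
  - intros S0 S1 (HS0 & HS1 & Hpart & Hdis).
    assert (exists p, p ∈ z /\ (forall h, h ∈ S0 -> cl E0 (op α h p)) /\
                               (forall h, h ∈ S1 -> cl E1 (op α h p))) as (p & Hp & H0 & H1).
    { apply NNPP. intro Hno.
      (* If no point works, every point of the completion has a neighbourhood in which some single
         element of [S0] or [S1] gives a condition that fails at all points of X. Compactness
         collects these elements into finite [F0] and [F1] that no point of X satisfies. *)
      assert (K : exists F0 F1, Finite F0 /\ Finite F1 /\ F0 ⊆ S0 /\ F1 ⊆ S1 /\
        forall u, u ∈ x -> I u ∈ z -> Hits a c E0 u F0 -> Hits a c E1 u F1 -> False).
      { pattern z. apply (compact_induction z t); auto.
        - unfold I. dfn.
        - exists Emp, Emp. repeat split; auto using Finite_Emp.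
          + intros h Hh. now apply in_Emp in Hh.
          + intros h Hh. now apply in_Emp in Hh.
          + intros u _ Hu. now apply in_Emp in Hu.
        - intros o p (F0 & F1 & Hf0 & Hf1 & Hs0 & Hs1 & K)
            (F0' & F1' & Hf0' & Hf1' & Hs0' & Hs1' & K').
          exists (Cup F0 F0'), (Cup F1 F1'). repeat split; auto using Finite_Cup.
          + intros h Hh. apply in_Cup in Hh. destruct Hh; auto.
          + intros h Hh. apply in_Cup in Hh. destruct Hh; auto.
          + intros u Hu Huo L0 L1. apply in_Cup in Huo. destruct Huo as [Huo|Huo].
            * apply (K u); auto; (eapply Hits_sub; [|eassumption]);
                intros h Hh; apply in_Cup; auto.
            * apply (K' u); auto; (eapply Hits_sub; [|eassumption]);
                intros h Hh; apply in_Cup; auto.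
        - intros p Hp.
          assert (Hsing : forall F h, h ∈ F -> Upair h h ⊆ F).
          { intros F h Hh k Hk. apply in_Upair in Hk. destruct Hk; subst; auto. }
          assert (Hfar : forall E h, h ∈ S -> ~ cl E (op α h p) ->
            exists Q, Q ∈ t /\ p ∈ Q /\ forall u, u ∈ x -> I u ∈ Q ->
              Hits a c E u (Upair h h) -> False).
          { intros E h Hh Hcl.
            assert (op α h p ∈ z) by (apply (act_in g m e z α Hα); auto).
            assert (exists o, o ∈ t /\ op α h p ∈ o /\ forall u, inA E u -> I u ∉ o)
              as (o & Ho & Hpo & K).
            { apply NNPP. intro K. apply Hcl. split; auto. intros o Ho Hpo.
              apply NNPP. intro L. apply K. exists o. split; auto. split; auto.
              intros u Hu Huo. apply L. eauto. }
            destruct (act_nbhd h p o) as (Q & HQ & HpQ & L); auto.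
            exists Q. split; auto. split; auto. intros u Hu HuQ Hhit.
            apply (K (op a h u)); [apply HinA; auto|].
            rewrite <- I_act; auto. }
          destruct (classic (exists h, h ∈ S0 /\ ~ cl E0 (op α h p))) as [(h & Hh & Hcl)|N0].
          + destruct (Hfar E0 h) as (Q & HQ & HpQ & K); auto.
            exists Q. split; auto. split; auto. exists (Upair h h), Emp.
            repeat split; auto using Finite_Upair, Finite_Emp.
            * now apply Hsing.
            * intros k Hk. now apply in_Emp in Hk.
            * intros u Hu HuQ Hhit _. eauto.
          + destruct (classic (exists h, h ∈ S1 /\ ~ cl E1 (op α h p))) as [(h & Hh & Hcl)|N1].
            * destruct (Hfar E1 h) as (Q & HQ & HpQ & K); auto.
              exists Q. split; auto. split; auto. exists Emp, (Upair h h).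
              repeat split; auto using Finite_Upair, Finite_Emp.
              -- intros k Hk. now apply in_Emp in Hk.
              -- now apply Hsing.
              -- intros u Hu HuQ _ Hhit. eauto.
            * exfalso. apply Hno. exists p. split; auto.
              split; intros h Hh; apply NNPP; intro; eauto. }
      destruct K as (F0 & F1 & Hf0 & Hf1 & Hs0 & Hs1 & K).
      destruct (Hind F0 F1) as (u & Hu & L0 & L1); auto.
      { intros (h & Hh0' & Hh1'). apply Hdis. exists h. auto. }
      apply (K u); auto. now apply I_in. }
    exists p. split; auto. intros h Hh q Hq.
    apply (act_App2 g m e z α Hα) in Hq; auto. subst q.
    assert (Hpz : op α h p ∈ z) by (apply (act_in g m e z α Hα); auto).
    destruct (Hpart h Hh) as [K|K].
    + assert (L := HclB _ _ (H0 h K)). split; split; auto.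
      intro L'. exfalso. eauto.
    + assert (L := HclB _ _ (H1 h K)). split; split; auto.
      intro L'. exfalso. eauto.
Qed.

(** Disjoint closures in a compact space are uniformly separated, so traces of a finite net on [A0]
    and [A1] at a small enough scale are apart. A shattering point satisfies open conditions at
    finitely many group elements, so by density some point of X satisfies them too. *)
Theorem not_tame_independent : ~ Tame g z t α -> exists c E0 E1 S,
  c ∈ b /\ E0 ⊆ x /\ E1 ⊆ x /\ Finite E0 /\ Finite E1 /\ Apart c E0 E1 /\
  S ⊆ g /\ ~ Finite S /\ Indep x a c E0 E1 S.
Proof.
  intro Hnt. apply NNPP in Hnt.
  destruct Hnt as (A0 & HA0 & A1 & HA1 & S & _ & _ & Hcl & HS & Hinf & Hsh).
  assert (exists C, C ∈ vz /\ forall p q, p ∈ z -> p ∈ A0 -> q ∈ A1 -> ~ p ~[C] q)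
    as (C & HC & HCsep).
  (* Only the range of [p] is localized; [q] runs over all of [A1] throughout. *)
  { pattern z at 1. apply (compact_induction z t); auto.
    - dfn.
    - exists (Prod z z). split; [now apply unif_full|]. intros p q Hp. now apply in_Emp in Hp.
    - intros o o' (c & Hc & K) (c' & Hc' & K'). exists (Cap c c').
      split; [now apply (unif_cap z)|]. intros p q Hp Hp0 Hq H.
      apply in_Cup in Hp. apply in_Cap in H. destruct Hp as [Hp|Hp].
      + apply (K p q); tauto.
      + apply (K' p q); tauto.
    - intros p Hp. destruct (classic (InCl t A0 p)) as [H0|H0].
      + assert (H1 : ~ InCl t A1 p) by (intro; apply Hcl; eauto).
        apply not_all_ex_not in H1. destruct H1 as [o H1].
        apply imply_to_and in H1. destruct H1 as [Ho H1].
        apply imply_to_and in H1. destruct H1 as [Hpo H1]. apply NNPP in H1.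
        destruct (open_nbhd z vz Hvz t Ht o p Ho Hpo) as (c & Hc & K).
        destruct (unif_half z vz Hvz c Hc) as (d & Hd & Hsym & Hd').
        destruct (ball_nbhd z vz Hvz t Ht d p Hd Hp) as (Q & HQ & HpQ & L).
        exists Q. split; auto. split; auto. exists d. split; auto.
        intros q r Hq _ Hr Hqr. apply H1. exists r. split; auto. apply K. eauto.
      + apply not_all_ex_not in H0. destruct H0 as [o H0].
        apply imply_to_and in H0. destruct H0 as [Ho H0].
        apply imply_to_and in H0. destruct H0 as [Hpo H0]. apply NNPP in H0.
        exists o. split; auto. split; auto. exists (Prod z z). split; [now apply unif_full|].
        intros q r Hq Hq0 _ _. apply H0. eauto. }
  destruct (I_unif C HC) as (W & HW & HWC).
  (* The chain u0, w0, y, y', w1 of four [U]-steps has to fit into [W1], and one more step to u1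
     into [W], which [I] maps into [C]. *)
  destruct (unif_half x v Hv W (Hbv W HW)) as (W1 & HW1 & _ & HW1').
  destruct (unif_quarter x v Hv W1 HW1) as (U0 & HU0 & Hsym & HU1 & _ & _ & HU4).
  destruct (Hbase U0 HU0) as (U & HU & HUsub).
  destruct (Hpre U HU) as (f & Hfx & Hfin & Hcov).
  set (E := fun A => Sep f (fun w => exists u, u ∈ x /\ I u ∈ A /\ w ~[U] u)).
  assert (HE : forall A w, w ∈ E A <-> w ∈ f /\ exists u, u ∈ x /\ I u ∈ A /\ w ~[U] u).
  { intro A. apply in_Sep. unfold I. dfn. }
  assert (HEf : forall A, E A ⊆ f) by (intros A w Hw; now apply HE in Hw).
  exists U, (E A0), (E A1), S. split; auto. split; [eauto|]. split; [eauto|].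
  split; [eauto using Finite_sub|]. split; [eauto using Finite_sub|].
  split; [|split; [|split]]; auto.
  - intros y y' w0 w1 Hw0 Hw1 Hy Hy' Hyy.
    apply HE in Hw0, Hw1. destruct Hw0 as (_ & u0 & Hu0 & Hu0A & Hwu0).
    destruct Hw1 as (_ & u1 & Hu1 & Hu1A & Hwu1).
    apply (HCsep (I u0) (I u1)); auto using I_in. apply HWC, (HW1' u0 w1 u1).
    + apply (HU4 u0 w0 y y' w1); auto.
    + auto.
  - intros F0 F1 Hf0 Hf1 Hs0 Hs1 Hdis.
    destruct (Hsh F0 (Diff S F0)) as (p & Hp & K).
    { split; auto. split; [intros h Hh; now apply in_Diff in Hh|]. split.
      - intros h Hh. rewrite in_Diff. destruct (classic (h ∈ F0)); auto.
      - intros (h & Hh & Hh'). now apply in_Diff in Hh'. }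
    destruct (finite_act_nbhd A0 p HA0 Hp F0 Hf0) as (Q0 & HQ0 & HpQ0 & L0).
    { auto. }
    { intros h Hh. apply (K h); auto. apply (act_App2 g m e z α Hα); auto. }
    destruct (finite_act_nbhd A1 p HA1 Hp F1 Hf1) as (Q1 & HQ1 & HpQ1 & L1).
    { auto. }
    { intros h Hh. apply (K h); auto. { apply (act_App2 g m e z α Hα); auto. }
      apply in_Diff. split; auto. intro. apply Hdis. eauto. }
    pose proof Htop as (_ & _ & Hcap & _).
    destruct (Hcap Q0 HQ0 Q1 HQ1) as (Q & HQ & EQ).
    destruct (I_dense Q p HQ) as (u & Hu & HuQ); [subst Q; now apply in_Cap|].
    rewrite EQ in HuQ. apply in_Cap in HuQ. destruct HuQ as [Hu0 Hu1].
    exists u. split; auto.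
    assert (L : forall A F, F ⊆ S -> (forall h, h ∈ F -> op α h (I u) ∈ A) ->
      Hits a U (E A) u F).
    { intros A F HF H h Hh. assert (Hhg : h ∈ g) by auto.
      assert (Hhu : op a h u ∈ x) by now apply (act_in g m e x a Ha).
      destruct (Hcov (op a h u) Hhu) as (w & Hw & Hwu). exists w. split; auto.
      apply HE. split; auto. exists (op a h u). split; auto. split; auto.
      rewrite <- I_act; auto. }
    split; apply L; auto.
Qed.

End Tameness.

(** * Rank functions of well-founded relations *)

Section CollapseDefs.
Context {M : Type} {HM : model M}.

(** A partial solution of the collapsing recursion, closed under predecessors. Single-valuedness is
    not built in, since it follows from well-foundedness ([rank_unique]); the solutions can then be
    united. *)
Definition rank_approx (N : M) (R : M -> M -> Prop) (h : M) : Prop :=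
  forall F y, F ~[h] y -> F ∈ N /\
    (forall F', F' ∈ N -> R F' F -> exists y', y' ∈ y /\ F' ~[h] y') /\
    (forall y', y' ∈ y -> exists F', F' ∈ N /\ R F' F /\ F' ~[h] y').

Definition has_rank (N : M) (R : M -> M -> Prop) (F y : M) : Prop :=
  exists h, rank_approx N R h /\ F ~[h] y.
End CollapseDefs.

#[export] Hint Unfold rank_approx has_rank : dfn.

Section Collapse.
Context {M : Type} {HM : model M}.
Variables (N : M) (R : M -> M -> Prop).
Hypothesis HR : def (fun v => R (v 0) (v 1)).
Hypothesis wf : forall S, S ⊆ N -> (exists F, F ∈ S) ->
  exists F, F ∈ S /\ forall F', F' ∈ S -> ~ R F' F.

Lemma wf_ind (P : M -> Prop) : def (fun v => P (v 0)) ->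
  (forall F, F ∈ N -> (forall F', F' ∈ N -> R F' F -> P F') -> P F) ->
  forall F, F ∈ N -> P F.
Proof.
  intros HP IH F HF. apply NNPP. intro HnP.
  assert (K : forall F, F ∈ Sep N (fun F => ~ P F) <-> F ∈ N /\ ~ P F)
    by (apply in_Sep; dfn).
  destruct (wf (Sep N (fun F => ~ P F))) as (F0 & HF0 & Hmin).
  - intros z Hz. now apply K in Hz.
  - exists F. now apply K.
  - apply K in HF0. destruct HF0 as [HF0 HnP0]. apply HnP0, IH; auto.
    intros F' HF' HRF. apply NNPP. intro. apply (Hmin F'); auto. now apply K.
Qed.

Lemma rank_unique : forall F, F ∈ N -> forall y1 y2,
  has_rank N R F y1 -> has_rank N R F y2 -> y1 = y2.
Proof.
  apply (wf_ind (fun F => forall y1 y2, has_rank N R F y1 -> has_rank N R F y2 -> y1 = y2));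
    [dfn|].
  assert (K : forall F, F ∈ N -> (forall F', F' ∈ N -> R F' F -> forall y1 y2,
    has_rank N R F' y1 -> has_rank N R F' y2 -> y1 = y2) ->
    forall y1 y2, has_rank N R F y1 -> has_rank N R F y2 -> y1 ⊆ y2).
  { intros F HF IH y1 y2 (h1 & G1 & K1) (h2 & G2 & K2) y Hy.
    destruct (G1 F y1 K1) as (_ & _ & D). destruct (D y Hy) as (F' & HF' & HRF & Hy1).
    destruct (G2 F y2 K2) as (_ & U & _). destruct (U F' HF' HRF) as (y' & Hy' & Hy2).
    rewrite (IH F' HF' HRF y y'); auto; eexists; eauto. }
  intros F HF IH y1 y2 H1 H2. apply sub_antisym; apply (K F); auto.
Qed.

(* The values are the Mostowski collapse: [y] is the set of the ranks of the
   [R]-predecessors of [F]. *)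
Theorem rank_function : exists H,
  (forall F, F ∈ N -> exists y, F ~[H] y) /\
  (forall F y F', F ~[H] y -> F' ∈ N -> R F' F -> exists y', y' ∈ y /\ F' ~[H] y').
Proof.
  set (D := Sep N (fun F => exists y, has_rank N R F y)).
  assert (HD : forall F, F ∈ D <-> F ∈ N /\ exists y, has_rank N R F y)
    by (apply in_Sep; dfn).
  assert (exists H, forall p, p ∈ H <->
    exists F, F ∈ D /\ exists y, p = Pair F y /\ has_rank N R F y) as [H HH].
  { apply (isset_repl (fun _ F p => exists y, p = Pair F y /\ has_rank N R F y)
      (fun _ => point)); [dfn|].
    intros F HF. apply HD in HF. destruct HF as (HF & y & Hy). exists (Pair F y).
    intro p. split.
    - intros (y' & -> & Hy'). f_equal. now apply (rank_unique F HF).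
    - intros ->. eauto. }
  assert (HF : forall F y, F ~[H] y <-> F ∈ N /\ has_rank N R F y).
  { intros F y. rewrite HH. split.
    - intros (F' & HF' & y' & E & Hy'). apply Pair_inj in E. destruct E as [<- <-].
      apply HD in HF'. tauto.
    - intros [HF Hy]. exists F. split; [apply HD; eauto|eauto]. }
  assert (G : rank_approx N R H).
  { intros F y Hy. apply HF in Hy. destruct Hy as (HFN & h & Gh & Hy).
    destruct (Gh F y Hy) as (_ & U & Dn). split; auto. split.
    - intros F' HF' HRF. destruct (U F' HF' HRF) as (y' & Hy' & K).
      exists y'. split; auto. apply HF. split; auto. now exists h.
    - intros y' Hy'. destruct (Dn y' Hy') as (F' & HF' & HRF & K). exists F'.
      split; auto. split; auto. apply HF. split; auto. now exists h. }
  exists H. split.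
  - apply (wf_ind (fun F => exists y, F ~[H] y)); [dfn|]. intros F HFN IH. apply NNPP. intro Hno.
    (* All predecessors of [F] are ranked, so replacement collects their ranks into [Y], and adding
       the pair of [F] and [Y] extends the solution. *)
    assert (exists Y, forall y', y' ∈ Y <->
      exists F', F' ∈ Sep N (fun F' => R F' F) /\ F' ~[H] y') as [Y HY].
    { apply (isset_repl (fun _ F' y' => F' ~[H] y') (fun _ => point)); [dfn|].
      intros F' HF'. rewrite in_Sep in HF' by dfn. destruct HF' as [HF' HRF].
      destruct (IH F' HF' HRF) as [y Hy]. exists y. intro y'. split; [|now intros ->].
      intro Hy'. apply HF in Hy, Hy'. apply (rank_unique F' HF'); tauto. }
    apply Hno. exists Y. apply HF. split; auto. exists (Add H (Pair F Y)).
    assert (K : forall F' y, F' ~[Add H (Pair F Y)] y <-> F' ~[H] y \/ F' = F /\ y = Y).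
    { intros F' y. rewrite in_Add, Pair_inj. tauto. }
    split; [|apply K; auto].
    intros F1 y1 H1. apply K in H1. destruct H1 as [H1|[-> ->]].
    + destruct (G F1 y1 H1) as (HF1 & U & Dn). split; auto. split.
      * intros F' HF' HRF. destruct (U F' HF' HRF) as (y' & Hy' & L).
        exists y'. rewrite K. auto.
      * intros y' Hy'. destruct (Dn y' Hy') as (F' & HF' & HRF & L).
        exists F'. rewrite K. auto.
    + split; auto. split.
      * intros F' HF' HRF. destruct (IH F' HF' HRF) as [y' Hy']. exists y'.
        rewrite K. split; auto. apply HY. exists F'. rewrite in_Sep by dfn. auto.
      * intros y' Hy'. apply HY in Hy'. destruct Hy' as (F' & HF' & L).
        rewrite in_Sep in HF' by dfn. exists F'. rewrite K. tauto.
  - intros F y F' Hy HF' HRF. destruct (G F y Hy) as (_ & U & _). auto.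
Qed.

End Collapse.

(** * Certificates *)

Section CertDefs.
Context {M : Type} {HM : model M}.

Definition ClosedAdd (K x : M) : Prop :=
  (exists z, z ∈ K /\ z = Emp) /\
  (forall k, k ∈ K -> forall u, u ∈ x -> exists k', k' ∈ K /\ k' = Add k u).

Definition HitsIn (a x U E u F : M) : Prop :=
  forall h, h ∈ F -> exists w, w ∈ E /\ exists y, y ∈ x /\ App2 a h u y /\ w ~[U] y.

Definition ApartIn (U x E0 E1 : M) : Prop :=
  forall y, y ∈ x -> forall z, z ∈ x -> forall w0, w0 ∈ E0 -> forall w1, w1 ∈ E1 ->
    w0 ~[U] y -> w1 ~[U] z -> ~ y ~[U] z.

(** Infinite members of [K] below [s] make this stronger than [Indep]. A strong hypothesis is
    welcome in [ShatterCert]; in [RankCert] the notion is only needed at finite [s], where the two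
    agree. *)
Definition IndepIn (K x a U E0 E1 s : M) : Prop :=
  forall F0, F0 ∈ K -> forall F1, F1 ∈ K -> F0 ⊆ s /\ F1 ⊆ s /\ Disj F0 F1 ->
    exists u, u ∈ x /\ HitsIn a x U E0 u F0 /\ HitsIn a x U E1 u F1.

(** One ranking relation for each label (U, E0, E1). Ranks are compared by membership, so foundation
    in the model provides the well-foundedness and no ordinals occur. The rank of the empty set
    starts the descent. *)
Definition RankCert (g x b a KX KG P Y : M) : Prop :=
  ClosedAdd KX x /\ ClosedAdd KG g /\
  (forall U, U ∈ b -> forall E0, E0 ∈ KX -> forall E1, E1 ∈ KX -> ApartIn U x E0 E1 ->
     exists r, r ∈ P /\
       (exists F, F ∈ KG /\ F = Emp /\ exists y, y ∈ Y /\ F ~[r] y) /\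
       (forall F, F ∈ KG -> forall y, y ∈ Y -> F ~[r] y ->
          forall F', F' ∈ KG -> forall h, h ∈ g ->
            F' = Add F h /\ ~ h ∈ F /\ IndepIn KG x a U E0 E1 F' ->
            exists y', y' ∈ Y /\ y' ∈ y /\ F' ~[r] y')).

Definition ShatterCert (g x b a U E0 E1 S K : M) : Prop :=
  U ∈ b /\ E0 ⊆ x /\ E1 ⊆ x /\ ApartIn U x E0 E1 /\ S ⊆ g /\
  ClosedAdd K S /\ ~ S ∈ K /\ IndepIn K x a U E0 E1 S.
End CertDefs.

#[export] Hint Unfold ClosedAdd HitsIn ApartIn IndepIn : dfn.

Section Certificates.
Context {M : Type} {HM : model M}.
Variables (g m e x v b a : M).
Hypothesis Hv : Uniformity x v.
Hypothesis Hbv : b ⊆ v.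
Hypothesis Ha : Action g m e x a.

Definition Fin (s : M) : M := Sep (Pow s) Finite.

Lemma in_Fin (s F : M) : F ∈ Fin s <-> F ⊆ s /\ Finite F.
Proof. unfold Fin. rewrite in_Sep by dfn. now rewrite in_Pow. Qed.

Lemma Fin_ClosedAdd (s : M) : ClosedAdd (Fin s) s.
Proof.
  split.
  - exists Emp. split; auto. apply in_Fin. split; [|apply Finite_Emp].
    intros z Hz. now apply in_Emp in Hz.
  - intros k Hk u Hu. exists (Add k u). split; auto. apply in_Fin in Hk. apply in_Fin.
    split; [|now apply Finite_Add]. intros z Hz. apply in_Add in Hz.
    destruct Hz as [Hz| ->]; [now apply Hk|auto].
Qed.

Lemma ClosedAdd_Finite (K s : M) : ClosedAdd K s -> forall F, Finite F -> F ⊆ s -> F ∈ K.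
Proof.
  intros [(z & Hz & ->) HA] F HF. pattern F. revert F HF. apply Finite_ind.
  - dfn.
  - auto.
  - intros F u _ _ IH H. destruct (HA F) with (u := u) as (k' & Hk' & ->); auto.
    + apply IH. intros w Hw. apply H, in_Add. auto.
    + apply H, in_Add. auto.
Qed.

Lemma HitsIn_iff U E u F : u ∈ x -> F ⊆ g -> (HitsIn a x U E u F <-> Hits a U E u F).
Proof.
  intros Hu HF. split; intros H h Hh.
  - destruct (H h Hh) as (w & Hw & y & Hy & Hy' & K).
    apply (act_App2 g m e x a Ha) in Hy'; auto. subst y. eauto.
  - destruct (H h Hh) as (w & Hw & K). exists w. split; auto. exists (op a h u).
    split; [apply (act_in g m e x a Ha); auto|]. split; auto.
    apply (act_App2 g m e x a Ha); auto.
Qed.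

Lemma ApartIn_iff U E0 E1 : U ∈ b -> (ApartIn U x E0 E1 <-> Apart U E0 E1).
Proof.
  intro HU. split.
  - intros H y z w0 w1 H0 H1 Hy Hz Hyz.
    destruct (unif_dom x v Hv U y z (Hbv U HU) Hyz) as [Hyx Hzx].
    apply (H y Hyx z Hzx w0 H0 w1 H1); auto.
  - intros H y _ z _ w0 H0 w1 H1. now apply H.
Qed.

Lemma IndepIn_Indep K U E0 E1 s :
  s ⊆ g -> ClosedAdd K s -> IndepIn K x a U E0 E1 s -> Indep x a U E0 E1 s.
Proof.
  intros Hs HK H F0 F1 Hf0 Hf1 Hs0 Hs1 Hd.
  destruct (H F0) with (F1 := F1) as (u & Hu & H0 & H1); auto.
  - now apply (ClosedAdd_Finite K s).
  - now apply (ClosedAdd_Finite K s).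
  - exists u. rewrite HitsIn_iff in H0, H1; auto.
Qed.

(** For the family of finite subsets the finiteness condition is immediate; for an arbitrary closed
    family it holds when [s] itself is finite, which is the case in [RankCert_sound]. *)
Lemma Indep_IndepIn K U E0 E1 s : s ⊆ g -> (forall F, F ∈ K -> F ⊆ s -> Finite F) ->
  Indep x a U E0 E1 s -> IndepIn K x a U E0 E1 s.
Proof.
  intros Hs HK H F0 HF0 F1 HF1 (Hs0 & Hs1 & Hd).
  destruct (H F0 F1) as (u & Hu & H0 & H1); auto.
  exists u. rewrite !HitsIn_iff; auto.
Qed.

Lemma Indep_sub U E0 E1 s s' : s ⊆ s' -> Indep x a U E0 E1 s' -> Indep x a U E0 E1 s.
Proof. intros Hs H F0 F1 Hf0 Hf1 Hs0 Hs1 Hd. apply H; auto. Qed.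

(** The family of all finite subsets of [S] is the least closed candidate; omitting [S] from it says
    exactly that [S] is infinite. *)
Lemma ShatterCert_iff U E0 E1 S :
  (exists K, ShatterCert g x b a U E0 E1 S K) <->
  U ∈ b /\ E0 ⊆ x /\ E1 ⊆ x /\ Apart U E0 E1 /\ S ⊆ g /\ ~ Finite S /\
  Indep x a U E0 E1 S.
Proof.
  split.
  - intros (K & HU & H0 & H1 & Hap & HS & HK & Hinf & Hind).
    rewrite ApartIn_iff in Hap by auto. do 5 (split; auto). split.
    + intro Hf. apply Hinf. now apply (ClosedAdd_Finite K S).
    + now apply (IndepIn_Indep K).
  - intros (HU & H0 & H1 & Hap & HS & Hinf & Hind). exists (Fin S).
    split; [auto|split; [auto|split; [auto|split; [|split; [auto|split; [|split]]]]]].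
    + now apply ApartIn_iff.
    + apply Fin_ClosedAdd.
    + rewrite in_Fin. tauto.
    + apply Indep_IndepIn; auto. intros F HF _. now apply in_Fin in HF.
Qed.

(* If [r] ranks the independent finite subsets of [g] by membership, the ranks of
   the finite subsets of an infinite independent set have no minimal element. *)
Lemma RankCert_sound KX KG P Y U E0 E1 S : RankCert g x b a KX KG P Y ->
  U ∈ b -> E0 ⊆ x -> E1 ⊆ x -> Finite E0 -> Finite E1 -> Apart U E0 E1 ->
  S ⊆ g -> ~ Finite S -> Indep x a U E0 E1 S -> False.
Proof.
  intros (HKX & HKG & H) HU H0 H1 Hf0 Hf1 Hap HS Hinf Hind.
  destruct (H U HU E0 (ClosedAdd_Finite KX x HKX E0 Hf0 H0)
              E1 (ClosedAdd_Finite KX x HKX E1 Hf1 H1))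
    as (r & _ & (F & _ & -> & y0 & Hy0 & Hr0) & Hr).
  { now apply ApartIn_iff. }
  set (W := Sep Y (fun y => exists F, Finite F /\ F ⊆ S /\ F ~[r] y)).
  assert (HW : forall y, y ∈ W <-> y ∈ Y /\ exists F, Finite F /\ F ⊆ S /\ F ~[r] y)
    by (apply in_Sep; dfn).
  destruct (foundation W y0) as (y & Hy & Hmin).
  { apply HW. split; auto. exists Emp. split; [apply Finite_Emp|]. split; auto.
    intros z Hz. now apply in_Emp in Hz. }
  apply HW in Hy. destruct Hy as (Hy & F & HF & HFS & HFy).
  assert (exists h, h ∈ S /\ h ∉ F) as (h & Hh & HhF).
  { apply NNPP. intro K. apply Hinf, (Finite_sub F); auto. intros h Hh.
    apply NNPP. intro. apply K. eauto. }
  assert (HF'S : Add F h ⊆ S).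
  { intros k Hk. apply in_Add in Hk. destruct Hk as [Hk| ->]; auto. }
  assert (HF' := Finite_Add F h HF).
  assert (HKGin := ClosedAdd_Finite KG g HKG).
  destruct (Hr F) with (y := y) (F' := Add F h) (h := h) as (y' & Hy' & Hy'y & K); auto.
  - split; auto. split; auto. apply Indep_IndepIn; auto.
    + intros F1 _ HF1. now apply (Finite_sub (Add F h)).
    + now apply (Indep_sub U E0 E1 _ S).
  - apply (Hmin y' Hy'y). apply HW. split; auto. eauto.
Qed.

(** The label is part of the node, so that one application of [rank_function] treats all labels at
    once and no choice among ranking functions arises. *)
Definition child (n' n : M) : Prop := exists U E0 E1 F h,
  n = Pair (Pair U (Pair E0 E1)) F /\ n' = Pair (Pair U (Pair E0 E1)) (Add F h) /\
  Apart U E0 E1 /\ h ∉ F /\ Indep x a U E0 E1 (Add F h).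

Lemma chain_finite (C : M) : chain C -> (exists c, c ∈ C) ->
  forall F, Finite F -> F ⊆ Union C -> exists c, c ∈ C /\ F ⊆ c.
Proof.
  intros HC [c0 Hc0] F HF. pattern F. revert F HF. apply Finite_ind.
  - dfn.
  - intros _. exists c0. split; auto. intros z Hz. now apply in_Emp in Hz.
  - intros F h _ _ IH H. destruct IH as (c & Hc & K).
    { intros z Hz. apply H, in_Add. auto. }
    assert (Hh : h ∈ Union C) by (apply H, in_Add; auto).
    apply in_Union in Hh. destruct Hh as (d & Hd & Hh).
    destruct (HC c d Hc Hd) as [L|L]; [exists d|exists c]; split; auto;
      intros z Hz; apply in_Add in Hz; destruct Hz as [Hz| ->]; auto.
Qed.

Hypothesis Hno : forall U E0 E1 S, U ∈ b -> E0 ⊆ x -> E1 ⊆ x -> Finite E0 -> Finite E1 ->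
  Apart U E0 E1 -> S ⊆ g -> ~ Finite S -> Indep x a U E0 E1 S -> False.

Let labels : M := Prod b (Prod (Fin x) (Fin x)).
Let nodes : M := Prod labels (Fin g).

(** Without a minimal node, the finite sets carrying one fixed label can always be extended. A
    maximal chain of them, provided by Zorn, has an infinite independent union, against [Hno]; the
    chain takes the place of a sequence obtained by dependent choice. *)
Lemma child_wf S : S ⊆ nodes -> (exists F, F ∈ S) ->
  exists F, F ∈ S /\ forall F', F' ∈ S -> ~ child F' F.
Proof.
  intros HS [n Hn]. apply NNPP. intro Hmin.
  assert (Hext : forall n, n ∈ S -> exists n', n' ∈ S /\ child n' n).
  { intros n' Hn'. apply NNPP. intro K. apply Hmin. exists n'. split; auto.
    intros n2 H2 Hc. eauto. }
  assert (Hn' := HS n Hn). apply in_Prod in Hn'. destruct Hn' as (l & F0 & Hl & _ & ->).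
  apply in_Prod in Hl. destruct Hl as (U & E & HU & HE & ->).
  apply in_Prod in HE. destruct HE as (E0 & E1 & HE0 & HE1 & ->).
  apply in_Fin in HE0, HE1.
  set (l := Pair U (Pair E0 E1)) in *.
  (* Children keep the label, so the descent from the chosen node stays among nodes labelled [l]. *)
  set (T := Sep (Fin g) (fun F => Pair l F ∈ S)).
  assert (HT : forall F, F ∈ T <-> F ∈ Fin g /\ Pair l F ∈ S) by (apply in_Sep; dfn).
  assert (HTS : forall F, Pair l F ∈ S -> F ∈ T).
  { intros F HF. apply HT. split; auto. apply HS, Pair_in_Prod in HF. tauto. }
  assert (HText : forall F, F ∈ T -> exists h, Add F h ∈ T /\ Apart U E0 E1 /\ h ∉ F /\
    Indep x a U E0 E1 (Add F h)).
  { intros F HF. apply HT in HF. destruct (Hext _ (proj2 HF)) as (n' & Hn' & K).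
    destruct K as (U' & E0' & E1' & F' & h & Ep & -> & Hap & Hh & Hind).
    unfold l in Ep. rewrite !Pair_inj in Ep.
    destruct Ep as ((<- & <- & <-) & <-). exists h. auto. }
  set (A := Sep (Pow T) chain).
  assert (HA : forall C, C ∈ A <-> C ⊆ T /\ chain C).
  { intro C. unfold A. rewrite in_Sep by dfn. now rewrite in_Pow. }
  destruct (zorn A (Upair F0 F0)) as (C & HC & HC0 & Hmax).
  - apply HA. split.
    + intros F HF. apply in_Upair in HF. assert (F = F0) as -> by tauto. auto.
    + intros F F' HF HF'. apply in_Upair in HF, HF'.
      left. assert (F = F0) as -> by tauto. assert (F' = F0) as -> by tauto. auto.
  - intros D HD Hch _. apply HA. split.
    + intros F HF. apply in_Union in HF. destruct HF as (C & HC & HF).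
      apply HD, HA in HC. now apply HC.
    + intros F F' HF HF'. apply in_Union in HF, HF'.
      destruct HF as (C & HC & HF), HF' as (C' & HC' & HF').
      assert (L := proj1 (HA _) (HD _ HC)). assert (L' := proj1 (HA _) (HD _ HC')).
      destruct (Hch C C' HC HC') as [K|K]; [apply L'|apply L]; auto.
  - assert (HCA := HC). apply HA in HC. destruct HC as [HCT HCch].
    assert (Hne : exists c, c ∈ C).
    { exists F0. apply HC0, in_Upair. auto. }
    assert (Hap : Apart U E0 E1).
    { destruct Hne as [c Hc]. destruct (HText c (HCT c Hc)) as (h & _ & K & _). exact K. }
    apply (Hno U E0 E1 (Union C)); try tauto.
    + intros h Hh. apply in_Union in Hh. destruct Hh as (c & Hc & Hh).
      apply HCT, HT in Hc. destruct Hc as [Hc _]. apply in_Fin in Hc. now apply Hc.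
    (* A finite union would lie inside a single member [c]. The extension of [c] by [h] could then
       be added to the chain, so by maximality it already belongs to it, and [h] would be in [c]. *)
    + intro Hfin. destruct (chain_finite C HCch Hne (Union C) Hfin) as (c & Hc & Hsub); auto.
      destruct (HText c (HCT c Hc)) as (h & Hh & _ & Hhc & _).
      assert (Hle : forall d, d ∈ C -> d ⊆ c).
      { intros d Hd w Hw. apply Hsub, in_Union. eauto. }
      assert (Ec : Add C (Add c h) = C).
      { apply Hmax; [|intros d Hd; apply in_Add; auto]. apply HA. split.
        - intros d Hd. apply in_Add in Hd. destruct Hd as [Hd| ->]; auto.
        - assert (Hle' : forall d, d ∈ C -> d ⊆ Add c h).
          { intros d Hd w Hw. apply in_Add. left. now apply (Hle d). }
          intros d d' Hd Hd'. apply in_Add in Hd, Hd'.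
          destruct Hd as [Hd| ->], Hd' as [Hd'| ->];
            [apply HCch|left; apply Hle'|right; apply Hle'|left]; auto. }
      apply Hhc, (Hle (Add c h)).
      * rewrite <- Ec. apply in_Add. auto.
      * apply in_Add. auto.
    + intros F1 F2 Hf1 Hf2 Hs1 Hs2 Hd.
      destruct (chain_finite C HCch Hne (Cup F1 F2)) as (c & Hc & Hsub).
      { now apply Finite_Cup. }
      { intros h Hh. apply in_Cup in Hh. destruct Hh; auto. }
      destruct (HText c (HCT c Hc)) as (h & _ & _ & _ & Hind).
      apply Hind; auto; intros k Hk; apply in_Add; left; apply Hsub, in_Cup; auto.
Qed.

Lemma RankCert_exists : exists KX KG P Y, RankCert g x b a KX KG P Y.
Proof.
  destruct (rank_function nodes child) as (H & Htot & Hdec).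
  { unfold child. dfn. }
  { exact child_wf. }
  (* Second components of the pairs in [H], hence all ranks, lie in this set. *)
  set (Y := Union (Union H)).
  assert (HY : forall n y, n ~[H] y -> y ∈ Y).
  { intros n y Hy. apply in_Union. exists (Upair n y). split; [|apply in_Upair; auto].
    apply in_Union. exists (Pair n y). split; auto. apply in_Upair. auto. }
  set (r := fun l => Rsep (Fin g) Y (fun F y => Pair l F ~[H] y)).
  assert (Hr : forall l F y, F ~[r l] y <-> F ∈ Fin g /\ y ∈ Y /\ Pair l F ~[H] y).
  { intro l. apply in_Rsep. dfn. }
  exists (Fin x), (Fin g), (Img labels r), Y.
  split; [apply Fin_ClosedAdd|]. split; [apply Fin_ClosedAdd|].
  intros U HU E0 HE0 E1 HE1 Hap. apply ApartIn_iff in Hap; auto.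
  assert (Hl : Pair U (Pair E0 E1) ∈ labels).
  { unfold labels. rewrite !Pair_in_Prod. auto. }
  set (l := Pair U (Pair E0 E1)) in *.
  exists (r l). split.
  { unfold r. rewrite in_Img by dfn. eauto. }
  assert (Hemp : Emp ∈ Fin g).
  { destruct (Fin_ClosedAdd g) as [(z & Hz & ->) _]. exact Hz. }
  split.
  - exists Emp. split; auto. split; auto.
    destruct (Htot (Pair l Emp)) as [y Hy]; [now apply Pair_in_Prod|].
    exists y. split; [eauto|]. apply Hr. eauto.
  - intros F HF y Hy HFy F' HF' h Hh (-> & HhF & Hind).
    apply Hr in HFy. destruct HFy as (_ & _ & HFy).
    destruct (Hdec (Pair l F) y (Pair l (Add F h))) as (y' & Hy' & K); auto.
    + now apply Pair_in_Prod.
    + exists U, E0, E1, F, h. do 4 (split; auto).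
      assert (HF'g := proj1 (proj1 (in_Fin g _) HF')).
      apply (IndepIn_Indep (Fin g)); auto. destruct (Fin_ClosedAdd g) as [Z1 Z2].
      split; auto.
    + exists y'. split; [eauto|]. split; auto. apply Hr. eauto.
Qed.

End Certificates.

(** * Tameness of the completion of a preflow *)

Section Main.
Context {M : Type} {HM : model M}.

(** [Preflow] and [TameCompletion] quantify the unit separately; this identifies the two. *)
Lemma unit_unique (g m e e' : M) : Group g m e -> Group g m e' -> e = e'.
Proof.
  intros Hg Hg'. pose proof Hg as (_ & _ & _ & Hu & _).
  rewrite <- (mul_unit_r g m e' Hg' e (unit_in g m e Hg)). symmetry.
  apply (mul_App2 g m e' Hg'); [apply (unit_in g m e Hg)|apply (unit_in g m e' Hg')|].
  now apply Hu, (unit_in g m e').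
Qed.

Variables g m n x b a : M.
Hypothesis Hpf : Preflow g m n x b a.

Lemma tame_no_shattering : TameCompletion g m n x b a ->
  ~ exists U E0 E1 S K, ShatterCert g x b a U E0 E1 S K.
Proof.
  intros (e & s & Hs & Hn & z & vz & t & i & α & HZ & Hflow & Hext & Htame)
    (U & E0 & E1 & S & HK).
  destruct Hpf as (e' & (s' & Hs' & _) & (v & tx & Hv & _ & _ & Hbv & Hbase & _)
    & Hpre & Ha & _).
  assert (e' = e) by exact (unit_unique g m e' e (proj1 Hs') (proj1 Hs)). subst e'.
  apply (ShatterCert_iff g m e x v b a Hv Hbv Ha) in HK.
  destruct HK as (HU & H0 & H1 & Hap & HS & Hinf & Hind).
  exact (independent_not_tame g m e s x b a z vz t i α Ha HZ Hflow Hext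
    U E0 E1 S HU H0 H1 Hap HS Hinf Hind Htame).
Qed.

Lemma no_shattering_rank : ~ (exists U E0 E1 S K, ShatterCert g x b a U E0 E1 S K) ->
  exists KX KG P Y, RankCert g x b a KX KG P Y.
Proof.
  intro Hno. destruct Hpf as (e & _ & (v & t & Hv & _ & _ & Hbv & _) & _ & Ha & _).
  apply (RankCert_exists g m e x v b a Hv Hbv Ha).
  intros U E0 E1 S HU H0 H1 _ _ Hap HS Hinf Hind. apply Hno. exists U, E0, E1, S.
  apply (ShatterCert_iff g m e x v b a Hv Hbv Ha). tauto.
Qed.

(** The one implication that has to produce a completion. Non-tameness of it would give finite [E0]
    and [E1], and these are the labels that the rank certificate is sure to cover. *)
Lemma rank_tame : (exists KX KG P Y, RankCert g x b a KX KG P Y) ->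
  TameCompletion g m n x b a.
Proof.
  intros (KX & KG & P & Y & HR).
  destruct (Preflow_completion g m n x b a Hpf)
    as (e & s & Hs & Hn & z & vz & t & i & α & HZ & Hflow & Hext).
  exists e, s. split; auto. split; auto. exists z, vz, t, i, α.
  do 3 (split; auto). apply NNPP. intro Hnt.
  destruct Hpf as (e' & (s' & Hs' & _) & (v & tx & Hv & _ & _ & Hbv & Hbase & _)
    & Hpre & Ha & _).
  assert (e' = e) by exact (unit_unique g m e' e (proj1 Hs') (proj1 Hs)). subst e'.
  destruct (not_tame_independent g m e s x b v a z vz t i α Hv Hbv Hbase Hpre Ha HZ
    Hflow Hext Hnt) as (U & E0 & E1 & S & HU & H0 & H1 & Hf0 & Hf1 & Hap & HS & Hinf & Hind).
  exact (RankCert_sound g m e x v b a Hv Hbv Ha KX KG P Y U E0 E1 S HR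
    HU H0 H1 Hf0 Hf1 Hap HS Hinf Hind).
Qed.
End Main.

(** * The formulas *)

Section Formulas.
Local Open Scope fm_scope.

Definition bEmpty (z : nat) : fm := ∀ w ∈ z, fun _ => fFalse.
(** The formulas for pairs and graphs used in the statement quantify over all sets. In these
    variants every quantifier is restricted to a set at hand. *)
Definition bPair (d x y : nat) : fm := x ∈ d ∧ y ∈ d ∧ (∀ w ∈ d, w ≡ x ∨ w ≡ y).
Definition bOpair (p x y : nat) : fm :=
  ∃ s ∈ p, ∃ d ∈ p, bPair s x x ∧ bPair d x y ∧ (∀ z ∈ p, z ≡ s ∨ z ≡ d).
Definition bRel (r x y : nat) : fm := ∃ p ∈ r, bOpair p x y.
(** The inner pair [q] is reached from [p] in two membership steps, since it belongs to both
    elements of the Kuratowski pair of [q] and [z]. *)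
Definition bApp2 (f x y z : nat) : fm :=
  ∃ p ∈ f, ∃ s ∈ p, ∃ q ∈ s, bOpair q x y ∧ bOpair p q z.
Definition bAdd (k' k u : nat) : fm :=
  (∀ w ∈ k, w ∈ k') ∧ u ∈ k' ∧ (∀ w ∈ k', w ∈ k ∨ w ≡ u).

Definition closed_add (K x : nat) : fm :=
  (∃ z ∈ K, bEmpty z) ∧ (∀ k ∈ K, ∀ u ∈ x, ∃ k' ∈ K, bAdd k' k u).
Definition hits_in (a x U E u F : nat) : fm :=
  ∀ h ∈ F, ∃ w ∈ E, ∃ y ∈ x, bApp2 a h u y ∧ bRel U w y.
Definition apart_in (U x E0 E1 : nat) : fm :=
  ∀ y ∈ x, ∀ z ∈ x, ∀ w0 ∈ E0, ∀ w1 ∈ E1,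
    bRel U w0 y → bRel U w1 z → ¬ bRel U y z.
Definition indep_in (K x a U E0 E1 s : nat) : fm :=
  ∀ F0 ∈ K, ∀ F1 ∈ K, subset F0 s ∧ subset F1 s ∧ disjoint F0 F1 →
    ∃ u ∈ x, hits_in a x U E0 u F0 ∧ hits_in a x U E1 u F1.
Definition rank_cert (g x b a KX KG P Y : nat) : fm :=
  closed_add KX x ∧ closed_add KG g ∧
  (∀ U ∈ b, ∀ E0 ∈ KX, ∀ E1 ∈ KX, apart_in U x E0 E1 →
     ∃ r ∈ P,
       (∃ F ∈ KG, bEmpty F ∧ (∃ y ∈ Y, bRel r F y)) ∧
       (∀ F ∈ KG, ∀ y ∈ Y, bRel r F y → ∀ F' ∈ KG, ∀ h ∈ g,
          bAdd F' F h ∧ ¬ (h ∈ F) ∧ indep_in KG x a U E0 E1 F' →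
          ∃ y' ∈ Y, y' ∈ y ∧ bRel r F' y')).
Definition shatter_cert (g x b a U E0 E1 S K : nat) : fm :=
  U ∈ b ∧ subset E0 x ∧ subset E1 x ∧ apart_in U x E0 E1 ∧ subset S g ∧
  closed_add K S ∧ ¬ (S ∈ K) ∧ indep_in K x a U E0 E1 S.

End Formulas.

(** Variables 6 to 9 are the witnesses, and 10 is the first name free for binding. The shattering
    matrix has five witnesses, 6 to 10, and binds from 11 on. *)
Definition rank_matrix : form := rank_cert 0 3 4 5 6 7 8 9 10.
Definition shatter_matrix : form := shatter_cert 0 3 4 5 6 7 8 9 10 11.

Lemma rank_matrix_bounded : bounded rank_matrix.
Proof. cbv. repeat constructor; discriminate. Qed.

Lemma shatter_matrix_bounded : bounded (fImp shatter_matrix fFalse).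
Proof. cbv. repeat constructor; discriminate. Qed.

(** * Evaluation of the formulas *)

Section Evaluation.
Context {M : Type} {HM : model M}.
Implicit Types (v : nat -> M).

Lemma sat_all f k v (P : M -> Prop) :
  (forall a, sat mem (upd v k a) (f k (S k)) <-> P a) ->
  sat mem v (mAll f k) <-> (forall a, P a).
Proof. intro H. split; intros K a; apply H, K. Qed.

Lemma sat_ex f k v (P : M -> Prop) :
  (forall a, sat mem (upd v k a) (f k (S k)) <-> P a) ->
  sat mem v (mEx f k) <-> (exists a, P a).
Proof. intro H. split; intros [a K]; exists a; apply H, K. Qed.

Lemma sat_and p q k v (P Q : Prop) : (sat mem v (p k) <-> P) -> (sat mem v (q k) <-> Q) ->
  sat mem v (mAnd p q k) <-> P /\ Q.
Proof. simpl. tauto. Qed.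

Lemma sat_or p q k v (P Q : Prop) : (sat mem v (p k) <-> P) -> (sat mem v (q k) <-> Q) ->
  sat mem v (mOr p q k) <-> P \/ Q.
Proof. simpl. tauto. Qed.

Lemma sat_imp p q k v (P Q : Prop) : (sat mem v (p k) <-> P) -> (sat mem v (q k) <-> Q) ->
  sat mem v (mImp p q k) <-> (P -> Q).
Proof. simpl. tauto. Qed.

Lemma sat_iff p q k v (P Q : Prop) : (sat mem v (p k) <-> P) -> (sat mem v (q k) <-> Q) ->
  sat mem v (mIff p q k) <-> (P <-> Q).
Proof. simpl. tauto. Qed.

Lemma sat_not p k v (P : Prop) : (sat mem v (p k) <-> P) ->
  sat mem v (mNot p k) <-> ~ P.
Proof. simpl. tauto. Qed.

(** The left sides of the lemmas from here on are what [sat] yields on the unfolded formulas, with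
    subformulas already evaluated where convenient; extensionality turns most of them into equations
    between sets. *)
Lemma eval_upair (z x y : M) : (forall w, w ∈ z <-> w = x \/ w = y) <-> z = Upair x y.
Proof.
  split; [|intros ->; apply in_Upair]. intro H. apply set_ext. intro w.
  now rewrite in_Upair.
Qed.

Lemma eval_opair (p x y : M) :
  (forall z, z ∈ p <-> (forall w, w ∈ z <-> w = x \/ w = x) \/
                       (forall w, w ∈ z <-> w = x \/ w = y)) <-> p = Pair x y.
Proof.
  setoid_rewrite eval_upair. apply eval_upair.
Qed.

Lemma eval_rel (r x y : M) :
  (exists p, p ∈ r /\ forall z, z ∈ p <-> (forall w, w ∈ z <-> w = x \/ w = x) \/
                       (forall w, w ∈ z <-> w = x \/ w = y)) <-> x ~[r] y.
Proof.
  setoid_rewrite eval_opair. split; [intros (p & Hp & ->); exact Hp|eauto].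
Qed.

Lemma eval_app2 (f x y z : M) :
  (exists p, p ∈ f /\ exists q,
    (forall z, z ∈ q <-> (forall w, w ∈ z <-> w = x \/ w = x) \/
                       (forall w, w ∈ z <-> w = x \/ w = y)) /\
    (forall r, r ∈ p <-> (forall w, w ∈ r <-> w = q \/ w = q) \/
                       (forall w, w ∈ r <-> w = q \/ w = z))) <-> App2 f x y z.
Proof.
  setoid_rewrite eval_opair. unfold App2.
  split; [intros (p & Hp & q & -> & ->); exact Hp|eauto].
Qed.

Lemma eval_relation (r x y : M) :
  (forall p, p ∈ r -> exists u, u ∈ x /\ exists s, s ∈ y /\
     forall z, z ∈ p <-> (forall w, w ∈ z <-> w = u \/ w = u) \/
                       (forall w, w ∈ z <-> w = u \/ w = s)) <-> r ⊆ Prod x y.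
Proof.
  setoid_rewrite eval_opair. setoid_rewrite in_Prod.
  split; intros H p Hp; destruct (H p Hp) as (u & K); exists u; firstorder.
Qed.

Lemma eval_product (r x y : M) :
  r ⊆ Prod x y /\ (forall u, u ∈ x -> forall w, w ∈ y -> u ~[r] w) <-> r = Prod x y.
Proof.
  split.
  - intros [H K]. apply sub_antisym; auto. intros p Hp. apply in_Prod in Hp.
    destruct Hp as (u & w & Hu & Hw & ->). auto.
  - intros ->. split; auto. intros u Hu w Hw. now apply Pair_in_Prod.
Qed.

Lemma eval_func2 (f x y z : M) :
  (exists d, d = Prod x y /\ Func f d z) <-> Func f (Prod x y) z.
Proof. split; [intros (d & -> & H); exact H|eauto]. Qed.

Lemma eval_inter (z x y : M) : (forall w, w ∈ z <-> w ∈ x /\ w ∈ y) <-> z = Cap x y.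
Proof.
  split; [|intros ->; apply in_Cap]. intro H. apply set_ext. intro w. now rewrite in_Cap.
Qed.

Lemma eval_union (z x : M) : (forall w, w ∈ z <-> exists y, y ∈ x /\ w ∈ y) <-> z = Union x.
Proof.
  split; [|intros ->; apply in_Union]. intro H. apply set_ext. intro w. now rewrite in_Union.
Qed.

Lemma eval_succ (z x : M) : (forall w, w ∈ z <-> w ∈ x \/ w = x) <-> z = Add x x.
Proof.
  split; [|intros -> w; apply in_Add]. intro H. apply set_ext. intro w. now rewrite in_Add.
Qed.

Lemma eval_inductive (i : M) :
  (exists z, z ∈ i /\ ~ exists w, w ∈ z) /\
  (forall n, n ∈ i -> exists s, s ∈ i /\ s = Add n n) <-> Ind i.
Proof.
  assert (HE : forall z : M, (~ exists w, w ∈ z) <-> z = Emp).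
  { intro z. split.
    - intro H. apply set_ext. intro w. rewrite in_Emp. firstorder.
    - intros -> [w Hw]. now apply in_Emp in Hw. }
  setoid_rewrite HE. split.
  - intros [(z & Hz & ->) H]. split; auto. intros k Hk. destruct (H k Hk) as (s & Hs & ->). auto.
  - intros [H K]. split; eauto.
Qed.

Lemma eval_bEmpty (z : M) : (forall w, w ∈ z -> False) <-> z = Emp.
Proof.
  split; [|intros -> w Hw; now apply in_Emp in Hw].
  intro H. apply set_ext. intro w. rewrite in_Emp. firstorder.
Qed.

Lemma eval_bPair (d x y : M) :
  x ∈ d /\ y ∈ d /\ (forall w, w ∈ d -> w = x \/ w = y) <-> d = Upair x y.
Proof.
  rewrite <- eval_upair. split.
  - intros (Hx & Hy & H) w. split; [auto|intros [-> | ->]; auto].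
  - intro H. rewrite !H. split; auto. split; auto. intro w. now rewrite H.
Qed.

Lemma eval_bOpair (p x y : M) :
  (exists s, s ∈ p /\ exists d, d ∈ p /\
    (x ∈ s /\ x ∈ s /\ (forall w, w ∈ s -> w = x \/ w = x)) /\
    (x ∈ d /\ y ∈ d /\ (forall w, w ∈ d -> w = x \/ w = y)) /\
    (forall z, z ∈ p -> z = s \/ z = d)) <-> p = Pair x y.
Proof.
  setoid_rewrite eval_bPair. unfold Pair. rewrite <- eval_bPair. split.
  - intros (s & Hs & d & Hd & -> & -> & H). auto.
  - intros (Hs & Hd & H). eauto 8.
Qed.

Lemma eval_bRel (r x y : M) : (exists p, p ∈ r /\ p = Pair x y) <-> x ~[r] y.
Proof. split; [intros (p & Hp & ->); exact Hp|eauto]. Qed.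

Lemma eval_bApp2 (f x y z : M) :
  (exists p, p ∈ f /\ exists s, s ∈ p /\ exists q, q ∈ s /\
     q = Pair x y /\ p = Pair q z) <-> App2 f x y z.
Proof.
  unfold App2. split.
  - intros (p & Hp & s & _ & q & _ & -> & ->). exact Hp.
  - intro H. exists (Pair (Pair x y) z). split; auto.
    exists (Upair (Pair x y) z). split; [apply in_Upair; auto|].
    exists (Pair x y). split; [apply in_Upair; auto|auto].
Qed.

Lemma eval_bAdd (k' k u : M) :
  (forall w, w ∈ k -> w ∈ k') /\ u ∈ k' /\ (forall w, w ∈ k' -> w ∈ k \/ w = u) <->
  k' = Add k u.
Proof.
  split.
  - intros (H1 & H2 & H3). apply set_ext. intro w. rewrite in_Add.
    split; [auto|intros [| ->]; auto].
  - intros ->. setoid_rewrite in_Add. auto.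
Qed.

End Evaluation.

(** Descends through formula and predicate in parallel. Variable names are numerals, so [upd]
    reduces and atoms agree by conversion; the [eval] lemmas serve the formulas that are represented
    by set operations on the other side. *)
Ltac eval_form :=
  cbv beta;
  lazymatch goal with
  | |- sat _ _ (opair _ _ _ _) <-> _ => exact (eval_opair _ _ _)
  | |- sat _ _ (rel _ _ _ _) <-> _ => exact (eval_rel _ _ _)
  | |- sat _ _ (app2 _ _ _ _ _) <-> _ => exact (eval_app2 _ _ _ _)
  | |- sat _ _ (relation _ _ _ _) <-> _ => exact (eval_relation _ _ _)
  | |- sat _ _ (inter _ _ _ _) <-> _ => exact (eval_inter _ _ _)
  | |- sat _ _ (union _ _ _) <-> _ => exact (eval_union _ _)
  | |- sat _ _ (succ _ _ _) <-> _ => exact (eval_succ _ _)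
  | |- sat _ _ (bEmpty _ _) <-> _ => exact (eval_bEmpty _)
  | |- sat _ _ (bOpair _ _ _ _) <-> _ => exact (eval_bOpair _ _ _)
  | |- sat _ _ (bAdd _ _ _ _) <-> _ => exact (eval_bAdd _ _ _)
  | |- sat _ _ (product _ _ _ _) <-> _ =>
      refine (iff_trans _ (eval_product _ _ _)); unfold product; eval_form
  | |- sat _ _ (func2 _ _ _ _ _) <-> _ =>
      refine (iff_trans _ (eval_func2 _ _ _ _)); unfold func2; eval_form
  | |- sat _ _ (func _ _ _ _) <-> _ => unfold func, Func; eval_form
  | |- sat _ _ (inductive _ _) <-> _ =>
      refine (iff_trans _ (eval_inductive _)); unfold inductive; eval_form
  | |- sat _ _ (bRel _ _ _ _) <-> _ =>
      refine (iff_trans _ (eval_bRel _ _ _)); unfold bRel; eval_form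
  | |- sat _ _ (bApp2 _ _ _ _ _) <-> _ =>
      refine (iff_trans _ (eval_bApp2 _ _ _ _)); unfold bApp2; eval_form
  | |- sat _ _ (mMem _ _ _) <-> _ => exact (iff_refl _)
  | |- sat _ _ (mEq _ _ _) <-> _ => exact (iff_refl _)
  | |- sat _ _ (subset _ _ _) <-> _ => exact (iff_refl _)
  | |- sat _ _ (empty _ _) <-> _ => exact (iff_refl _)
  | |- sat _ _ (disjoint _ _ _) <-> _ => exact (iff_refl _)
  | |- sat _ ?v (mAll ?f ?k) <-> (forall a, @?P a) =>
      apply (sat_all f k v P); intro; eval_form
  | |- sat _ ?v (mEx ?f ?k) <-> (exists a, @?P a) =>
      apply (sat_ex f k v P); intro; eval_form
  | |- sat _ _ (mAnd _ _ _) <-> _ => apply sat_and; eval_form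
  | |- sat _ _ (mOr _ _ _) <-> _ => apply sat_or; eval_form
  | |- sat _ _ (mImp _ _ _) <-> _ => apply sat_imp; eval_form
  | |- sat _ _ (mIff _ _ _) <-> _ => apply sat_iff; eval_form
  | |- sat _ _ (mNot _ _) <-> _ => apply sat_not; eval_form
  end.

Section Evaluated.
Context {M : Type} {HM : model M}.

Lemma sat_is_preflow v :
  sat mem v is_preflow <-> Preflow (v 0) (v 1) (v 2) (v 3) (v 4) (v 5).
Proof.
  unfold is_preflow, preflow, top_group, group, base_at, uniform_space, precompact,
    action, topology, hausdorff, continuous2, uniformity, uniform_topology,
    regular_open2, in_closure2, finite, natural, bijection.
  unfold Preflow, TopGroup, Group, BaseAt, UniformSpace, Precompact,
    Action, Topology, Hausdorff, Cont2, Uniformity, UTop, RegOpen2, InCl2,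
    Finite, Natural, Biject.
  eval_form.
Qed.

Lemma sat_completion_is_tame v :
  sat mem v completion_is_tame <-> TameCompletion (v 0) (v 1) (v 2) (v 3) (v 4) (v 5).
Proof.
  unfold completion_is_tame, tame_completion, completion, flow, tame, shatters,
    top_group, group, base_at, compact, complete, filter, cauchy, in_closure,
    action, topology, hausdorff, continuous2, uniformity, uniform_topology,
    finite, natural, bijection.
  unfold TameCompletion, Completion, Flow, Extends, Tame, Shatters,
    TopGroup, Group, BaseAt, Compact, Complete, Filter, Cauchy, InCl,
    Action, Topology, Hausdorff, Cont2, Uniformity, UTop,
    Finite, Natural, Biject.
  eval_form.
Qed.

Lemma sat_rank_matrix v : sat mem v rank_matrix <->
  RankCert (v 0) (v 3) (v 4) (v 5) (v 6) (v 7) (v 8) (v 9).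
Proof.
  unfold rank_matrix, rank_cert, closed_add, indep_in, apart_in, hits_in.
  unfold RankCert, ClosedAdd, IndepIn, ApartIn, HitsIn.
  eval_form.
Qed.

Lemma sat_shatter_matrix v : sat mem v shatter_matrix <->
  ShatterCert (v 0) (v 3) (v 4) (v 5) (v 6) (v 7) (v 8) (v 9) (v 10).
Proof.
  unfold shatter_matrix, shatter_cert, closed_add, indep_in, apart_in, hits_in.
  unfold ShatterCert, ClosedAdd, IndepIn, ApartIn, HitsIn.
  eval_form.
Qed.

End Evaluated.

(** * The two normal forms *)

Lemma ZFC_equiv_refl p : ZFC_equiv p p.
Proof. intros M E _ v. simpl. tauto. Qed.

Lemma bounded_Delta0 p : bounded p -> Delta0 p.
Proof. intro H. exists p. split; [exact H|apply ZFC_equiv_refl]. Qed.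

Theorem proposition11p4 : Delta1_given is_preflow completion_is_tame.
Proof.
  split.
  - exists (List.fold_right fEx rank_matrix [6; 7; 8; 9]). split.
    + exists [6; 7; 8; 9], rank_matrix.
      split; [exact (bounded_Delta0 _ rank_matrix_bounded)|apply ZFC_equiv_refl].
    + intros M E HE v.
      (* The given assignment shows that the structure is inhabited and supplies [point]. *)
      set (HM := {| mem := E; mem_ZFC := HE; point := v 0 |} : model M).
      change (sat (@mem M HM) v is_preflow ->
        (sat (@mem M HM) v completion_is_tame <->
         exists a0 a1 a2 a3, sat (@mem M HM) (upd (upd (upd (upd v 6 a0) 7 a1) 8 a2) 9 a3)
           rank_matrix)).
      rewrite sat_is_preflow, sat_completion_is_tame. intro Hpf.
      setoid_rewrite sat_rank_matrix. split.
      * intro H. exact (no_shattering_rank _ _ _ _ _ _ Hpf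
          (tame_no_shattering _ _ _ _ _ _ Hpf H)).
      * exact (rank_tame _ _ _ _ _ _ Hpf).
  - exists (List.fold_right fAll (fImp shatter_matrix fFalse) [6; 7; 8; 9; 10]). split.
    + exists [6; 7; 8; 9; 10], (fImp shatter_matrix fFalse).
      split; [exact (bounded_Delta0 _ shatter_matrix_bounded)|apply ZFC_equiv_refl].
    + intros M E HE v.
      set (HM := {| mem := E; mem_ZFC := HE; point := v 0 |} : model M).
      change (sat (@mem M HM) v is_preflow ->
        (sat (@mem M HM) v completion_is_tame <->
         forall a0 a1 a2 a3 a4, ~ sat (@mem M HM)
           (upd (upd (upd (upd (upd v 6 a0) 7 a1) 8 a2) 9 a3) 10 a4) shatter_matrix)).
      rewrite sat_is_preflow, sat_completion_is_tame. intro Hpf.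
      setoid_rewrite sat_shatter_matrix. split.
      * intros H a0 a1 a2 a3 a4 K. apply (tame_no_shattering _ _ _ _ _ _ Hpf H).
        now exists a0, a1, a2, a3, a4.
      * intro H. apply (rank_tame _ _ _ _ _ _ Hpf), (no_shattering_rank _ _ _ _ _ _ Hpf).
        intros (a0 & a1 & a2 & a3 & a4 & K). exact (H a0 a1 a2 a3 a4 K).
Qed.
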